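(* Assume the setting and standing assumptions described in the context (clamped linear viscoelastic Timoshenko beam). Let $(\theta,w,\gamma)\in L^1_{\mathcal{J}}(\mathbb{H}\times L^2(\Omega))$ be the solution of the mixed problem (M) and let $(\theta_h,w_h,\gamma_h)\in L^1_{\mathcal{J}}(\mathbb{H}_h\times\mathcal{Q}_h^r)$ be the solution of its semi-discretization (M$_h$). If $q_E\in L^1_{\mathcal{J}}(H^r(\Omega))$, then there exists a constant $C>0$, independent of $h$ and $\lambda$, such that $$\|(\theta,w)-(\theta_h,w_h)\|_{L^1_{\mathcal{J}}(\mathbb{H})}+\|\gamma-\gamma_h\|_{L^1_{\mathcal{J}}(L^2(\Omega))}\le Ch^r\|q_E\|_{L^1_{\mathcal{J}}(H^r(\Omega))}.$$
   Context: $\Omega=[0,L]$, $\mathcal{J}=[0,T]$; $L^1_{\mathcal{J}}(\mathcal{B})$ is the Bochner space $L^1(\mathcal{J};\mathcal{B})$; $(\cdot,\cdot)_{0,\Omega}$ is the $L^2(\Omega)$ inner product; primes denote $d/dx$. $\mathbb{H}=H_0^1(\Omega)\times H_0^1(\Omega)$ with $\|(\eta,v)\|_{\mathbb{H}}^2=\|\eta'\|_{L^2(\Omega)}^2+\|v'\|_{L^2(\Omega)}^2$. Data: $E$ is the relaxation modulus, $\nu$ the (time-independent) Poisson ratio, $\hat{I}=I/\varepsilon^3$, $\hat{A}=k_sA/\varepsilon$ are the scaled moment of inertia and cross-section area ($I(x)$ the moment of inertia, $A(x)$ the area, $k_s$ the correction factor), where the thickness parameter $\varepsilon\in(0,\varepsilon_{\max}]$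 is given by $\varepsilon^2=\frac1L\int_\Omega\frac{I(x)}{A(x)L^2}dx$, and $\lambda=2(1+\nu)\varepsilon^2$. The load $q\in L^1_{\mathcal{J}}(L^2(\Omega))$ is independent of $\varepsilon$ and $q_E=q/E(0)$. It is assumed that there are positive constants $\underline{C}_E,\overline{C}_E,\underline{C}_G,\overline{C}_G$ with $\underline{C}_E\le E(0)\hat{I}(x)\le\overline{C}_E$ and $\underline{C}_G\le\frac{E(0)}{2(1+\nu)}\hat{A}(x)\le\overline{C}_G$, and that the kernel $k(t,s)=\dot{E}(t-s)/E(0)$ is continuous and bounded on $0\le s\le t\le T$. Mixed problem (M): find $(\theta,w,\gamma)\in L^1_{\mathcal{J}}(\mathbb{H}\times L^2(\Omega))$ such that, a.e. in $\mathcal{J}$, for all $(\eta,v)\in\mathbb{H}$ and $\psi\in L^2(\Omega)$, $$\begin{aligned}&(\hat{I}\theta',\eta')_{0,\Omega}+(\gamma,\eta-v')_{0,\Omega}=(q_E,v)_{0,\Omega}+\int_0^t\frac{\dot{E}(t-s)}{E(0)}\big[(\hat{I}\theta'(s),\eta')_{0,\Omega}+(\gamma(s),\eta-v')_{0,\Omega}\big]ds,\\&(\theta-w',\psi)_{0,\Omega}-\lambda(\gamma/\hat{A},\psi)_{0,\Omega}=0.\end{aligned}$$ Standing regularity result used by the paper: for $k\ge2$ (with $H^0=L^2$) the solution satisfies $\|\theta\|_{L^1_{\mathcal{J}}(H^k(\Omega))}+\|w\|_{L^1_{\mathcal{J}}(H^k(\Omega))}+\|\gamma\|_{L^1_{\mathcal{J}}(H^{k-1}(\Omega))}\le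 C\|q_E\|_{L^1_{\mathcal{J}}(H^{k-2}(\Omega))}$ with $C$ independent of (uniform in) the thickness parameter. Discretization: $0=x_0<\dots<x_n=L$ is a partition of $\Omega$ with elements $\Omega_i=(x_{i-1},x_i)$ and $h=\max_i(x_i-x_{i-1})$. For $r\ge1$, with $\mathbb{P}_r$ the polynomials of degree at most $r$, $$\mathcal{V}_h^r=\{v\in H^1(\Omega):v|_{\Omega_i}\in\mathbb{P}_r(\Omega_i)\ \forall i\},\qquad \mathcal{Q}_h^r=\{q\in L^2(\Omega):q|_{\Omega_i}\in\mathbb{P}_{r-1}(\Omega_i)\ \forall i\},$$ and $\mathbb{H}_h=(\mathcal{V}_h^r\times\mathcal{V}_h^r)\cap\mathbb{H}$. Problem (M$_h$): find $(\theta_h,w_h,\gamma_h)\in L^1_{\mathcal{J}}(\mathbb{H}_h\times\mathcal{Q}_h^r)$ satisfying the equations of (M) with $(\theta,w,\gamma)$ replaced by $(\theta_h,w_h,\gamma_h)$, for all $(\eta,v)\in\mathbb{H}_h$ and $\psi\in\mathcal{Q}_h^r$. *)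

(* Defs.v *)
From mathcomp Require Import all_boot all_order all_algebra.
From mathcomp Require Import all_classical all_reals all_analysis.
Import Order.TTheory GRing.Theory Num.Theory.
Import numFieldNormedType.Exports.

Set Implicit Arguments.
Unset Strict Implicit.
Unset Printing Implicit Defensive.

Local Open Scope classical_set_scope.
Local Open Scope ring_scope.

(** Elements of L^2(0, L) are represented by functions [R -> R] of which only
    the values on [0, L] matter: [u \_ D] is [u] extended by 0 outside [D]. *)

Definition L2 (R : realType) (L : R) : set (R -> R) :=
  [set u | (u \_ `[0, L]) \in Lfun (@lebesgue_measure R) 2%:E].

Definition L2dot (R : realType) (L : R) (u v : R -> R) : R :=
  \int[@lebesgue_measure R]_(x in `[0, L]) (u x * v x).

Definition L2norm (R : realType) (L : R) (u : R -> R) : R :=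
  fine ('N[@lebesgue_measure R]_(2%:E)[EFin \o (u \_ `[0%R, L])])%E.

(** The support is closed and bounded, hence compact. *)
Definition C1c (R : realType) (L : R) : set (R -> R) :=
  [set phi : R -> R | [/\ forall x : R, derivable phi x 1,
                 continuous (derive1 phi) &
                 closure [set x | phi x != 0] `<=` `]0, L[]].

Definition is_wderiv (R : realType) (L : R) (u g : R -> R) : Prop :=
  L2 L g /\ forall phi, C1c L phi -> L2dot L u (derive1 phi) = - L2dot L g phi.

(** A choice of representative: weak derivatives are unique up to null sets. *)
Definition wderiv (R : realType) (L : R) (u : R -> R) : R -> R :=
  xget (cst 0) [set g | is_wderiv L u g].

Fixpoint sobolev (R : realType) (L : R) (k : nat) : set (R -> R) :=
  if k is k'.+1 then
    [set u | L2 L u /\ exists2 g, is_wderiv L u g & sobolev L k' g]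
  else L2 L.

Definition sobolev_norm (R : realType) (L : R) (k : nat) (u : R -> R) : R :=
  Num.sqrt (\sum_(j < k.+1) L2norm L (iter j (wderiv L) u) ^+ 2).

Definition H10 (R : realType) (L : R) : set (R -> R) :=
  [set u | sobolev L 1 u /\
     forall e : R, 0 < e -> exists2 phi, C1c L phi & sobolev_norm L 1 (u - phi) < e].

Definition HH (R : realType) (L : R) : set ((R -> R) * (R -> R)) :=
  H10 L `*` H10 L.

Definition HH_norm (R : realType) (L : R) (u : (R -> R) * (R -> R)) : R :=
  Num.sqrt (L2norm L (wderiv L u.1) ^+ 2 + L2norm L (wderiv L u.2) ^+ 2).

Definition HHL2_norm (R : realType) (L : R)
    (u : (R -> R) * (R -> R) * (R -> R)) : R :=
  Num.sqrt (HH_norm L u.1 ^+ 2 + L2norm L u.2 ^+ 2).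

(** The Bochner space L^1(0, T; B), where B is given by a carrier [D], a subset
    of an additive group, and a (semi)norm [N]: the limits a.e. of simple
    functions with integrable norm. Measurability refers to Borel sets, so
    [N (f t)] is Borel measurable up to a null set only; the integral of a
    nonnegative function does not depend on its values on a null set. *)

Definition simple_map (R : realType) (V : zmodType) (T : R) (D : set V)
    (s : R -> V) : Prop :=
  [/\ finite_set (s @` `[0, T]),
      forall b, measurable (`[0, T] `&` s @^-1` [set b]) &
      forall t : R, t \in `[0, T] -> D (s t)].

Definition L1norm (R : realType) (V : zmodType) (T : R) (N : V -> R)
    (f : R -> V) : \bar R :=
  (\int[@lebesgue_measure R]_(t in `[0%R, T]) (N (f t))%:E)%E.

Definition L1 (R : realType) (V : zmodType) (T : R) (D : set V) (N : V -> R) :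
    set (R -> V) :=
  [set f | (exists2 s : nat -> R -> V, forall n, simple_map T D (s n) &
      {ae @lebesgue_measure R, forall t : R, t \in `[0, T] ->
         D (f t) /\ (N (f t - s n t) @[n --> \oo] --> (0 : R))}) /\
    (L1norm T N f < +oo)%E].

(** [df] is the derivative of [f] relative to [D], so that derivatives at the
    end points of an interval are one-sided. *)
Definition is_deriv_within (R : realType) (D : set R) (f df : R -> R) : Prop :=
  forall t, D t ->
    (f s - f t) / (s - t) @[s --> within (D `\ t) (nbhs t)] --> df t.

Definition memory_kernel (R : realType) (E dE : R -> R) (t s : R) : R :=
  dE (t - s) / E 0.

Definition scaled_inertia (R : realType) (inertia : R -> R) (eps : R) : R -> R :=
  fun x => inertia x / eps ^+ 3.

Definition scaled_area (R : realType) (ks : R) (area : R -> R) (eps : R) :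
    R -> R :=
  fun x => ks * area x / eps.

Definition elastic_form (R : realType) (L : R) (Ih th ga eta v : R -> R) : R :=
  L2dot L (Ih \* wderiv L th) (wderiv L eta) + L2dot L ga (eta \- wderiv L v).

(** [X] and [Q] are both the trial and the test spaces: the continuous problem
    has [X] = [HH L] and [Q] = [L2 L], the semi-discrete one their finite
    element subspaces. *)
Definition mixed_solution (R : realType) (L T : R) (k : R -> R -> R)
    (Ih Ah : R -> R) (lam : R) (X : set ((R -> R) * (R -> R)))
    (Q : set (R -> R)) (qE th w ga : R -> R -> R) : Prop :=
  L1 T (X `*` Q) (HHL2_norm L) (fun t => (th t, w t, ga t)) /\
  {ae @lebesgue_measure R, forall t : R, t \in `[0, T] ->
    forall eta v psi, X (eta, v) -> Q psi ->
    elastic_form L Ih (th t) (ga t) eta v =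
      L2dot L (qE t) v +
      \int[@lebesgue_measure R]_(s in `[0, t])
        (k t s * elastic_form L Ih (th s) (ga s) eta v)
    /\
    L2dot L (th t \- wderiv L (w t)) psi
      - lam * L2dot L (fun x => ga t x / Ah x) psi = 0}.

(** A partition 0 = x_0 < x_1 < ... < x_n = L is given by the sequence
    x_1, ..., x_n, as in [itv_partition]. *)

Definition mesh_size (R : realType) (s : seq R) : R :=
  \big[Num.max/0]_(i < size s) (s`_i - (0 :: s)`_i).

Definition piecewise_poly (R : realType) (m : nat) (s : seq R) (v : R -> R) :
    Prop :=
  forall i, (i < size s)%N -> exists2 p : {poly R}, (size p <= m.+1)%N &
    {ae @lebesgue_measure R, forall x : R, x \in `](0 :: s)`_i, s`_i[ ->
       v x = p.[x]}.

Definition Vh (R : realType) (L : R) (r : nat) (s : seq R) : set (R -> R) :=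
  [set v | sobolev L 1 v /\ piecewise_poly r s v].

Definition Qh (R : realType) (L : R) (r : nat) (s : seq R) : set (R -> R) :=
  [set v | L2 L v /\ piecewise_poly r.-1 s v].

Definition HHh (R : realType) (L : R) (r : nat) (s : seq R) :
    set ((R -> R) * (R -> R)) :=
  (Vh L r s `*` Vh L r s) `&` HH L.

(* Main.v *)
Require Import Defs.
From mathcomp Require Import all_boot all_order all_algebra.
From mathcomp Require Import all_classical all_reals all_analysis.
From mathcomp Require Import measurable_realfun.
From mathcomp Require Import ring lra.
Import Order.TTheory GRing.Theory Num.Theory.
Import numFieldNormedType.Exports.

Set Implicit Arguments.
Unset Strict Implicit.
Unset Printing Implicit Defensive.

Local Open Scope classical_set_scope.
Local Open Scope ring_scope.

(** Volterra in time, Galerkin in space. For a discrete test pair (eta, v) the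
    elastic forms of the two solutions satisfy the same Volterra equation of the
    second kind, hence coincide: at almost every time the discrete solution is
    the steady mixed Galerkin approximation of the continuous one, and it remains
    to bound the steady error uniformly in the mesh and in lambda.

    In dimension one every discrete function vanishing at 0 is the primitive of
    a piecewise polynomial, so that the steady problem is a problem on the
    derivatives theta', w' and on gamma. Testing with (0, v) bounds the error on
    gamma up to a constant c. The energy identity for theta - theta_h has c
    multiplied by the integral of theta - theta_h, and the constraint tested by
    1 turns that integral into a positive multiple of lambda c; testing with a
    rotation eta of positive integral then bounds c itself. Such an eta, of
    bounded energy, exists except for r = 1 on meshes all of whose nodes are
    near the end points. Then h >= L / 2, so that stability is enough, and it
    holds because the discrete functions are small themselves. *)

(** The difficulty is uniformity as lambda tends to 0. The energy controls the constant part [c] of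
    the shear error only through [lambda * c ^+ 2], so no estimate may divide by lambda; a lower
    bound independent of lambda has to come from a rotation of positive integral.

    Since theta' and w' replace theta and w as unknowns, the approximation is by discontinuous
    polynomials of degree [r - 1] in L2, element by element, and no interpolation matched at the
    nodes is involved.

    In time the obstacle is the order of quantifiers: there are uncountably many test pairs, so the
    exceptional null set may not depend on the pair. The Volterra argument therefore shows that the
    memory integral of the difference vanishes at every time; the two forms then agree at each time
    at which both equations hold, for all pairs at once.

    Norms of Bochner functions are measurable only up to null sets, and the error norms are
    integrated without any measurability. Each is dominated separately by the whole bound, which
    costs a factor 2. *)

Lemma discr_le (R : realFieldType) (a b c : R) : 0 <= c ->
  (forall t, 0 <= a + 2 * t * b + t ^+ 2 * c) -> b ^+ 2 <= a * c.
Proof.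
rewrite le_eqVlt => /predU1P[<- h|c0 h].
  rewrite mulr0; have [->|b0] := eqVneq b 0; first by rewrite expr0n.
  (* With [c = 0] the expression is affine in [t]; this [t] gives it the value -1. *)
  have := h (- (a + 1) / (2 * b)).
  have -> : a + 2 * (- (a + 1) / (2 * b)) * b
            + (- (a + 1) / (2 * b)) ^+ 2 * 0 = -1 by field.
  by lra.
(* The minimiser of the quadratic. *)
have := h (- b / c).
have -> : a + 2 * (- b / c) * b + (- b / c) ^+ 2 * c = (a * c - b ^+ 2) / c.
  by field; rewrite gt_eqF.
by rewrite pmulr_lge0 ?invr_gt0// subr_ge0.
Qed.

#[local] Instance ae_lebesgue_filter (R : realType) :
  Filter (nbhs (almost_everywhere (@lebesgue_measure R))).
Proof. exact: (ae_filter_ringOfSetsType (@lebesgue_measure R)). Qed.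

(** * Square-integrable functions *)

Section square_integrable.
Context {R : realType}.
Notation mu := (@lebesgue_measure R).
Implicit Types (D : set R) (u v f g : R -> R).

(** The domain is arbitrary because approximation is done on single elements; [L2_sqint] identifies
    the case of [[0, L]] with [L2]. *)
Definition sqint D u :=
  measurable_fun D u /\ mu.-integrable D (EFin \o (fun x => u x ^+ 2)).

Definition ip D u v := \int[mu]_(x in D) (u x * v x).

Definition aeq D u v := {ae mu, forall x, D x -> u x = v x}.

Lemma aeq_refl D u : aeq D u u.
Proof. exact: aeW. Qed.

Lemma aeq_sym D u v : aeq D u v -> aeq D v u.
Proof. by apply: filterS => x uv /uv. Qed.

Lemma aeqB D u u' v v' : aeq D u u' -> aeq D v v' ->
  aeq D (fun x => u x - v x) (fun x => u' x - v' x).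
Proof. by apply: filterS2 => x uu vv Dx; rewrite uu// vv. Qed.

Lemma aeqS D D' u v : D' `<=` D -> aeq D u v -> aeq D' u v.
Proof. by move=> DD; apply: filterS => x uv /DD/uv. Qed.

Variables (D : set R) (mD : measurable D).

Lemma integrable_bound u g : measurable_fun D u ->
  mu.-integrable D (EFin \o g) -> (forall x, D x -> `|u x| <= g x) ->
  mu.-integrable D (EFin \o u).
Proof.
move=> mu_ ig h; apply: le_integrable ig => //; first exact/measurable_EFinP.
by move=> x Dx /=; rewrite lee_fin (le_trans (h _ Dx))// ler_norm.
Qed.

Lemma integrableD_fin u v : mu.-integrable D (EFin \o u) ->
  mu.-integrable D (EFin \o v) -> mu.-integrable D (EFin \o (fun x => u x + v x)).
Proof. exact: integrableD. Qed.

Lemma integrableZ_fin c u : mu.-integrable D (EFin \o u) ->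
  mu.-integrable D (EFin \o (fun x => c * u x)).
Proof. exact: integrableZl. Qed.

Lemma sqintM u v : sqint D u -> sqint D v ->
  mu.-integrable D (EFin \o (fun x => u x * v x)).
Proof.
move=> [mu_ iu] [mv iv].
apply: (@integrable_bound _ (fun x => u x ^+ 2 + v x ^+ 2)).
- exact: measurable_funM.
- exact: integrableD_fin.
- move=> x _; rewrite normrM -(real_normK (num_real (u x))).
  rewrite -(real_normK (num_real (v x))).
  by move: (normr_ge0 (u x)) (normr_ge0 (v x)) => *; nra.
Qed.

Lemma sqintD u v : sqint D u -> sqint D v -> sqint D (fun x => u x + v x).
Proof.
move=> [mu_ iu] [mv iv]; split; first exact: measurable_funD.
apply: (@integrable_bound _ (fun x => 2 * (u x ^+ 2 + v x ^+ 2))).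
- by apply: measurable_funX; exact: measurable_funD.
- exact/integrableZ_fin/integrableD_fin.
- move=> x _; rewrite ger0_norm ?sqr_ge0//.
  by have := sqr_ge0 (u x - v x); nra.
Qed.

Lemma sqintZ c u : sqint D u -> sqint D (fun x => c * u x).
Proof.
move=> [mu_ iu]; split; first exact: measurable_funM.
rewrite (_ : (fun x => _) = (fun x => c ^+ 2 * u x ^+ 2)).
  exact: integrableZ_fin.
by apply/funext => x; rewrite exprMn.
Qed.

Lemma sqintN u : sqint D u -> sqint D (fun x => - u x).
Proof.
move=> /(sqintZ (-1)); rewrite (_ : (fun x => -1 * u x) = (fun x => - u x))//.
by apply/funext => x; rewrite mulN1r.
Qed.

Lemma sqintB u v : sqint D u -> sqint D v -> sqint D (fun x => u x - v x).
Proof. by move=> su /sqintN; exact: sqintD. Qed.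

Lemma sqint_bound u (b : R -> R) c : measurable_fun D b -> (forall x, D x -> `|b x| <= c) ->
  sqint D u -> sqint D (fun x => b x * u x).
Proof.
move=> mb bc [mu_ iu]; split; first exact: measurable_funM.
apply: (@integrable_bound _ (fun x => c ^+ 2 * u x ^+ 2)).
- by apply: measurable_funX; exact: measurable_funM.
- exact: integrableZ_fin.
- move=> x Dx; rewrite exprMn normrM [`|u x ^+ 2|]ger0_norm ?sqr_ge0//.
  rewrite ler_wpM2r ?sqr_ge0// ger0_norm ?sqr_ge0// -(real_normK (num_real (b x))).
  by rewrite ler_sqr ?nnegrE// ?bc// (le_trans _ (bc _ Dx)).
Qed.

Lemma ipC u v : ip D u v = ip D v u.
Proof. by apply: eq_Rintegral => x _; rewrite mulrC. Qed.

Lemma ipDl u v w : sqint D u -> sqint D v -> sqint D w ->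
  ip D (fun x => u x + v x) w = ip D u w + ip D v w.
Proof.
move=> su sv sw; rewrite /ip -RintegralD//; [|exact: sqintM..].
by apply: eq_Rintegral => x _; rewrite mulrDl.
Qed.

Lemma ipZl c u w : sqint D u -> sqint D w ->
  ip D (fun x => c * u x) w = c * ip D u w.
Proof.
move=> su sw; rewrite /ip -RintegralZl//; last exact: sqintM.
by apply: eq_Rintegral => x _; rewrite mulrA.
Qed.

Lemma ipBl u v w : sqint D u -> sqint D v -> sqint D w ->
  ip D (fun x => u x - v x) w = ip D u w - ip D v w.
Proof.
move=> su sv sw; rewrite /ip -RintegralB//; [|exact: sqintM..].
by apply: eq_Rintegral => x _; rewrite mulrBl.
Qed.

Lemma ipDr u v w : sqint D u -> sqint D v -> sqint D w ->
  ip D w (fun x => u x + v x) = ip D w u + ip D w v.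
Proof. by move=> su sv sw; rewrite ipC ipDl// !(ipC w). Qed.

Lemma ipBr u v w : sqint D u -> sqint D v -> sqint D w ->
  ip D w (fun x => u x - v x) = ip D w u - ip D w v.
Proof. by move=> su sv sw; rewrite ipC ipBl// !(ipC w). Qed.

Lemma ipZr c u w : sqint D u -> sqint D w ->
  ip D w (fun x => c * u x) = c * ip D w u.
Proof. by move=> su sw; rewrite ipC ipZl// ipC. Qed.

Lemma ip_ge0 u : 0 <= ip D u u.
Proof. by apply: Rintegral_ge0 => x _; rewrite -expr2 sqr_ge0. Qed.

(** The squared norm of [u + t v] is a nonnegative quadratic in [t], so [discr_le] bounds its
    discriminant. *)
Lemma ip_CS u v : sqint D u -> sqint D v ->
  ip D u v ^+ 2 <= ip D u u * ip D v v.
Proof.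
move=> su sv; apply: discr_le; first exact: ip_ge0.
move=> t; have stv := sqintZ t sv.
have := ip_ge0 (fun x => u x + t * v x).
rewrite ipDl// ?ipDr//; last exact: sqintD.
by rewrite !ipZl// !ipZr// (ipC v u) => h; apply: (le_trans h); nra.
Qed.

Lemma Rintegral_ae f g : measurable_fun D f -> measurable_fun D g -> aeq D f g ->
  \int[mu]_(x in D) f x = \int[mu]_(x in D) g x.
Proof.
move=> mf mg fg; congr fine; apply: ae_eq_integral => //.
- exact/measurable_EFinP.
- exact/measurable_EFinP.
- by apply: filterS fg => x fg Dx; rewrite fg.
Qed.

Lemma ip_ae u u' v v' : sqint D u -> sqint D u' -> sqint D v -> sqint D v' ->
  aeq D u u' -> aeq D v v' -> ip D u v = ip D u' v'.
Proof.
move=> [mu1 _] [mu2 _] [mv1 _] [mv2 _] uu vv.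
apply: Rintegral_ae; [exact: measurable_funM..|].
by move: uu vv; apply: filterS2 => x uu vv Dx; rewrite uu// vv.
Qed.

Lemma sqintS D' u : measurable D' -> D' `<=` D -> sqint D u -> sqint D' u.
Proof.
move=> mD' DD [mu_ iu]; split; first exact: measurable_funS mu_.
exact: integrableS iu.
Qed.

Definition nrm u := Num.sqrt (ip D u u).

Lemma nrm_ge0 u : 0 <= nrm u. Proof. exact: sqrtr_ge0. Qed.

Lemma nrm_sqr u : nrm u ^+ 2 = ip D u u.
Proof. by rewrite sqr_sqrtr// ip_ge0. Qed.

Lemma ip_le_nrm u v : sqint D u -> sqint D v -> `|ip D u v| <= nrm u * nrm v.
Proof.
move=> su sv; rewrite -ler_sqr ?nnegrE ?mulr_ge0 ?nrm_ge0//.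
by rewrite exprMn !nrm_sqr real_normK ?num_real// ip_CS.
Qed.

Lemma nrmD u v : sqint D u -> sqint D v -> nrm (fun x => u x + v x) <= nrm u + nrm v.
Proof.
move=> su sv; rewrite -ler_sqr ?nnegrE ?addr_ge0 ?nrm_ge0//.
have suv := sqintD su sv.
rewrite nrm_sqr ipDl// !ipDr// (ipC v u).
have /ler_normlW := ip_le_nrm su sv.
by rewrite -!nrm_sqr; nra.
Qed.

Lemma nrmZ c u : sqint D u -> nrm (fun x => c * u x) = `|c| * nrm u.
Proof.
move=> su; rewrite /nrm ipZl ?ipZr//; last exact: sqintZ.
by rewrite mulrA -expr2 sqrtrM ?sqr_ge0// sqrtr_sqr.
Qed.

Lemma nrmN u : nrm (fun x => - u x) = nrm u.
Proof. by rewrite /nrm /ip; congr Num.sqrt; apply: eq_Rintegral => x _; rewrite mulrNN. Qed.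

Lemma nrmB u v : sqint D u -> sqint D v -> nrm (fun x => u x - v x) <= nrm u + nrm v.
Proof. by move=> su sv; rewrite -(nrmN v); apply: nrmD => //; exact: sqintN. Qed.

Lemma nrm_ae u v : sqint D u -> sqint D v -> aeq D u v -> nrm u = nrm v.
Proof. by move=> su sv uv; rewrite /nrm (ip_ae su sv su sv). Qed.

Hypothesis fD : (mu D < +oo)%E.

Lemma sqint_cst c : sqint D (cst c).
Proof.
split; first exact: measurable_cst.
rewrite (_ : (fun x => _) = cst (c ^+ 2))//.
apply: measurable_bounded_integrable => //.
exact: bounded_cst.
Qed.

Lemma sqint_int u : sqint D u -> mu.-integrable D (EFin \o u).
Proof.
move=> /(sqintM (sqint_cst 1)).
by rewrite (_ : (fun x => _) = u)//; apply/funext => x; rewrite mul1r.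
Qed.

Lemma sqint_bounded u c : measurable_fun D u -> (forall x, D x -> `|u x| <= c) ->
  sqint D u.
Proof.
move=> mu_ uc; have := sqint_bound mu_ uc (sqint_cst 1).
by rewrite (_ : (fun x => _) = u)//; apply/funext => x; rewrite mulr1.
Qed.

End square_integrable.

(** * The interval [[0, L]] and antiderivatives *)

Section L2_interval.
Context {R : realType}.
Notation mu := (@lebesgue_measure R).
Implicit Types (u v f g phi : R -> R) (L : R).

Lemma itv_measure_lty (a b : R) : (mu `[a, b] < +oo)%E.
Proof. by rewrite lebesgue_measure_itv/=; case: ifP => _; rewrite ltry. Qed.

Lemma powR2_patch L u (x : R) :
  (`|(u \_ `[0, L]) x| `^ 2)%:E =
  ((EFin \o (fun x => u x ^+ 2)) \_ `[0, L]) x.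
Proof.
rewrite /= !patchE; case: ifP => _ /=; last by rewrite normr0 powR0.
by rewrite powR_mulrn// real_normK ?num_real.
Qed.

Lemma L2_sqint L u : L2 L u <-> sqint `[0, L] u.
Proof.
have msq : measurable_fun setT (u \_ `[0, L]) <-> measurable_fun `[0%R, L] u.
  by apply: iff_sym; exact: measurable_restrictT.
split=> [u2|[mu_ iu]].
  split; first by apply/msq; move: u2 => /andP[/[!inE]].
  apply/integrable_mkcond => //.
  move: u2 => /Lfun2_integrable_sqr.
  rewrite (_ : EFin \o _ = (EFin \o (fun x => u x ^+ 2)) \_ `[0, L])//.
  by apply/funext => x /=; rewrite !patchE; case: ifP => // _; rewrite expr0n.
apply/andP; split; rewrite inE/=; first exact/msq.
rewrite /finite_norm unlock /= poweR_lty//.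
have /integrable_mkcond : mu.-integrable `[0, L] (EFin \o (fun x => u x ^+ 2)) by [].
move=> /(_ (measurable_itv _)) /integrableP[_]; apply: le_lt_trans.
rewrite le_eqVlt; apply/orP; left; apply/eqP; apply: eq_integral => x _.
rewrite /= powR2_patch gee0_abs// patchE; case: ifP => _ //=.
by rewrite lee_fin sqr_ge0.
Qed.

Lemma L2norm_nrm L u : L2norm L u = nrm `[0, L] u.
Proof.
rewrite /L2norm /nrm /ip unlock /= fine_poweR powR12_sqrt; last first.
  by apply/fine_ge0/integral_ge0 => x _; rewrite lee_fin powR_ge0.
congr (Num.sqrt (fine _)); rewrite [RHS]integral_mkcond.
apply: eq_integral => x _; rewrite powR2_patch.
by rewrite !patchE; case: ifP.
Qed.

Lemma Rintegral_cst_itv (a b c : R) : a <= b ->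
  \int[mu]_(x in `[a, b]) c = c * (b - a).
Proof.
move=> ab; rewrite Rintegral_cst//.
rewrite -[b - a]/(fine (b - a)%:E); congr (_ * fine _).
apply: (etrans (lebesgue_measure_itv `[a, b])).
rewrite /= lte_fin; case: ifPn => //; rewrite -leNgt => ba.
by rewrite (_ : a = b) ?subrr//; apply/eqP; rewrite eq_le ab ba.
Qed.

(** Functions of H^1 are handled as a constant plus [prim] of their weak derivative, those of H^1_0
    as [prim] of a derivative of zero integral. *)
Definition prim u (x : R) := \int[mu]_(t in `[0, x]) u t.

Lemma prim0 u : prim u 0 = 0.
Proof. by rewrite /prim set_itv1 Rintegral_set1. Qed.

Lemma primB L u v x : mu.-integrable `[0, L] (EFin \o u) ->
  mu.-integrable `[0, L] (EFin \o v) -> x <= L ->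
  prim (fun t => u t - v t) x = prim u x - prim v x.
Proof.
move=> iu iv xL; have sub : `[0, x] `<=` `[0, L] by apply: subset_itvl; rewrite bnd_simp.
by rewrite /prim RintegralB//; [apply: integrableS iu|apply: integrableS iv].
Qed.

Lemma prim_sub L u a b : mu.-integrable `[0, L] (EFin \o u) ->
  0 <= a -> a <= b -> b <= L -> prim u b - prim u a = \int[mu]_(t in `[a, b]) u t.
Proof.
move=> iu a0 ab bL; rewrite /prim Rintegral_itvB ?bnd_simp//; last first.
  by apply: integrableS iu => //; apply: subset_itvl; rewrite bnd_simp.
apply: Rintegral_itv_obnd_cbnd; apply: integrableS iu => //.
by apply: subset_itv; rewrite bnd_simp.
Qed.

Lemma prim_continuous L u : 0 <= L -> mu.-integrable `[0, L] (EFin \o u) ->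
  {within `[0, L], continuous (prim u)}.
Proof. by move=> L0 iu; apply: parameterized_integral_continuous. Qed.

Lemma prim_measurable L u : 0 <= L -> mu.-integrable `[0, L] (EFin \o u) ->
  measurable_fun `[0, L] (prim u).
Proof.
move=> L0 iu; apply: subspace_continuous_measurable_fun => //.
exact: prim_continuous.
Qed.

Lemma ipS (D D' : set R) u : measurable D -> measurable D' -> D' `<=` D ->
  sqint D u -> ip D' u u <= ip D u u.
Proof.
move=> mD mD' DD su; have su' := sqintS mD mD' DD su.
apply: fine_le; [apply: integrable_fin_num => //; exact: sqintM..|].
apply: ge0_subset_integral => //.
- by apply/measurable_EFinP; case: su => ? _; exact: measurable_funM.
- by move=> x _; rewrite lee_fin -expr2 sqr_ge0.
Qed.

Lemma int_CS (a b : R) u : a <= b -> sqint `[a, b] u ->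
  (\int[mu]_(t in `[a, b]) u t) ^+ 2 <= (b - a) * ip `[a, b] u u.
Proof.
move=> ab su; have s1 := sqint_cst (measurable_itv `[a, b]) (itv_measure_lty a b) 1.
have := ip_CS (measurable_itv _) s1 su.
rewrite [ip _ _ u](_ : _ = \int[mu]_(t in `[a, b]) u t); last first.
  by apply: eq_Rintegral => x _; rewrite mul1r.
rewrite [ip _ _ (cst 1)](_ : _ = b - a)//.
rewrite /ip (_ : (fun x => _) = cst 1); last by apply/funext => x; rewrite mulr1.
by rewrite Rintegral_cst_itv// mul1r.
Qed.

(** Cauchy-Schwarz against 1: antiderivatives are 1/2-Hoelder. Keeping the length [b - a] matters in
    [prim_le_end], where short end pieces make [prim] small. *)
Lemma prim_CS L u a b : sqint `[0, L] u -> 0 <= a -> a <= b -> b <= L ->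
  (prim u b - prim u a) ^+ 2 <= (b - a) * ip `[a, b] u u.
Proof.
move=> su a0 ab bL; rewrite (@prim_sub L)//; last first.
  by apply: sqint_int => //; exact: itv_measure_lty.
apply: int_CS => //; apply: sqintS su => //.
by apply: subset_itv; rewrite bnd_simp.
Qed.

Lemma prim_le L u x : sqint `[0, L] u -> x \in `[0, L] ->
  `|prim u x| <= Num.sqrt L * nrm `[0, L] u.
Proof.
move=> su; rewrite in_itv/= => /andP[x0 xL].
rewrite -ler_sqr ?nnegrE ?mulr_ge0 ?nrm_ge0 ?sqrtr_ge0//.
rewrite real_normK ?num_real// exprMn nrm_sqr// sqr_sqrtr ?(le_trans x0)//.
have := prim_CS su (lexx 0) x0 xL; rewrite prim0 !subr0 => /le_trans; apply.
rewrite ler_pM ?ip_ge0// ipS//.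
by apply: subset_itv; rewrite bnd_simp.
Qed.

Lemma prim_sqint L u : 0 <= L -> sqint `[0, L] u -> sqint `[0, L] (prim u).
Proof.
move=> L0 su; apply: (@sqint_bounded _ _ _ _ _ (Num.sqrt L * nrm `[0, L] u)) => //.
- exact: itv_measure_lty.
- apply: prim_measurable => //; apply: sqint_int => //; exact: itv_measure_lty.
- by move=> x xL; exact: prim_le.
Qed.

Lemma nrm_cst (L c : R) : 0 <= L -> nrm `[0, L] (cst c) = Num.sqrt L * `|c|.
Proof.
move=> L0; rewrite /nrm /ip (_ : (fun x => _) = cst (c * c))//.
by rewrite Rintegral_cst_itv// subr0 -expr2 mulrC sqrtrM// sqrtr_sqr.
Qed.

Lemma nrm_bounded L u c : 0 <= L -> 0 <= c -> measurable_fun `[0, L] u ->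
  (forall x, x \in `[0, L] -> `|u x| <= c) -> nrm `[0, L] u <= Num.sqrt L * c.
Proof.
move=> L0 c0 mu_ uc.
have su : sqint `[0, L] u by apply: sqint_bounded mu_ uc => //; exact: itv_measure_lty.
rewrite -[c]ger0_norm// -nrm_cst// ler_sqrt ?ip_ge0//.
have sc := sqint_cst (measurable_itv `[0, L]) (itv_measure_lty 0 L) c.
apply: le_Rintegral => //; [exact: sqintM..|].
move=> x xL; rewrite -!expr2 -(real_normK (num_real (u x))) ler_sqr ?nnegrE//.
exact: uc.
Qed.

(** Poincare inequality for functions vanishing at 0: one factor [sqrt L] comes from the supremum
    bound, the other from the norm of a constant. *)
Lemma prim_nrm L u : 0 <= L -> sqint `[0, L] u ->
  nrm `[0, L] (prim u) <= L * nrm `[0, L] u.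
Proof.
move=> L0 su; rewrite -{2}(sqr_sqrtr L0) expr2 -mulrA.
apply: nrm_bounded => //; first by rewrite mulr_ge0 ?sqrtr_ge0 ?nrm_ge0.
  by apply: prim_measurable => //; apply: sqint_int => //; exact: itv_measure_lty.
by move=> x; exact: prim_le.
Qed.

End L2_interval.

(** * Weak derivatives *)

Section weak_derivative.
Context {R : realType}.
Notation mu := (@lebesgue_measure R).
Implicit Types (u v f g phi : R -> R) (L : R).

Lemma EFin_Rintegral (D : set R) f : measurable D -> mu.-integrable D (EFin \o f) ->
  (\int[mu]_(x in D) (f x)%:E = (\int[mu]_(x in D) f x)%R%:E)%E.
Proof. by move=> mD fi; rewrite fineK//; exact: integrable_fin_num. Qed.

Lemma integrable_patch (D : set R) f : measurable D ->
  mu.-integrable D (EFin \o f) -> mu.-integrable setT (EFin \o (f \_ D)).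
Proof.
by move=> mD fi; rewrite -restrict_EFin; apply: (iffLR (integrable_mkcond _ _)).
Qed.

Lemma continuous_integrable_itv (a b : R) f : continuous f ->
  mu.-integrable `[a, b] (EFin \o f).
Proof.
move=> cf; apply: continuous_compact_integrable; first exact: segment_compact.
exact: continuous_subspaceT.
Qed.

Lemma continuous_sqint (a b : R) f : continuous f -> sqint `[a, b] f.
Proof.
move=> cf; split; first by apply: measurable_funTS; exact: continuous_measurable_fun.
by apply: continuous_integrable_itv => x; apply: continuousM; exact: cf.
Qed.

Lemma C1c_continuous L phi : C1c L phi -> continuous phi.
Proof. by case=> dphi _ _ x; apply: differentiable_continuous; apply/derivable1_diffP. Qed.

Lemma C1c_bnd L phi : C1c L phi -> phi 0 = 0 /\ phi L = 0.
Proof.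
case=> _ _ sub; split; apply/eqP; apply: contraT => h.
- have /sub : closure [set x | phi x != 0] 0 by apply: subset_closure.
  by rewrite /= in_itv/= ltxx.
- have /sub : closure [set x | phi x != 0] L by apply: subset_closure.
  by rewrite /= in_itv/= ltxx andbF.
Qed.

Lemma continuous_deriv_FTC phi a b : (forall x, derivable phi x 1) ->
  continuous (derive1 phi) -> a <= b ->
  \int[mu]_(x in `[a, b]) (derive1 phi x) = phi b - phi a.
Proof.
move=> dphi cphi; rewrite le_eqVlt => /predU1P[->|ab].
  by rewrite set_itv1 Rintegral_set1 subrr.
have ct x : {for x, continuous phi}.
  by apply: differentiable_continuous; apply/derivable1_diffP.
have h : (\int[mu]_(x in `[a, b]) (derive1 phi x)%:E = (phi b)%:E - (phi a)%:E)%E.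
  apply: (@continuous_FTC2 R (derive1 phi) phi a b ab); [|split|by []].
  - exact: continuous_subspaceT.
  - by move=> x _; exact: dphi.
  - by apply/cvg_at_right_filter; exact: ct.
  - by apply/cvg_at_left_filter; exact: ct.
by rewrite /Rintegral h.
Qed.

Lemma C1c_FTC L phi a b : C1c L phi -> a <= b ->
  \int[mu]_(x in `[a, b]) (derive1 phi x) = phi b - phi a.
Proof. by case=> dphi cphi _ ab; exact: (continuous_deriv_FTC dphi cphi ab). Qed.

(** As [u] is merely square integrable, [prim u] is not differentiated: the formula is Fubini's
    theorem for [u(s) phi'(y)] on the triangle [s <= y]. *)
Lemma prim_ibp L u phi : sqint `[0, L] u -> C1c L phi ->
  ip `[0, L] (prim u) (derive1 phi) = - ip `[0, L] u phi.
Proof.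
move=> su c1; have [_ cphi _] := c1.
have iu := sqint_int (measurable_itv `[0, L]) (itv_measure_lty 0 L) su.
pose U := u \_ `[0, L]; pose P := (derive1 phi) \_ `[0, L].
have mU : measurable_fun setT U.
  apply/(measurable_restrictT _ (measurable_itv _)).
  by apply/measurable_EFinP; apply: measurable_int iu.
have mP : measurable_fun setT P.
  apply/(measurable_restrictT _ (measurable_itv _)).
  by apply: measurable_funTS; exact: continuous_measurable_fun.
(* Integrating in [y] first gives [- u s * phi s], because [phi] vanishes at [L] ([E1]); integrating
   in [s] first gives [phi' y * prim u y] ([E2]). *)
pose f (p : R * R) := (if p.1 <= p.2 then U p.1 * P p.2 else 0)%:E.
have mf : measurable_fun setT f.
  apply/measurable_EFinP; apply: measurable_fun_ifT => //.
  - by apply: measurable_fun_ler.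
  - by apply: measurable_funM; exact: measurableT_comp.
have iU : mu.-integrable setT (EFin \o U).
  exact: integrable_patch.
have iP : mu.-integrable setT (EFin \o P).
  by apply: integrable_patch => //; exact: continuous_integrable_itv.
have fint : (mu \x mu)%E.-integrable setT f.
  (* Domination by [|U s| * |P y|], whose double integral is a product of two finite integrals. *)
  apply/integrable12ltyP => //.
  have /integrableP[_ Uoo] := iU; have /integrableP[_ Poo] := iP.
  apply: (@le_lt_trans _ _ (\int[mu]_s (`|(U s)%:E| * \int[mu]_y `|(P y)%:E|))%E).
    have mabs (g : R -> R) : measurable_fun setT g ->
        measurable_fun setT (fun x => `|(g x)%:E|)%E.
      by move=> mg; apply: measurableT_comp => //; exact/measurable_EFinP.
    apply: ge0_le_integral.
    - by [].
    - by move=> *; exact: integral_ge0.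
    - apply: (@measurable_fun_fubini_tonelli_F _ _ _ _ _ mu (abse \o f)) => //.
        exact: measurableT_comp.
      by move=> p; exact: abse_ge0.
    - by apply: emeasurable_funM; [exact: mabs|exact: measurable_cst].
    - move=> s _; rewrite -ge0_integralZl//; last exact: mabs.
      apply: ge0_le_integral.
      + by [].
      + by [].
      + by apply: measurableT_comp => //; exact: measurableT_comp mf (pair1_measurable _).
      + by apply: measurable_funeM; exact: mabs.
      move=> y _; rewrite /f /= -EFinM lee_fin; case: ifP => _; first by rewrite normrM.
      by rewrite normr0 mulr_ge0.
  rewrite ge0_integralZr//; last 2 first.
  - by apply: measurableT_comp => //; exact/measurable_EFinP.
  - exact: integral_ge0.
  by rewrite lte_mul_pinfty ?integral_ge0// ge0_fin_numE// integral_ge0.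
have E1 s : (\int[mu]_y f (s, y) = (- (U s * phi s))%:E)%E.
  rewrite /f /U patchE; case: ifPn => [|_]; last first.
    by rewrite mul0r oppr0; apply: integral0_eq => y _; rewrite mul0r if_same.
  rewrite inE /= in_itv /= => /andP[s0 sL].
  transitivity (\int[mu]_(y in `[s, L]) (u s * derive1 phi y)%:E)%E.
    rewrite [RHS]integral_mkcond; apply: eq_integral => y _.
    rewrite /P !patchE /= !mem_setE !in_itv/=; case: (leP s y) => sy //=.
    by rewrite (le_trans s0 sy) /=; case: ifP => // _; exact: (congr1 EFin (mulr0 (u s))).
  have iphi : mu.-integrable `[s, L] (EFin \o derive1 phi).
    exact: continuous_integrable_itv.
  rewrite EFin_Rintegral//; last exact: integrableZ_fin.
  rewrite RintegralZl// (C1c_FTC c1)// (C1c_bnd c1).2 sub0r; congr EFin; lra.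
have E2 y : (\int[mu]_s f (s, y) = (P y * prim u y)%:E)%E.
  rewrite /f /P patchE; case: ifPn => [|_]; last first.
    by rewrite mul0r; apply: integral0_eq => s _; rewrite mulr0 if_same.
  rewrite inE /= in_itv /= => /andP[y0 yL].
  transitivity (\int[mu]_(s in `[0%R, y]) (derive1 phi y * u s)%:E)%E.
    rewrite [RHS]integral_mkcond; apply: eq_integral => s _.
    rewrite /U !patchE /= !mem_setE !in_itv/=; case: (leP s y) => sy; last by rewrite andbF.
    rewrite (le_trans sy yL) !andbT; case: ifP => _; first by rewrite mulrC.
    exact: (congr1 EFin (mul0r _)).
  have iu' : mu.-integrable `[0, y] (EFin \o u).
    by apply: integrableS iu => //; apply: subset_itvl; rewrite bnd_simp.
  rewrite EFin_Rintegral//; last exact: integrableZ_fin.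
  by rewrite RintegralZl.
have /(congr1 fine) h : (\int[mu]_s (- (U s * phi s))%:E = \int[mu]_y (P y * prim u y)%:E)%E.
  transitivity (\int[mu]_s \int[mu]_y f (s, y))%E.
    by apply: eq_integral => s _; rewrite E1.
  transitivity (\int[mu]_y \int[mu]_s f (s, y))%E; first exact: Fubini.
  by apply: eq_integral => y _; rewrite E2.
rewrite /ip [LHS]Rintegral_mkcond.
rewrite [LHS](_ : _ = \int[mu]_x (P x * prim u x)); last first.
  by apply: eq_Rintegral => x _; rewrite /P !patchE; case: ifP; rewrite ?mul0r// mulrC.
rewrite -[LHS]h -mulN1r -RintegralZl//; last first.
  by apply: sqintM => //; apply: continuous_sqint; exact: C1c_continuous c1.
rewrite [RHS]Rintegral_mkcond.
apply: eq_Rintegral => x _; rewrite /U !patchE; case: ifP => _; first by rewrite mulN1r.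
by rewrite mul0r oppr0.
Qed.

End weak_derivative.

(** * Continuous functions of compact support and their antiderivatives *)

Section compactly_supported.
Context {R : realType}.
Notation mu := (@lebesgue_measure R).
Implicit Types (u v f g phi chi : R -> R) (L : R).

(** The support is enclosed in an explicit segment of the open interval, which passes directly to
    sums and to antiderivatives. *)
Definition Cc L chi := continuous chi /\
  exists a b, [/\ 0 < a, b < L & forall x, ~~ (a <= x <= b) -> chi x = 0].

Lemma Cc_add L f g : Cc L f -> Cc L g -> Cc L (fun x => f x + g x).
Proof.
move=> [cf [a [b [a0 bL fab]]]] [cg [c [d [c0 dL gcd]]]].
split; first by move=> x; apply: continuousD; [exact: cf|exact: cg].
exists (Num.min a c), (Num.max b d); split; first by rewrite lt_min a0.
  by rewrite gt_max bL.
move=> x; rewrite negb_and -!ltNge !lt_min !gt_max => h.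
have [hf hg] : ~~ (a <= x <= b) /\ ~~ (c <= x <= d).
  by rewrite !negb_and -!ltNge; case/orP : h => /andP[-> ->]; rewrite ?orbT.
by rewrite fab// gcd// addr0.
Qed.

Lemma Cc_scale L c f : Cc L f -> Cc L (fun x => c * f x).
Proof.
move=> [cf [a [b [a0 bL fab]]]].
split; first by move=> x; apply: continuousM; [exact: cvg_cst|exact: cf].
by exists a, b; split => // x /fab ->; rewrite mulr0.
Qed.

Lemma Cc_sqint L f : Cc L f -> sqint `[0, L] f.
Proof. by move=> [cf _]; exact: continuous_sqint. Qed.

(** Integration starts at -oo so that the result is differentiable on the whole line, as [C1c]
    demands; for [x >= 0] it agrees with [prim]. *)
Definition antider chi (x : R) := \int[mu]_(t in `]-oo, x]) chi t.

Section antiderivative.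
Variables (L : R) (chi : R -> R).
Hypothesis Cchi : Cc L chi.

Lemma Cc_supp x : ~~ (0 < x < L) -> chi x = 0.
Proof.
have [_ [a [b [a0 bL h]]]] := Cchi; move=> hx; apply: h.
by apply: contra hx => /andP[ax xb]; rewrite (lt_le_trans a0 ax) (le_lt_trans xb bL).
Qed.

Lemma Cc_integrable : mu.-integrable setT (EFin \o chi).
Proof.
have [cchi _] := Cchi.
have := integrable_patch (measurable_itv `[0, L]) (continuous_integrable_itv 0 L cchi).
rewrite (_ : chi \_ _ = chi)//; apply/funext => x; rewrite patchE mem_setE in_itv/=.
case: ifPn => // h; rewrite Cc_supp//.
by apply: contra h => /andP[/ltW-> /ltW->].
Qed.

Lemma antider_prim x : 0 <= x -> antider chi x = prim chi x.
Proof.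
move=> x0; rewrite /antider /prim Rintegral_mkcond [RHS]Rintegral_mkcond.
apply: eq_Rintegral => y _; rewrite !patchE !mem_setE !in_itv/=.
case: (leP 0 y) => //= y0; case: ifP => // _; apply: Cc_supp.
by rewrite negb_and -!leNgt (ltW y0).
Qed.

Lemma antider_FTC x : derivable (antider chi) x 1 /\ derive1 (antider chi) x = chi x.
Proof.
have [cchi _] := Cchi.
apply: (@continuous_FTC1 _ chi -oo%O x (x + 1)); [by rewrite ltrDl| |by rewrite ltNyr|exact: cchi].
by apply: integrableS Cc_integrable.
Qed.

(** The vanishing integral is what makes the antiderivative return to 0 to the right of the
    support. *)
Lemma antider_C1c : 0 < L -> \int[mu]_(x in `[0, L]) chi x = 0 ->
  C1c L (antider chi).
Proof.
move=> L0 int0; have [cchi [a [b [a0 bL h]]]] := Cchi.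
split; [by move=> x; have [] := antider_FTC x| |].
  by rewrite (_ : derive1 _ = chi)//; apply/funext => x; have [] := antider_FTC x.
(* Left of [a] the integrand is 0; right of [b] the value is the full integral, which is 0. *)
have sub : [set x | antider chi x != 0] `<=` `[a, b].
  move=> x /= h0; rewrite in_itv/=; apply/negPn/negP => xab; move/eqP: h0; apply.
  have [xa|ax] := ltP x a.
    rewrite /antider /Rintegral integral0_eq// => y; rewrite /= in_itv/= => yx.
    by rewrite h// negb_and -!ltNge (le_lt_trans yx xa).
  have bx : b < x by move: xab; rewrite ax/= -ltNge.
  have x0 : 0 <= x by rewrite (le_trans (ltW a0)).
  rewrite antider_prim//.
  transitivity (\int[mu]_(x in `[0, L]) chi x) => //.
  rewrite /prim Rintegral_mkcond [RHS]Rintegral_mkcond.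
  apply: eq_Rintegral => y _; rewrite !patchE !mem_setE !in_itv/=.
  case: (leP 0 y) => //= y0; case: (leP y x) => yx; case: (leP y L) => yL //.
  - by apply: h; rewrite negb_and -!ltNge (lt_trans bL yL) orbT.
  - by apply/esym/h; rewrite negb_and -!ltNge (lt_trans bx yx) orbT.
apply: (subset_trans (closureS sub)).
have /closure_id <- : closed (`[a, b]%classic : set R) by exact: interval_closed.
move=> x /=.
by rewrite !in_itv/= => /andP[ax xb]; rewrite (lt_le_trans a0 ax) (le_lt_trans xb bL).
Qed.

End antiderivative.

Definition pos_part (y : R) := (y + `|y|) / 2.

Lemma pos_part_continuous : continuous pos_part.
Proof.
move=> y; apply: cvgM; last exact: cvg_cst.
by apply: cvgD; [exact: cvg_id|apply: cvg_norm; exact: cvg_id].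
Qed.

(** The function [n (x - a) (b - x)] clipped to [[1, 2]] and lowered by 1. Clipping at 1 rather than
    0 leaves a margin at the end points, hence a compact support inside []a, b[]. *)
Definition plateau a b (n : nat) (x : R) : R :=
  let y := n%:R * ((x - a) * (b - x)) in pos_part (y - 1) - pos_part (y - 2).

Lemma plateau_continuous a b n : continuous (plateau a b n).
Proof.
have c (k : R) : continuous (fun x : R => n%:R * ((x - a) * (b - x)) - k).
  move=> x; apply: cvgB; last exact: cvg_cst.
  apply: cvgM; first exact: cvg_cst.
  apply: cvgM; first by apply: cvgB; [exact: cvg_id|exact: cvg_cst].
  by apply: cvgB; [exact: cvg_cst|exact: cvg_id].
move=> x; apply: cvgB.
- by apply: (continuous_comp (c 1 x)); exact: pos_part_continuous.
- by apply: (continuous_comp (c 2 x)); exact: pos_part_continuous.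
Qed.

Lemma plateau_itv a b n x : 0 <= plateau a b n x <= 1.
Proof.
rewrite /plateau /pos_part; set y := n%:R * _.
case: (ger0P (y - 1)); case: (ger0P (y - 2)) => *; apply/andP; split; lra.
Qed.

Lemma plateau0 a b n x : n%:R * ((x - a) * (b - x)) <= 1 -> plateau a b n x = 0.
Proof.
rewrite /plateau /pos_part; set y := n%:R * _ => y1.
by rewrite !ler0_norm; lra.
Qed.

Lemma plateau1 a b n x : 2 <= n%:R * ((x - a) * (b - x)) -> plateau a b n x = 1.
Proof.
rewrite /plateau /pos_part; set y := n%:R * _ => y1.
by rewrite !ger0_norm; lra.
Qed.

Lemma plateau_Cc L (a b : R) (n : nat) (p : R -> R) : 0 <= a -> a < b -> b <= L -> continuous p ->
  Cc L (fun x => p x * plateau a b n x).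
Proof.
move=> a0 ab bL cp; split.
  by move=> x; apply: continuousM; [exact: cp|exact: plateau_continuous].
(* Width of the margin: closer than [d] to an end point, [(x - a) (b - x)] is at most
   [d (b - a) = 1 / (n + 1)], so [n] times it is at most 1. Using [n + 1] covers [n = 0]. *)
pose d := (n.+1%:R * (b - a))^-1 : R.
have d0 : 0 < d by rewrite invr_gt0 mulr_gt0// subr_gt0.
exists (a + d), (b - d); split; [lra|lra|] => x xab.
rewrite plateau0 ?mulr0//.
have nd : n.+1%:R * (b - a) * d = 1 by rewrite divff// mulf_neq0// subr_eq0 gt_eqF.
have nn : 0 <= n%:R :> R by [].
have [xlo|xlo] := leP x a.
  by rewrite (le_trans _ ler01)// mulr_ge0_le0// mulr_le0_ge0//; lra.
have [xhi|xhi] := leP b x.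
  by rewrite (le_trans _ ler01)// mulr_ge0_le0// mulr_ge0_le0//; lra.
have key : (x - a) * (b - x) <= d * (b - a).
  move: xab; rewrite negb_and -!ltNge => /orP[h|h]; nra.
have : n%:R * ((x - a) * (b - x)) <= n.+1%:R * (d * (b - a)).
  by apply: ler_pM => //; [nra|rewrite ler_nat].
by move=> /le_trans; apply; lra.
Qed.

Lemma plateau_cvg a b x : a < b ->
  (plateau a b n x @[n --> \oo] --> (\1_`]a, b[%classic x : R)).
Proof.
move=> ab; rewrite indicE mem_setE in_itv/=; case: (boolP (a < x < b)) => [/andP[ax xb]|xab].
  set m := (x - a) * (b - x).
  have m0 : 0 < m by rewrite mulr_gt0 ?subr_gt0.
  apply: cvg_near_cst; near=> n; apply: plateau1; rewrite -/m.
  rewrite -ler_pdivrMr//; near: n; exact: nbhs_infty_ger.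
apply: cvg_near_cst; apply: nearW => n; apply: plateau0.
rewrite (le_trans _ ler01)// mulr_ge0_le0//.
move: xab; rewrite negb_and -!leNgt => /orP[]h.
- by rewrite mulr_le0_ge0//; lra.
- by rewrite mulr_ge0_le0//; lra.
Unshelve. all: by end_near. Qed.

End compactly_supported.

(** * Functions that are L2 limits of compactly supported ones *)

Section dense_functions.
Context {R : realType}.
Notation mu := (@lebesgue_measure R).
Implicit Types (u v f g phi chi : R -> R) (L : R).

(** Density of [Cc] is carried as a property of the function at hand. It is established for
    polynomials cut off to subintervals and their sums, which covers indicators and piecewise
    polynomials. *)
Definition approx_Cc L u := sqint `[0, L] u /\ forall e, 0 < e ->
  exists2 chi, Cc L chi & nrm `[0, L] (fun x => u x - chi x) < e.

Lemma approx_Cc_add L u v : approx_Cc L u -> approx_Cc L v ->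
  approx_Cc L (fun x => u x + v x).
Proof.
move=> [su hu] [sv hv]; split; first exact: sqintD.
move=> e e0; have e2 : 0 < e / 2 by lra.
have [f Cf fu] := hu _ e2; have [g Cg gv] := hv _ e2.
exists (fun x => f x + g x); first exact: Cc_add.
rewrite [X in nrm _ X](_ : _ = (fun x => (u x - f x) + (v x - g x))).
  apply: (le_lt_trans (nrmD _ _ _)) => //.
  - by apply: sqintB => //; exact: Cc_sqint.
  - by apply: sqintB => //; exact: Cc_sqint.
  - by lra.
by apply/funext => x; ring.
Qed.

Lemma approx_Cc_ae L u v : sqint `[0, L] v -> aeq `[0, L] u v ->
  approx_Cc L u -> approx_Cc L v.
Proof.
move=> sv uv [su hu]; split => // e /hu[f Cf fu]; exists f => //.
rewrite -(@nrm_ae _ _ (measurable_itv `[0, L]) (fun x => u x - f x))//.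
- by apply: sqintB => //; exact: Cc_sqint.
- by apply: sqintB => //; exact: Cc_sqint.
- by apply: aeqB => //; exact: aeq_refl.
Qed.

(** Dominated convergence: multiplying [p] by the plateaus of []a, b[] gives squared errors that
    tend to 0 pointwise and stay below [p ^+ 2]. *)
Lemma approx_Cc_piece L a b (p : R -> R) : 0 <= a -> a < b -> b <= L -> continuous p ->
  approx_Cc L (fun x => p x * \1_(`]a, b[%classic) x).
Proof.
move=> a0 ab bL cp; have sp : sqint `[0, L] p by exact: continuous_sqint.
have mp := proj1 sp.
have m1 : measurable_fun `[0, L] (\1_(`]a, b[%classic) : R -> R).
  exact: measurable_indic.
have s1 : sqint `[0, L] (fun x => p x * \1_(`]a, b[%classic) x).
  rewrite (_ : (fun x => _) = (fun x => \1_(`]a, b[%classic) x * p x)); last first.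
    by apply/funext => x; rewrite mulrC.
  apply: (@sqint_bound _ _ _ _ _ 1) => // x _; rewrite indicE.
  by case: (_ \in _); rewrite ?normr1 ?normr0.
split=> // e e0.
have st n : sqint `[0, L] (fun x => p x * plateau a b n x).
  by apply: Cc_sqint; exact: plateau_Cc.
pose g n x := (p x * \1_(`]a, b[%classic) x - p x * plateau a b n x) ^+ 2.
have mg n : measurable_fun `[0, L] (g n).
  by apply: measurable_funX; apply: measurable_funB; [exact: (proj1 s1)|exact: (proj1 (st n))].
have pl n x : g n x <= p x ^+ 2.
  rewrite /g -mulrBr exprMn ler_piMr ?sqr_ge0//.
  have /andP[p0 p1] := plateau_itv a b n x; rewrite indicE.
  by case: (_ \in _) => /=; nra.
have cg x : (g n x)%:E @[n --> \oo] --> 0%E.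
  apply: cvg_EFin; first exact: nearW.
  rewrite (_ : 0 = (p x * \1_(`]a, b[%classic) x - p x * \1_(`]a, b[%classic) x) ^+ 2);
    last by rewrite subrr expr0n.
  apply: cvgM; (apply: cvgB; first exact: cvg_cst);
    (apply: cvgM; [exact: cvg_cst|exact: plateau_cvg]).
have : (\int[mu]_(x in `[0%R, L]) (g n x)%:E)%E @[n --> \oo] --> (\int[mu]_(x in `[0%R, L]) 0)%E.
  have [] // := @dominated_convergence _ _ R mu `[0, L]%classic (measurable_itv _)
    (fun n => EFin \o g n) (cst 0%E) (EFin \o (fun x => p x ^+ 2)).
  - by move=> n; apply/measurable_EFinP; exact: mg.
  - by apply: aeW => x _; exact: cg.
  - by case: sp.
  - by apply: aeW => x n _; rewrite /= lee_fin ger0_norm ?sqr_ge0//; exact: pl.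
rewrite integral0 => /fine_cvg /cvgr0_norm_lt /(_ _ (exprn_gt0 2 e0)) [N _ /(_ N (leqnn N))].
rewrite /= => hN; exists (fun x => p x * plateau a b N x); first exact: plateau_Cc.
rewrite -(ltr_pXn2r (n := 2)) ?nnegrE ?nrm_ge0 ?(ltW e0)// nrm_sqr.
by apply: (le_lt_trans (ler_norm _)).
Qed.

Lemma ae_exists (P : R -> Prop) a b : a < b -> {ae mu, forall x, P x} ->
  exists x, [/\ a < x, x < b & P x].
Proof.
move=> ab [N [mN N0 sub]]; apply: contrapT => h.
have : (mu `]a, b[ <= mu N)%E.
  apply: le_measure; rewrite ?inE// => x /= xab; apply: sub => /= Px; apply: h.
  by move: xab; rewrite in_itv/= => /andP[? ?]; exists x.
by rewrite N0 lebesgue_measure_itv/= lte_fin ab leNgt lte_fin subr_gt0 ab.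
Qed.

Lemma ae_neq (a : R) : {ae mu, forall x, x <> a}.
Proof.
exists [set a]; split => //; first exact: lebesgue_measure_set1.
by move=> x /= /contrapT.
Qed.

End dense_functions.

(** * The lemma of du Bois-Reymond *)

Section du_bois_reymond.
Context {R : realType}.
Notation mu := (@lebesgue_measure R).
Implicit Types (u v f g phi chi : R -> R) (L : R).

Lemma int_nrm L u : 0 <= L -> sqint `[0, L] u ->
  `|\int[mu]_(x in `[0, L]) u x| <= Num.sqrt L * nrm `[0, L] u.
Proof.
move=> L0 su; rewrite -ler_sqr ?nnegrE ?mulr_ge0 ?nrm_ge0 ?sqrtr_ge0//.
rewrite real_normK ?num_real// exprMn nrm_sqr// sqr_sqrtr//.
by have := int_CS L0 su; rewrite subr0.
Qed.

Lemma Cc_unit L : 0 < L -> exists2 chi, Cc L chi & \int[mu]_(x in `[0, L]) chi x = 1.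
Proof.
move=> L0; have L0' := ltW L0.
have c1 : continuous (cst 1 : R -> R) by move=> x; exact: cvg_cst.
have [s1 h] := approx_Cc_piece (lexx 0) L0 (lexx L) c1.
(* With this tolerance the integral of [chi] differs from [L] by at most [L / 2]; it is positive and
   can be normalised. *)
have [|chi Cchi hchi] := h (Num.sqrt L / 2); first by rewrite divr_gt0 ?sqrtr_gt0.
set m := \int[mu]_(x in `[0, L]) chi x.
have sc := Cc_sqint Cchi.
have ichi := sqint_int (measurable_itv `[0, L]) (itv_measure_lty 0 L) sc.
have i1 := sqint_int (measurable_itv `[0, L]) (itv_measure_lty 0 L) s1.
have := int_nrm L0' (sqintB (measurable_itv _) s1 sc).
rewrite RintegralB// -/m => hm.
have E1 : \int[mu]_(x in `[0, L]) (cst 1 x * \1_(`]0, L[%classic) x) = L.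
  rewrite -[RHS]subr0 -[RHS]mul1r -Rintegral_cst_itv//.
  apply: Rintegral_ae => //; [exact: (proj1 s1)|].
  move: (ae_neq (0 : R)) (ae_neq (L : R)); apply: filterS2 => x x0 xL.
  rewrite /= !in_itv/= => /andP[x0' xL']; rewrite mul1r indicE mem_setE in_itv/=.
  by rewrite !lt_neqAle x0' xL' !andbT eq_sym (introN eqP x0) (introN eqP xL).
rewrite E1 in hm.
have m0 : 0 < m.
  have /(ler_wpM2l (sqrtr_ge0 L)) := ltW hchi.
  rewrite mulrA -expr2 sqr_sqrtr// => /(le_trans hm).
  by rewrite ler_norml => /andP[_]; lra.
exists (fun x => m^-1 * chi x); first exact: Cc_scale.
by rewrite RintegralZl// -/m mulVf// gt_eqF.
Qed.

Lemma ip_Cc_eq0 L v w : sqint `[0, L] v -> approx_Cc L w ->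
  (forall chi, Cc L chi -> ip `[0, L] v chi = 0) -> ip `[0, L] v w = 0.
Proof.
move=> sv [sw hw] h; apply/eqP; rewrite -normr_eq0 -[_ == 0]negbK; apply/negP => n0.
have {n0} : 0 < `|ip `[0, L] v w| by rewrite lt_def n0/=.
set t := `|_| => t0.
have N0 : 0 < nrm `[0, L] v + 1 by rewrite ltr_wpDl ?nrm_ge0.
have [|chi Cchi hchi] := hw (t / (nrm `[0, L] v + 1)); first by rewrite divr_gt0.
have sc := Cc_sqint Cchi; have sd := sqintB (measurable_itv _) sw sc.
have : t <= nrm `[0, L] v * nrm `[0, L] (fun x => w x - chi x).
  apply: le_trans (ip_le_nrm (measurable_itv _) sv sd); rewrite (ipBr (measurable_itv _) sw sc sv) (h _ Cchi) subr0.
have := ltW hchi; rewrite ler_pdivlMr// => h1 h2.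
have := nrm_ge0 `[0, L] (fun x => w x - chi x); have := nrm_ge0 `[0, L] v.
move: hchi; rewrite ltr_pdivlMr//; nra.
Qed.

(** Lebesgue differentiation: almost everywhere [v] is the derivative of its indefinite integral,
    which is 0 near every interior point. *)
Lemma int_eq0_ae (a b : R) v : mu.-integrable `[a, b] (EFin \o v) ->
  (forall x, a < x < b -> \int[mu]_(t in `[a, x]) v t = 0) -> aeq `[a, b] v (cst 0).
Proof.
move=> iv h.
have iV := integrable_patch (measurable_itv _) iv.
set V := v \_ `[a, b] in iV.
have lV : locally_integrable [set: R] V by apply: open_integrable_locally => //; exact: openT.
have iVy y : mu.-integrable [set` Interval (BLeft a) (BRight y)] (EFin \o V).
  by apply: integrableS iV.
have := FTC1 iVy lV.
move: (ae_neq a) (ae_neq b); apply: filterS3 => x x0 xL + /= .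
rewrite in_itv/= => + /andP[x0' xL'].
have {}x0 : a < x by rewrite lt_def x0' andbT; apply/eqP.
have {}xL : x < b by rewrite lt_neqAle xL' andbT; apply/eqP.
rewrite lte_fin => /(_ x0) [_ ]; rewrite /V patchE mem_setE in_itv/= x0' xL' /= => <-.
rewrite derive1E (@near_eq_derive _ _ _ _ (cst 0)) ?derive_cst//.
near=> y; rewrite -[RHS](h y); last by apply/andP; split; near: y; [exact: lt_nbhsr|exact: lt_nbhsl].
apply: eq_Rintegral => z; rewrite inE/= in_itv/= => /andP[z0 zy].
rewrite patchE mem_setE in_itv/= z0 (le_trans zy)//= ltW//.
by near: y; exact: lt_nbhsl.
Unshelve. all: by end_near. Qed.

Lemma prim_eq0_ae L v : sqint `[0, L] v ->
  (forall x, 0 < x < L -> prim v x = 0) -> aeq `[0, L] v (cst 0).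
Proof.
by move=> sv; apply: int_eq0_ae; apply: sqint_int sv => //; exact: itv_measure_lty.
Qed.

Lemma Rintegral_sub (a b x y : R) u : mu.-integrable `[a, b] (EFin \o u) ->
  a <= x -> x <= y -> y <= b ->
  \int[mu]_(t in `[a, y]) u t - \int[mu]_(t in `[a, x]) u t =
  \int[mu]_(t in `[x, y]) u t.
Proof.
move=> iu ax xy yb; rewrite Rintegral_itvB ?bnd_simp//; last first.
  by apply: integrableS iu => //; apply: subset_itvl; rewrite bnd_simp.
apply: Rintegral_itv_obnd_cbnd; apply: integrableS iu => //.
by apply: subset_itv; rewrite bnd_simp.
Qed.

(* The integral is 1/2-Hoelder, hence constant as soon as it is so a.e. *)
Lemma int_ae_cst (a b c x : R) g : sqint `[a, b] g ->
  aeq `[a, b] (fun y => \int[mu]_(t in `[a, y]) g t) (cst c) -> a <= x < b ->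
  \int[mu]_(t in `[a, x]) g t = c.
Proof.
move=> sg h /andP[x0 xL]; apply/eqP; rewrite -subr_eq0 -sqrf_eq0.
rewrite eq_le sqr_ge0 andbT; apply/ler_addgt0Pl => e e0; rewrite addr0.
set I := (`[a, b]%classic : set R) in sg *.
have mI : measurable I by exact: measurable_itv.
have ig := sqint_int mI (itv_measure_lty a b) sg.
(* A point [y] of []x, x + d[] stays in [[a, b]], and the Hoelder bound [(y - x) * ip I g g] is at
   most [e]. The [+ 1] keeps the denominator positive. *)
pose d := Num.min (b - x) (e / (ip I g g + 1)).
have N0 : 0 < ip I g g + 1 by rewrite ltr_wpDl ?ip_ge0.
have d0 : 0 < d by rewrite lt_min subr_gt0 xL divr_gt0.
have [|y [xy yd hy]] := ae_exists _ h (a := x) (b := x + d); first by rewrite ltrDl.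
have yL : y <= b by move: yd; rewrite -ltrBlDl lt_min => /andP[+ _]; lra.
have ye : (y - x) * (ip I g g + 1) <= e.
  by move: yd; rewrite -ltrBlDl lt_min ltr_pdivlMr// => /andP[_ /ltW].
have <- : \int[mu]_(t in `[a, y]) g t = c.
  by apply: hy; rewrite /= in_itv/= yL (le_trans x0 (ltW xy)).
have sub : `[x, y]%classic `<=` I by apply: subset_itv; rewrite bnd_simp.
rewrite -sqrrN opprB (Rintegral_sub ig x0 (ltW xy) yL).
apply: (le_trans (int_CS (ltW xy) (sqintS mI (measurable_itv _) sub sg))).
apply: le_trans ye; apply: ler_wpM2l; first by rewrite subr_ge0 ltW.
by rewrite -[leLHS]addr0 lerD// ipS.
Qed.

(** Subtracting from [chi] its integral times [chi0] leaves the derivative of a [C1c] function.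
    Hence [u - c], with [c] the product of [u] and [chi0], is orthogonal to all of [Cc], then to the
    indicators of []0, x[]: its antiderivative vanishes. *)
Lemma du_bois_reymond L u : 0 < L -> sqint `[0, L] u ->
  (forall phi, C1c L phi -> ip `[0, L] u (derive1 phi) = 0) ->
  exists c, aeq `[0, L] u (cst c).
Proof.
move=> L0 su h; have [chi0 C0 int0] := Cc_unit L0.
exists (ip `[0, L] u chi0); set c := ip _ _ _.
have sc := sqint_cst (measurable_itv `[0, L]) (itv_measure_lty 0 L) c.
have sv := sqintB (measurable_itv _) su sc.
have i0 := sqint_int (measurable_itv `[0, L]) (itv_measure_lty 0 L) (Cc_sqint C0).
have vchi chi : Cc L chi -> ip `[0, L] (fun x => u x - c) chi = 0.
  move=> Cchi; pose m := \int[mu]_(x in `[0, L]) chi x.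
  have ichi := sqint_int (measurable_itv `[0, L]) (itv_measure_lty 0 L) (Cc_sqint Cchi).
  have Cz : Cc L (fun x => chi x + - m * chi0 x) by apply: Cc_add => //; exact: Cc_scale.
  have intz : \int[mu]_(x in `[0, L]) (chi x + - m * chi0 x) = 0.
    rewrite RintegralD//; last exact: integrableZ_fin.
    by rewrite RintegralZl// int0 mulr1 subrr.
  have := h _ (antider_C1c Cz L0 intz).
  rewrite (_ : derive1 _ = (fun x => chi x + - m * chi0 x)); last first.
    by apply/funext => x; have [] := antider_FTC Cz x.
  have s0 := Cc_sqint C0; have schi := Cc_sqint Cchi.
  rewrite ipDr ?ipZr//; last exact: sqintZ.
  rewrite ipBl// -/c => hh.
  rewrite [X in _ - X](_ : _ = c * m); last by rewrite /ip RintegralZl.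
  by move: hh; rewrite mulNr [m * c]mulrC.
suff : forall x, 0 < x < L -> prim (fun x => u x - c) x = 0.
  move=> /(prim_eq0_ae sv); apply: filterS => x hx Dx.
  by apply/eqP; rewrite -subr_eq0; apply/eqP; exact: hx.
move=> x /andP[x0 xL].
have c1 : continuous (cst 1 : R -> R) by move=> y; exact: cvg_cst.
(* The indicator of []0, x[] is a limit of [Cc] functions, so it is orthogonal to [u - c]; the inner
   product is [prim (u - c) x]. *)
have ax := approx_Cc_piece (lexx 0) x0 (ltW xL) c1.
rewrite -[RHS](ip_Cc_eq0 sv ax vchi) /ip.
transitivity (\int[mu]_(y in `[0, L]) (((fun y => u y - c) \_ `[0, x]) y)).
  rewrite -Rintegral_mkcondr /prim; congr Rintegral.
  apply/seteqP; split => y /=; rewrite !in_itv/=; last by case.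
  by move=> /andP[-> yx]; rewrite yx (le_trans yx (ltW xL)).
apply: Rintegral_ae => //.
- apply/measurable_restrict => //; apply: measurable_funS (proj1 sv) => //.
- by apply: measurable_funM; [exact: (proj1 sv)|case: (proj1 ax)].
- move: (ae_neq (0 : R)) (ae_neq (x : R)); apply: filterS2 => y y0 yx.
  rewrite /= in_itv/= => /andP[y0' _]; rewrite indicE patchE !mem_setE !in_itv/= mul1r.
  rewrite !lt_neqAle y0' andTb eq_sym (introN eqP y0) (introN eqP yx)/=.
  by case: (y <= x); rewrite ?mulr1 ?mulr0.
Qed.

End du_bois_reymond.

(** * Uniqueness and calculus of weak derivatives *)

Section weak_derivatives.
Context {R : realType}.
Notation mu := (@lebesgue_measure R).
Variables (L : R) (L0 : 0 < L).
Notation I := (`[0, L]%classic : set R).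
Implicit Types (u v f g h phi : R -> R) (c : R).

Let mI : measurable I. Proof. exact: measurable_itv. Qed.
Let fI : (mu I < +oo)%E. Proof. exact: itv_measure_lty. Qed.

Lemma C1c_sqint phi : C1c L phi -> sqint I phi.
Proof. by move=> c1; apply: continuous_sqint; exact: C1c_continuous c1. Qed.

Lemma C1c_deriv_sqint phi : C1c L phi -> sqint I (derive1 phi).
Proof. by case=> _ c1 _; apply: continuous_sqint. Qed.

Lemma is_wderiv_prim c g : sqint I g -> is_wderiv L (fun x => c + prim g x) g.
Proof.
move=> sg; split; first exact/L2_sqint.
move=> phi c1; rewrite -[L2dot _ _ phi]/(ip I g phi) -(prim_ibp sg c1).
have sd := C1c_deriv_sqint c1.
rewrite -[LHS]/(ip I _ _) (ipDl mI (u := cst c) (sqint_cst mI fI c) (prim_sqint (ltW L0) sg) sd).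
have idphi := sqint_int mI fI sd.
rewrite [X in X + _ = _](_ : _ = 0) ?add0r//.
rewrite /ip RintegralZl// (C1c_FTC c1) ?(ltW L0)//.
by have [-> ->] := C1c_bnd c1; rewrite subrr mulr0.
Qed.

Lemma is_wderiv_ae u u' g g' : sqint I u -> sqint I u' -> sqint I g' ->
  aeq I u u' -> aeq I g g' -> is_wderiv L u g -> is_wderiv L u' g'.
Proof.
move=> su su' sg' uu gg [/L2_sqint sg h]; split; first exact/L2_sqint.
move=> phi c1; have sd := C1c_deriv_sqint c1; have sp := C1c_sqint c1.
have := h _ c1; rewrite -![L2dot _ _ _]/(ip I _ _).
rewrite (ip_ae mI su su' sd sd uu (aeq_refl _ _)).
by rewrite (ip_ae mI sg sg' sp sp gg (aeq_refl _ _)).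
Qed.

Lemma is_wderivB u v g h : sqint I u -> sqint I v -> is_wderiv L u g ->
  is_wderiv L v h -> is_wderiv L (fun x => u x - v x) (fun x => g x - h x).
Proof.
move=> su sv [/L2_sqint sg hg] [/L2_sqint sh hh].
split; first by apply/L2_sqint; exact: sqintB.
move=> phi c1; have sd := C1c_deriv_sqint c1; have sp := C1c_sqint c1.
rewrite -![L2dot _ _ _]/(ip I _ _) !ipBl//.
have := hg _ c1; have := hh _ c1; rewrite -![L2dot _ _ _]/(ip I _ _) => -> ->.
by rewrite opprB opprK addrC.
Qed.

Lemma prim_ae_cst g c x : sqint I g -> aeq I (prim g) (cst c) -> 0 <= x < L ->
  prim g x = c.
Proof. by move=> sg h; exact: int_ae_cst. Qed.

(** The antiderivative of [g - h] is orthogonal to all [phi'], hence constant almost everywhere; by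
    Hoelder continuity it is constant on [[0, L[], and its value at 0 is 0. *)
Lemma is_wderiv_uniq u g h : is_wderiv L u g -> is_wderiv L u h -> aeq I g h.
Proof.
move=> [/L2_sqint sg hg] [/L2_sqint sh hh].
pose d x := g x - h x; have sd : sqint I d by exact: sqintB.
have [c pc] : exists c, aeq I (prim d) (cst c).
  apply: du_bois_reymond => //; first exact: prim_sqint (ltW L0) sd.
  move=> phi c1; rewrite prim_ibp// ipBl//; last exact: C1c_sqint.
  have := hg _ c1; have := hh _ c1; rewrite -![L2dot _ _ _]/(ip I _ _) => -> /oppr_inj ->.
  by rewrite subrr oppr0.
have c0 : c = 0 by rewrite -(@prim_ae_cst d c 0)// ?prim0// lexx.
have : aeq I d (cst 0).
  apply: prim_eq0_ae => // x /andP[x0 xL].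
  by rewrite (prim_ae_cst sd pc) ?c0// (ltW x0).
by apply: filterS => x hx /hx/eqP; rewrite subr_eq0 => /eqP.
Qed.

(** Integration by parts makes [u - prim g] orthogonal to all [phi'], so du Bois-Reymond applies.
    This is the one-dimensional description of H^1. *)
Lemma is_wderivP u g : sqint I u -> is_wderiv L u g ->
  exists c, aeq I u (fun x => c + prim g x).
Proof.
move=> su [/L2_sqint sg h].
have sp := prim_sqint (ltW L0) sg.
have [c hc] : exists c, aeq I (fun x => u x - prim g x) (cst c).
  apply: du_bois_reymond => //; first exact: sqintB.
  move=> phi c1; rewrite ipBl ?prim_ibp//; last exact: C1c_deriv_sqint.
  by have := h _ c1; rewrite -![L2dot _ _ _]/(ip I _ _) => ->; rewrite subrr.
exists c; apply: filterS hc => x hx /hx /= <-; ring.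
Qed.

Lemma wderivP u g : is_wderiv L u g -> is_wderiv L u (wderiv L u).
Proof. by move=> h; apply: (xgetPex (cst 0)); exists g. Qed.

Lemma wderiv_ae u g : is_wderiv L u g -> aeq I (wderiv L u) g.
Proof. by move=> h; apply: is_wderiv_uniq (wderivP h) h. Qed.

Lemma sobolev_sqint k u : sobolev L k u -> sqint I u.
Proof. by case: k => [/L2_sqint//|k [/L2_sqint]]. Qed.

Lemma sobolev_ae k u v : sqint I v -> aeq I u v -> sobolev L k u -> sobolev L k v.
Proof.
move=> sv uv; case: k => [_|k [/L2_sqint su [g hg sg]]]; first exact/L2_sqint.
split; first exact/L2_sqint.
exists g => //; apply: is_wderiv_ae hg => //.
- by apply: sobolev_sqint sg.
- exact: aeq_refl.
Qed.

(** [sobolev] provides some regular weak derivative, while [wderiv] is an arbitrary choice; by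
    uniqueness they agree almost everywhere and share their regularity. *)
Lemma sobolev_wderiv k u : sobolev L k.+1 u ->
  is_wderiv L u (wderiv L u) /\ sobolev L k (wderiv L u).
Proof.
move=> [u2 [g hg sg]]; have hw := wderivP hg; split => //.
apply: sobolev_ae sg; first by case: hw => /L2_sqint.
exact: aeq_sym (wderiv_ae hg).
Qed.

Lemma wderiv_sqint k u : sobolev L k.+1 u -> sqint I (wderiv L u).
Proof. by move=> /sobolev_wderiv[_]; exact: sobolev_sqint. Qed.

Lemma sobolevB k u v : sobolev L k u -> sobolev L k v ->
  sobolev L k (fun x => u x - v x).
Proof.
elim: k u v => [u v /L2_sqint su /L2_sqint sv|k IH u v].
  by apply/L2_sqint; exact: sqintB.
move=> [/L2_sqint su [g hg sg]] [/L2_sqint sv [h hh sh]].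
split; first by apply/L2_sqint; exact: sqintB.
by exists (fun x => g x - h x); [exact: is_wderivB|exact: IH].
Qed.

(** As [wderiv] chooses representatives, linearity holds only almost everywhere. Allowing any [w]
    almost equal to [u - v] is what the induction needs after one derivative. *)
Lemma iter_wderivB k j u v w : sobolev L k u -> sobolev L k v -> sobolev L k w ->
  aeq I w (fun x => u x - v x) -> (j <= k)%N ->
  aeq I (iter j (wderiv L) w)
        (fun x => iter j (wderiv L) u x - iter j (wderiv L) v x).
Proof.
elim: j k u v w => [//|j IH] [//|k] u v w su sv sw wuv jk.
rewrite !iterSr.
have [hu su'] := sobolev_wderiv su; have [hv sv'] := sobolev_wderiv sv.
have [hw sw'] := sobolev_wderiv sw.
apply: (IH k) => //.
have su0 := sobolev_sqint su; have sv0 := sobolev_sqint sv.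
have := is_wderivB su0 sv0 hu hv.
apply: is_wderiv_uniq; apply: is_wderiv_ae hw => //.
- exact: sobolev_sqint sw.
- exact: sqintB.
- exact: sobolev_sqint sw'.
- exact: aeq_refl.
Qed.

Lemma sobolev_iter k j u : sobolev L k u -> (j <= k)%N ->
  sobolev L (k - j) (iter j (wderiv L) u).
Proof.
elim: j k u => [|j IH] [|k] u su //; rewrite ?subn0//.
by rewrite iterSr subSS ltnS; apply: IH; case: (sobolev_wderiv su).
Qed.

End weak_derivatives.

(** * H^1_0 as antiderivatives of functions of zero integral *)

Section H10_theory.
Context {R : realType}.
Notation mu := (@lebesgue_measure R).
Variables (L : R) (L0 : 0 < L).
Notation I := (`[0, L]%classic : set R).
Implicit Types (u v f g h phi : R -> R) (c : R).

Let mI : measurable I. Proof. exact: measurable_itv. Qed.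
Let fI : (mu I < +oo)%E. Proof. exact: itv_measure_lty. Qed.

Lemma nrm_le_sobolev k j u : (j <= k)%N ->
  nrm I (iter j (wderiv L) u) <= sobolev_norm L k u.
Proof.
move=> jk; rewrite /sobolev_norm -[leLHS]ger0_norm ?nrm_ge0// -sqrtr_sqr.
rewrite ler_wsqrtr// (bigD1 (Ordinal (jk : (j < k.+1)%N)))//= L2norm_nrm lerDl.
by apply: sumr_ge0 => i _; exact: sqr_ge0.
Qed.

Lemma C1c_prim phi x : C1c L phi -> 0 <= x -> prim (derive1 phi) x = phi x.
Proof. by move=> c1 x0; rewrite /prim (C1c_FTC c1)// (C1c_bnd c1).1 subr0. Qed.

Lemma is_wderiv_C1c phi : C1c L phi -> is_wderiv L phi (derive1 phi).
Proof.
move=> c1; have sd := C1c_deriv_sqint c1; have sp := C1c_sqint c1.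
apply: (is_wderiv_ae _ sp sd _ (aeq_refl _ _) (is_wderiv_prim L0 0 sd)).
- apply: sqintD => //; first exact: sqint_cst.
  exact: prim_sqint (ltW L0) sd.
- by apply: aeW => x; rewrite /= in_itv/= => /andP[x0 _]; rewrite add0r C1c_prim.
Qed.

Lemma H10_wderiv u : H10 L u -> is_wderiv L u (wderiv L u).
Proof. by case=> /(sobolev_wderiv L0)[]. Qed.

Lemma H10_sqint u : H10 L u -> sqint I u.
Proof. by case=> /sobolev_sqint. Qed.

Lemma H10_wderiv_sqint u : H10 L u -> sqint I (wderiv L u).
Proof. by case=> /(wderiv_sqint L0). Qed.

Lemma H10_approx u e : H10 L u -> 0 < e -> exists2 phi, C1c L phi &
  nrm I (fun x => u x - phi x) < e /\
  nrm I (fun x => wderiv L u x - derive1 phi x) < e.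
Proof.
move=> hu e0; have [su1 h] := hu; have [phi c1 hphi] := h _ e0.
exists phi => //; split.
  exact: le_lt_trans (@nrm_le_sobolev 1 0 (u - phi) isT) hphi.
apply: le_lt_trans hphi; apply: le_trans (@nrm_le_sobolev 1 1 (u - phi) isT).
have hw := is_wderivB (H10_sqint hu) (C1c_sqint c1) (H10_wderiv hu) (is_wderiv_C1c c1).
rewrite le_eqVlt; apply/orP; left; apply/eqP; apply: nrm_ae => //.
- by case: hw => /L2_sqint.
- by case: (wderivP hw) => /L2_sqint.
- exact: aeq_sym (wderiv_ae L0 hw).
Qed.

Lemma le_eps_eq0 (a b : R) : 0 <= b -> (forall e, 0 < e -> `|a| <= b * e) -> a = 0.
Proof.
move=> b0 h; apply/eqP; rewrite -normr_le0; apply/ler_addgt0Pl => e e0; rewrite addr0.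
have b1 : 0 < b + 1 by rewrite ltr_wpDl.
apply: (le_trans (h (e / (b + 1)) (divr_gt0 e0 b1))).
by rewrite mulrCA ger_pMr// ler_pdivrMr// mul1r lerDl.
Qed.

(** The boundary conditions at 0 and [L], without traces: the additive constant and the integral of
    the derivative are 0 for [C1c] functions and are controlled by the H^1 distance to them. *)
Lemma H10_prim u : H10 L u ->
  aeq I u (prim (wderiv L u)) /\ \int[mu]_(x in I) wderiv L u x = 0.
Proof.
move=> hu; have su := H10_sqint hu; have sg := H10_wderiv_sqint hu.
have hw := H10_wderiv hu.
have [c hc] := is_wderivP L0 su hw.
split; last first.
  apply: (@le_eps_eq0 _ (Num.sqrt L)); first exact: sqrtr_ge0.
  move=> e /(H10_approx hu)[phi c1 [_ h]].
  have sd := C1c_deriv_sqint c1.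
  have := int_nrm (ltW L0) (sqintB mI sg sd).
  rewrite RintegralB//; [|exact: sqint_int..].
  rewrite (C1c_FTC c1) ?(ltW L0)//; have [-> ->] := C1c_bnd c1.
  rewrite !subr0 => /le_trans; apply.
  by rewrite ler_wpM2l ?sqrtr_ge0// ltW.
have c0 : c = 0.
  apply: (@le_eps_eq0 _ ((1 + L) / Num.sqrt L)).
    by rewrite divr_ge0 ?sqrtr_ge0// addr_ge0 ?ltW.
  move=> e /(H10_approx hu)[phi c1 [h1 h2]].
  have sd := C1c_deriv_sqint c1; have sp := C1c_sqint c1.
  rewrite mulrAC ler_pdivlMr ?sqrtr_gt0// mulrC -nrm_cst ?(ltW L0)//.
  have sup := sqintB mI su sp; have sgd := sqintB mI sg sd.
  have spr := prim_sqint (ltW L0) sgd.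
  rewrite (nrm_ae mI (sqint_cst mI fI c) (sqintB mI sup spr)); last first.
    apply: filterS hc => x hx Ix; rewrite hx//.
    move: Ix; rewrite /= in_itv/= => /andP[x0 xL].
    rewrite (@primB _ L)//; [|exact: sqint_int..].
    by rewrite C1c_prim//=; ring.
  apply: (le_trans (nrmB mI sup spr)).
  apply: (le_trans (lerD (lexx _) (prim_nrm (ltW L0) sgd))).
  rewrite mulrDl mul1r; apply: lerD; first exact: ltW.
  by rewrite ler_wpM2l ?ltW.
by apply: filterS hc => x hx /hx ->; rewrite c0 add0r.
Qed.

Lemma wderiv_prim g : sqint I g -> aeq I (wderiv L (prim g)) g.
Proof.
move=> sg; apply: (wderiv_ae L0).
rewrite (_ : prim g = fun x => 0 + prim g x); first exact: is_wderiv_prim.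
by apply/funext => x; rewrite add0r.
Qed.

Lemma sobolev_prim g : sqint I g -> sobolev L 1 (prim g).
Proof.
move=> sg; split; first by apply/L2_sqint; exact: prim_sqint (ltW L0) sg.
exists g; last exact/L2_sqint.
rewrite (_ : prim g = fun x => 0 + prim g x); first exact: is_wderiv_prim.
by apply/funext => x; rewrite add0r.
Qed.

(** Converse of [H10_prim]: approximate [g] by [chi] in [Cc], correct its integral [m] by a multiple
    of [chi0], and take the antiderivative. The correction is small because [g] has zero
    integral. *)
Lemma prim_H10 g : approx_Cc L g -> \int[mu]_(x in I) g x = 0 -> H10 L (prim g).
Proof.
move=> [sg hg] int0; have sp1 := sobolev_prim sg; split => // e e0.
have [chi0 C0 int1] := Cc_unit L0.
have s0 := Cc_sqint C0.
(* The first factor pays for correcting the integral of [chi]; the second bounds the function by its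
   derivative (Poincare) and adds the derivative itself. *)
pose K := (1 + Num.sqrt L * nrm I chi0) * (1 + L).
have K0 : 0 < K.
  rewrite mulr_gt0//; last by rewrite ltr_wpDr ?ltW.
  by rewrite ltr_wpDr// mulr_ge0 ?sqrtr_ge0 ?nrm_ge0.
have [|chi Cchi hchi] := hg (e / (2 * K)); first by rewrite divr_gt0// mulr_gt0.
have sc := Cc_sqint Cchi.
have ic := sqint_int mI fI sc; have ig := sqint_int mI fI sg.
have i0 := sqint_int mI fI s0.
pose m := \int[mu]_(x in I) chi x.
have Cz : Cc L (fun x => chi x + - m * chi0 x) by apply: Cc_add => //; exact: Cc_scale.
have sz := Cc_sqint Cz.
have intz : \int[mu]_(x in I) (chi x + - m * chi0 x) = 0.
  rewrite RintegralD//; last exact: integrableZ_fin.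
  by rewrite RintegralZl// int1 mulr1 subrr.
have c1 := antider_C1c Cz L0 intz.
exists (antider (fun x => chi x + - m * chi0 x)) => //.
set z := fun x => chi x + _ in Cz sz intz c1 *.
have dz : derive1 (antider z) = z by apply/funext => x; have [] := antider_FTC Cz x.
have sgc := sqintB mI sg sc.
have hm : `|m| <= Num.sqrt L * nrm I (fun x => g x - chi x).
  have := int_nrm (ltW L0) sgc; rewrite RintegralB// int0 sub0r normrN.
  by move=> /le_trans; apply.
have sgz := sqintB mI sg sz.
have nz : nrm I (fun x => g x - z x) <=
    (1 + Num.sqrt L * nrm I chi0) * nrm I (fun x => g x - chi x).
  rewrite (_ : (fun x => _) = (fun x => (g x - chi x) + m * chi0 x)); last first.
    by apply/funext => x; rewrite /z; ring.
  apply: (le_trans (nrmD mI sgc (sqintZ mI m s0))).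
  rewrite (nrmZ mI)// mulrDl mul1r lerD2l mulrAC.
  by rewrite ler_wpM2r ?nrm_ge0.
have spz := prim_sqint (ltW L0) sgz.
have sp := prim_sqint (ltW L0) sg; have sa := C1c_sqint c1.
have hw := wderivP (is_wderiv_C1c c1).
have hd : is_wderiv L (prim g - antider z) (fun x => g x - z x).
  have hdz : is_wderiv L (antider z) z by rewrite -{2}dz; exact: is_wderiv_C1c.
  have hp : is_wderiv L (prim g) g.
    rewrite (_ : prim g = fun x => 0 + prim g x); first exact: is_wderiv_prim.
    by apply/funext => x; rewrite add0r.
  exact: (is_wderivB sp sa hp hdz).
have spa := sqintB mI sp sa.
have E0 : nrm I (prim g - antider z) <= L * nrm I (fun x => g x - z x).
  apply: le_trans (prim_nrm (ltW L0) sgz); rewrite le_eqVlt; apply/orP; left; apply/eqP.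
  apply: nrm_ae => //; apply: aeW => x; rewrite /= in_itv/= => /andP[x0 xL].
  rewrite (@primB _ L)//; [|exact: sqint_int..].
  by rewrite -(antider_prim Cz).
have E1 : nrm I (wderiv L (prim g - antider z)) = nrm I (fun x => g x - z x).
  apply: nrm_ae => //; last exact (wderiv_ae L0 hd).
  by case: (wderivP hd) => /L2_sqint.
rewrite /sobolev_norm big_ord_recl big_ord1 !L2norm_nrm /= E1.
set N := nrm I (fun x => g x - z x) in E0 nz *.
set P := nrm I _ in E0 *.
have N0 : 0 <= N by exact: nrm_ge0.
have P0 : 0 <= P by exact: nrm_ge0.
apply: (@le_lt_trans _ _ (P + N)).
  rewrite -[leRHS]ger0_norm ?addr_ge0// -sqrtr_sqr ler_wsqrtr//; nra.
apply: (@le_lt_trans _ _ ((1 + L) * N)); first by rewrite mulrDl mul1r addrC lerD2l.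
apply: (@le_lt_trans _ _ (K * nrm I (fun x => g x - chi x))).
  by rewrite /K mulrAC mulrC ler_wpM2r// addr_ge0// ltW.
have K2 : 0 < 2 * K by lra.
move: hchi; rewrite ltr_pdivlMr//.
have := nrm_ge0 I (fun x => g x - chi x); nra.
Qed.

End H10_theory.

(** * Piecewise polynomials *)

Section partition.
Context {R : realType}.
Notation mu := (@lebesgue_measure R).
Variables (L : R) (s : seq R) (ps : itv_partition 0 L s).

Notation node i := ((0 :: s)`_i).

Lemma node_lt i : (i < size s)%N -> node i < node i.+1.
Proof. by case: ps => + _ => /(pathP 0); exact. Qed.

Lemma node_le i j : (i <= j)%N -> (j <= size s)%N -> node i <= node j.
Proof.
elim: j => [|j IH]; first by rewrite leqn0 => /eqP ->.
rewrite leq_eqVlt => /predU1P[-> //|]; rewrite ltnS => ij js.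
by apply: (le_trans (IH ij (ltnW js))); rewrite ltW// node_lt.
Qed.

Lemma node_ge0 i : (i <= size s)%N -> 0 <= node i.
Proof. by move=> js; apply: (node_le (i := 0)). Qed.

Lemma node_last : node (size s) = L.
Proof. by case: ps => _ /eqP <-; rewrite -(nth_last 0) /=; case: (s). Qed.

Lemma node_leL i : (i <= size s)%N -> node i <= L.
Proof. by move=> js; rewrite -node_last node_le. Qed.

Lemma mesh_ge i : (i < size s)%N -> node i.+1 - node i <= mesh_size s.
Proof.
by move=> js; rewrite /mesh_size (le_bigmax _ (fun i : 'I_(size s) => s`_i - node i) (Ordinal js)).
Qed.

Lemma mesh_ge0 : 0 <= mesh_size s.
Proof. by rewrite /mesh_size; elim/big_rec: _ => // i x _ x0; rewrite le_max x0 orbT. Qed.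

Lemma ae_elements (P : R -> Prop) :
  (forall i, (i < size s)%N ->
     {ae mu, forall x, x \in `]node i, node i.+1[ -> P x}) ->
  {ae mu, forall x, `[0, L]%classic x -> P x}.
Proof.
move=> h.
have key k : (k <= size s)%N -> {ae mu, forall x, 0 < x < node k -> P x}.
  elim: k => [_|k IH ks]; first by apply: aeW => x /andP[/lt_trans h1 /h1]; rewrite ltxx.
  have := IH (ltnW ks); move: (h k ks) (ae_neq (node k)).
  apply: filterS3 => x h1 h2 h3 /andP[x0 xk].
  have [xlt|xge|xeq] := ltgtP x (node k).
  - by apply: h3; rewrite x0.
  - by apply: h1; rewrite in_itv/= xge.
  - by case: h2.
have := key _ (leqnn _); rewrite node_last.
move: (ae_neq (0 : R)) (ae_neq L); apply: filterS3 => x x0 xL hx.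
rewrite /= in_itv/= => /andP[x0' xL']; apply: hx.
by rewrite !lt_neqAle x0' xL' !andbT eq_sym (introN eqP x0) (introN eqP xL).
Qed.

(** Open elements keep the terms disjoint; the value at the nodes is 0, which is immaterial almost
    everywhere. *)
Definition pw (p : nat -> {poly R}) (x : R) :=
  \sum_(i < size s) (p i).[x] * \1_(`]node i, node i.+1[%classic) x.

Lemma pwE p i x : (i < size s)%N -> x \in `]node i, node i.+1[ -> pw p x = (p i).[x].
Proof.
move=> js xi; rewrite /pw (bigD1 (Ordinal js))//= big1 ?addr0.
  by rewrite indicE mem_setE xi mulr1.
move=> j /eqP ji; rewrite indicE; case: (boolP (_ \in _)); rewrite ?mulr0// => xj.
exfalso; apply: ji; apply: val_inj => /=; move: xj xi.
rewrite mem_setE !in_itv/= => /andP[j1 j2] /andP[i1 i2].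
have [lt_ij|lt_ji|//] := ltngtP j i.
- by have := lt_trans (lt_le_trans j2 (node_le lt_ij (ltnW js))) i1; rewrite ltxx.
- by have := lt_trans (lt_le_trans i2 (node_le lt_ji (ltnW (ltn_ord j)))) j1; rewrite ltxx.
Qed.

Lemma pw_approx (L0 : 0 < L) p : approx_Cc L (pw p).
Proof.
rewrite /pw; elim: (index_enum _) => [|i t IH].
  rewrite (_ : (fun x => _) = cst 0); last by apply/funext => x; rewrite big_nil.
  split; first by apply: sqint_cst => //; exact: itv_measure_lty.
  move=> e e0; exists (cst 0); last first.
    rewrite (_ : (fun x => _) = cst 0) ?nrm_cst ?ltW// ?normr0 ?mulr0//.
    by apply/funext => x; rewrite subrr.
  split; first by move=> x; exact: cvg_cst.
  by exists (L / 3), (L / 2); split => //; lra.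
rewrite (_ : (fun x => _) = (fun x => (p i).[x] * \1_(`]node i, node i.+1[%classic) x +
    \sum_(j <- t) (p j).[x] * \1_(`]node j, node j.+1[%classic) x)); last first.
  by apply/funext => x; rewrite big_cons.
apply: approx_Cc_add IH; apply: approx_Cc_piece; last exact: continuous_horner.
- exact: (node_ge0 (ltnW (ltn_ord i))).
- exact: (node_lt (ltn_ord i)).
- exact: (node_leL (ltn_ord i)).
Qed.

Lemma piecewise_poly_pw m v : piecewise_poly m s v -> exists2 p : nat -> {poly R},
  forall i, (i < size s)%N -> (size (p i) <= m.+1)%N & aeq `[0, L] v (pw p).
Proof.
move=> h.
have /choice[p hp] : forall i, exists p : {poly R}, (i < size s)%N ->
    (size p <= m.+1)%N /\
    {ae mu, forall x, x \in `]node i, node i.+1[ -> v x = p.[x]}.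
  move=> i; case: (ltnP i (size s)) => [js|_]; last by exists 0.
  by have [p p1 p2] := h i js; exists p.
exists p => [i js|]; first by case: (hp i js).
apply: ae_elements => i js; have [_] := hp i js.
by apply: filterS => x hx xi; rewrite hx// (pwE _ js).
Qed.

Lemma pw_piecewise_poly m (p : nat -> {poly R}) : (forall i, (i < size s)%N -> (size (p i) <= m.+1)%N) ->
  piecewise_poly m s (pw p).
Proof.
move=> h i js; exists (p i); first exact: h.
by apply: aeW => x xi; rewrite (pwE _ js).
Qed.

Lemma piecewise_poly_approx m v : 0 < L -> sqint `[0, L] v -> piecewise_poly m s v ->
  approx_Cc L v.
Proof.
move=> L0 sv /piecewise_poly_pw[p _ hp].
by apply: approx_Cc_ae (pw_approx L0 p) => //; exact: aeq_sym.
Qed.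

End partition.

(** * Polynomial approximation on the elements of a mesh *)

Section piecewise_polynomials.
Context {R : realType}.
Notation mu := (@lebesgue_measure R).
Implicit Types (p q : {poly R}).

(** At [i = 0] the coefficient is a quotient by 0, which is 0 by convention. *)
Definition poly_primitive q : {poly R} := \poly_(i < (size q).+1) (q`_i.-1 / i%:R).

Lemma size_poly_primitive q : (size (poly_primitive q) <= (size q).+1)%N.
Proof. exact: size_poly. Qed.

Lemma deriv_poly_primitive q : (poly_primitive q)^`() = q.
Proof.
apply/polyP => i; rewrite coef_deriv coef_poly ltnS /=.
case: ltnP => iq; last by rewrite nth_default ?mul0rn.
by rewrite -[LHS]mulr_natr mulfVK// pnatr_eq0.
Qed.

Lemma poly_FTC p a b : a <= b ->
  \int[mu]_(x in `[a, b]) p^`().[x] = p.[b] - p.[a].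
Proof.
move=> ab; have c : continuous (derive1 (horner p)).
  by rewrite -derivE; exact: continuous_horner.
by rewrite -(continuous_deriv_FTC (@derivable_horner _ p) c ab) derivE.
Qed.

Lemma poly_sqint a b p : sqint `[a, b] (horner p).
Proof. by apply: continuous_sqint; exact: continuous_horner. Qed.

Variables (L : R) (L0 : 0 < L).
Notation I := (`[0, L]%classic : set R).
Let mI : measurable I. Proof. exact: measurable_itv. Qed.
Let fI : (mu I < +oo)%E. Proof. exact: itv_measure_lty. Qed.

Lemma sub_itvI a b : 0 <= a -> b <= L -> `[a, b]%classic `<=` I.
Proof. by move=> a0 bL; apply: subset_itv; rewrite bnd_simp. Qed.

(* Taylor polynomial at a: the remainder of order r.+1 is the primitive of the
   remainder of order r of the derivative. *)
Lemma taylor_approx r f a b : sobolev L r f -> 0 <= a -> a < b -> b <= L ->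
  exists2 p : {poly R}, (size p <= r)%N &
    ip `[a, b] (fun x => f x - p.[x]) (fun x => f x - p.[x]) <=
    (b - a) ^+ (2 * r) * ip `[a, b] (iter r (wderiv L) f) (iter r (wderiv L) f).
Proof.
move=> + a0 ab bL; have sub := sub_itvI a0 bL.
have mab := measurable_itv `[a, b].
elim: r f => [|r IH] f sf.
  exists 0; first by rewrite size_poly0.
  rewrite muln0 expr0 mul1r /= le_eqVlt; apply/orP; left; apply/eqP.
  by apply: eq_Rintegral => x _; rewrite horner0 subr0.
have [hw sw] := sobolev_wderiv L0 sf.
have sf0 := sobolev_sqint sf; have sg0 := sobolev_sqint sw.
set g := wderiv L f in hw sw sg0.
have [q sq hq] := IH _ sw.
have [c hc] := is_wderivP L0 sf0 hw.
(* [k] matches the values at [a], so that the remainder is the integral of [g - q] from [a]. *)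
pose P := poly_primitive q; pose k := c + prim g a - P.[a].
exists (P + k%:P).
  apply: (leq_trans (size_polyD _ _)); rewrite geq_max.
  rewrite (leq_trans (size_poly_primitive _)) ?ltnS//.
  by rewrite (leq_trans (size_polyC_leq1 _)).
have sgq : sqint `[a, b] (fun x => g x - q.[x]).
  by apply: sqintB => //; [exact: sqintS sub sg0|exact: poly_sqint].
have ig := sqint_int mI fI sg0.
pose A := ip `[a, b] (fun x => g x - q.[x]) (fun x => g x - q.[x]).
have rem x : x \in `[a, b] -> (c + prim g x - (P + k%:P).[x]) ^+ 2 <= (b - a) * A.
  rewrite in_itv/= => /andP[ax xb].
  have -> : c + prim g x - (P + k%:P).[x] = \int[mu]_(t in `[a, x]) (g t - q.[t]).
    have s1 : `[a, x]%classic `<=` I by apply: sub_itvI => //; exact: le_trans bL.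
    rewrite RintegralB//; last 2 first.
    - by apply: integrableS ig.
    - by apply: continuous_integrable_itv; exact: continuous_horner.
    rewrite -(prim_sub ig a0 ax) ?(le_trans xb)//.
    have -> : \int[mu]_(t in `[a, x]) q.[t] = P.[x] - P.[a].
      by rewrite -poly_FTC// deriv_poly_primitive.
    by rewrite hornerD hornerC /k; ring.
  have s2 : `[a, x]%classic `<=` `[a, b]%classic by apply: subset_itv; rewrite bnd_simp.
  apply: (le_trans (int_CS ax (sqintS mab (measurable_itv _) s2 sgq))).
  by apply: ler_pM; rewrite ?ip_ge0 ?subr_ge0 ?lerD2r// ipS.
have sfp : sqint `[a, b] (fun x => f x - (P + k%:P).[x]).
  by apply: sqintB => //; [exact: sqintS sub sf0|exact: poly_sqint].
have scp : sqint `[a, b] (fun x => c + prim g x - (P + k%:P).[x]).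
  apply: sqintB => //; [apply: sqintS sub _ => //|exact: poly_sqint].
  by apply: sqintD => //; [exact: sqint_cst|exact: prim_sqint (ltW L0) sg0].
rewrite (ip_ae mab sfp scp sfp scp); last 2 first.
- by apply: aeqB; [exact: aeqS sub hc|exact: aeq_refl].
- by apply: aeqB; [exact: aeqS sub hc|exact: aeq_refl].
have A0 : 0 <= A by exact: ip_ge0.
(* One factor [b - a] comes from Cauchy-Schwarz in [rem], the other from integrating the pointwise
   bound: each order gains [(b - a) ^+ 2] in the squared norm. *)
apply: (@le_trans _ _ ((b - a) * A * (b - a))).
  rewrite -(Rintegral_cst_itv _ (ltW ab)); apply: le_Rintegral => //.
  - exact: sqintM.
  - by apply: sqint_int (sqint_cst _ _ _) => //; exact: itv_measure_lty.
have -> : (b - a) * A * (b - a) = (b - a) ^+ 2 * A by ring.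
rewrite iterSr mulnS exprD -mulrA.
by apply: ler_wpM2l; [exact: sqr_ge0|exact: hq].
Qed.

Section mesh.
Variables (s : seq R) (ps : itv_partition 0 L s).
Notation node i := ((0 :: s)`_i).

Lemma ip_split a b c u : 0 <= a -> a <= b -> b <= c -> c <= L -> sqint I u ->
  ip `[a, c] u u = ip `[a, b] u u + ip `[b, c] u u.
Proof.
move=> a0 ab bc cL su.
have iu : mu.-integrable `[a, c] (EFin \o (fun x => u x * u x)).
  by apply: integrableS (sqintM mI su su) => //; exact: sub_itvI.
by rewrite /ip -(Rintegral_sub iu ab bc (lexx c)) addrC subrK.
Qed.

Lemma ip_elements K u v : sqint I u -> sqint I v ->
  (forall i, (i < size s)%N -> ip `[node i, node i.+1] u u <= K * ip `[node i, node i.+1] v v) ->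
  ip I u u <= K * ip I v v.
Proof.
move=> su sv h.
have key k : (k <= size s)%N -> ip `[0, node k] u u <= K * ip `[0, node k] v v.
  elim: k => [_|k IH ks]; first by rewrite /ip set_itv1 !Rintegral_set1 mulr0.
  have h0 := node_ge0 ps (ltnW ks); have h1 := ltW (node_lt ps ks).
  have h2 := node_leL ps ks.
  rewrite (ip_split (lexx 0) h0 h1 h2 su) (ip_split (lexx 0) h0 h1 h2 sv) mulrDr.
  by apply: lerD; [apply: IH; exact: ltnW|exact: h].
by have := key _ (leqnn _); rewrite (node_last ps).
Qed.

(** Taylor polynomials on each element, with no matching at the nodes, and squared errors added up.
    It is applied to theta', w' and gamma, so degree [r - 1] already gives order [r]. *)
Lemma piecewise_approx r f : sobolev L r f -> exists2 psi,
  L2 L psi /\ piecewise_poly r.-1 s psi &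
  nrm I (fun x => f x - psi x) <= mesh_size s ^+ r * nrm I (iter r (wderiv L) f).
Proof.
move=> sf; have sf0 := sobolev_sqint sf.
have /choice[p hp] : forall i, exists p : {poly R}, (i < size s)%N ->
   (size p <= r)%N /\
   ip `[node i, node i.+1] (fun x => f x - p.[x]) (fun x => f x - p.[x]) <=
   (node i.+1 - node i) ^+ (2 * r) *
     ip `[node i, node i.+1] (iter r (wderiv L) f) (iter r (wderiv L) f).
  move=> i; case: (ltnP i (size s)) => [js|_]; last by exists 0.
  have [p p1 p2] := taylor_approx sf (node_ge0 ps (ltnW js)) (node_lt ps js) (node_leL ps js).
  by exists p.
have [sw _] := pw_approx ps L0 p.
exists (pw s p).
  split; first exact/L2_sqint.
  apply: (pw_piecewise_poly ps) => i js; have [h _] := hp i js.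
  (* The bound required is [r.-1.+1], which is [r] for [r >= 1] and 1 for [r = 0]. *)
  by apply: (leq_trans h); exact: leqSpred.
have sfr : sqint I (iter r (wderiv L) f).
  by have := sobolev_iter L0 sf (leqnn r); exact: sobolev_sqint.
have sd := sqintB mI sf0 sw.
rewrite -ler_sqr ?nnegrE ?mulr_ge0 ?nrm_ge0 ?exprn_ge0 ?mesh_ge0//.
rewrite exprMn !nrm_sqr -exprM mulnC; apply: ip_elements => // i js.
have [_ h] := hp i js.
have n0 := node_ge0 ps (ltnW js); have n1 := node_lt ps js; have n2 := node_leL ps js.
have sub := sub_itvI n0 n2; have mn := measurable_itv `[node i, node i.+1].
have sfi := sqintS mI mn sub sf0.
have aepw : aeq `[node i, node i.+1] (fun x => f x - pw s p x) (fun x => f x - (p i).[x]).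
  move: (ae_neq (node i)) (ae_neq (node i.+1)); apply: filterS2 => x x0 x1.
  rewrite /= in_itv/= => /andP[h1 h2]; rewrite (pwE ps p js)// in_itv/=.
  by rewrite !lt_neqAle h1 h2 !andbT eq_sym (introN eqP x0) (introN eqP x1).
have s1 := sqintS mI mn sub sd.
have s2 := sqintB mn sfi (poly_sqint _ _ (p i)).
rewrite (ip_ae mn s1 s2 s1 s2 aepw aepw); apply: (le_trans h).
rewrite ler_wpM2r ?ip_ge0// lerXn2r ?nnegrE ?subr_ge0 ?(ltW n1) ?mesh_ge0//.
exact: mesh_ge.
Qed.

End mesh.
End piecewise_polynomials.

(** * Discrete spaces and their derivatives *)

Section finite_elements.
Context {R : realType}.
Notation mu := (@lebesgue_measure R).
Variables (L : R) (L0 : 0 < L) (s : seq R) (ps : itv_partition 0 L s).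
Notation I := (`[0, L]%classic : set R).
Notation node i := ((0 :: s)`_i).
Let mI : measurable I. Proof. exact: measurable_itv. Qed.
Let fI : (mu I < +oo)%E. Proof. exact: itv_measure_lty. Qed.
Implicit Types (u v psi : R -> R).

Lemma piecewise_polyB m u v : piecewise_poly m s u -> piecewise_poly m s v ->
  piecewise_poly m s (fun x => u x - v x).
Proof.
move=> hu hv i js; have [p sp hp] := hu i js; have [q sq hq] := hv i js.
exists (p - q).
  by rewrite (leq_trans (size_polyD _ _))// size_polyN geq_max sp.
by apply: filterS2 hp hq => x hp hq xi; rewrite hp// hq// hornerD hornerN.
Qed.

Lemma piecewise_poly_cst m c : piecewise_poly m s (cst c).
Proof.
move=> i js; exists c%:P; last by apply: aeW => x _; rewrite hornerC.
by rewrite (leq_trans (size_polyC_leq1 _)).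
Qed.

Lemma aeq_oo_cc a b u v : {ae mu, forall x, x \in `]a, b[ -> u x = v x} ->
  aeq `[a, b] u v.
Proof.
move: (ae_neq a) (ae_neq b); apply: filterS3 => x x0 x1 h.
rewrite /= in_itv/= => /andP[h1 h2]; apply: h; rewrite in_itv/=.
by rewrite !lt_neqAle h1 h2 !andbT eq_sym (introN eqP x0) (introN eqP x1).
Qed.

Lemma prim_piecewise m psi : sqint I psi -> piecewise_poly m s psi ->
  piecewise_poly m.+1 s (prim psi).
Proof.
move=> su hpsi i js; have [p sp hp] := hpsi i js.
have n0 := node_ge0 ps (ltnW js); have n1 := node_lt ps js; have n2 := node_leL ps js.
set a := node i in n0 n1 hp *; set b := node i.+1 in n1 n2 *.
pose P := poly_primitive p.
exists (P + (prim psi a - P.[a])%:P).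
  apply: (leq_trans (size_polyD _ _)); rewrite geq_max.
  rewrite (leq_trans (size_poly_primitive _)) ?ltnS//=.
  by rewrite (leq_trans (size_polyC_leq1 _)).
apply: aeW => x; rewrite in_itv/= => /andP[ax xb].
have ip := sqint_int mI fI su.
have xL : x <= L by apply: le_trans n2; exact: ltW.
have -> : prim psi x = prim psi a + \int[mu]_(t in `[a, x]) psi t.
  by rewrite -(prim_sub ip n0 (ltW ax) xL); ring.
rewrite [X in _ + X](_ : _ = P.[x] - P.[a]); last first.
  rewrite -poly_FTC ?ltW// deriv_poly_primitive.
  have sub : `[a, x]%classic `<=` I by exact: sub_itvI.
  apply: Rintegral_ae => //.
  - by apply: measurable_funS (proj1 su).
  - exact: (proj1 (poly_sqint a x p)).
  - have subab : `[a, x]%classic `<=` `[a, b]%classic.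
      by apply: subset_itv; rewrite bnd_simp// ltW.
    exact: aeqS subab (aeq_oo_cc hp).
by rewrite hornerD hornerC; ring.
Qed.

(** On an element, the integral from [a] of the weak derivative minus the classical derivative of
    the polynomial is almost everywhere a constant [kappa]. By continuity [kappa] is its value at
    [a], which is 0, so the integrand vanishes. *)
Lemma wderiv_piecewise m v : sobolev L 1 v -> piecewise_poly m s v ->
  piecewise_poly m.-1 s (wderiv L v).
Proof.
move=> sv hv i js; have [p sp hp] := hv i js.
have n0 := node_ge0 ps (ltnW js); have n1 := node_lt ps js; have n2 := node_leL ps js.
set a := node i in n0 n1 hp *; set b := node i.+1 in n1 n2 hp *.
exists p^`().
  rewrite /deriv (leq_trans (size_poly _ _))//.
  by apply: leq_trans (leqSpred m); move: sp; case: (size p).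
have [hw sw] := sobolev_wderiv L0 sv.
have sv0 := sobolev_sqint sv; have sg := sobolev_sqint sw.
set g := wderiv L v in hw sw sg *.
have [c hc] := is_wderivP L0 sv0 hw.
have sub := sub_itvI n0 n2; have mab := measurable_itv `[a, b].
pose d x := g x - p^`().[x].
have sd : sqint `[a, b] d.
  by apply: sqintB => //; [exact: sqintS sub sg|exact: poly_sqint].
have ig := sqint_int mI fI sg.
pose kappa := - (c + prim g a - p.[a]).
have F x : a <= x -> x <= b ->
    \int[mu]_(t in `[a, x]) d t = (prim g x - prim g a) - (p.[x] - p.[a]).
  move=> ax xb; have s1 : `[a, x]%classic `<=` I.
    by apply: sub_itvI => //; exact: le_trans n2.
  rewrite /d RintegralB//; last 2 first.
  - by apply: integrableS ig.
  - by apply: continuous_integrable_itv; exact: continuous_horner.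
  by rewrite -(prim_sub ig n0 ax) ?(le_trans xb)// poly_FTC.
have Fk : aeq `[a, b] (fun x => \int[mu]_(t in `[a, x]) d t) (cst kappa).
  apply: filterS2 (aeqS sub hc) (aeq_oo_cc hp) => x h1 h2 xab.
  move: (xab); rewrite /= in_itv/= => /andP[ax xb]; rewrite F//.
  by have := h1 xab; rewrite h2// => ->; rewrite /kappa; ring.
have k0 : kappa = 0.
  by rewrite -(int_ae_cst (x := a) sd Fk) ?lexx// set_itv1 Rintegral_set1.
have : aeq `[a, b] d (cst 0).
  apply: int_eq0_ae; first exact (sqint_int mab (itv_measure_lty a b) sd).
  by move=> x /andP[ax xb]; rewrite (int_ae_cst sd Fk) ?k0// (ltW ax).
apply: filterS => x hx; rewrite in_itv/= => /andP[ax xb].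
apply/eqP; rewrite -subr_eq0; apply/eqP; apply: hx.
by rewrite /= in_itv/= !ltW.
Qed.

(** Source of the discrete test functions. Continuity across nodes is automatic for an
    antiderivative, and piecewise polynomials are limits of [Cc] functions, as [prim_H10]
    requires. *)
Lemma Vh_prim r psi : (1 <= r)%N -> sqint I psi -> piecewise_poly r.-1 s psi ->
  \int[mu]_(x in I) psi x = 0 -> Vh L r s (prim psi) /\ H10 L (prim psi).
Proof.
move=> r1 su hpsi int0; split; last first.
  by apply: prim_H10 => //; exact: (piecewise_poly_approx ps L0 su hpsi).
split; first exact: sobolev_prim.
by rewrite -(prednK r1); exact: prim_piecewise.
Qed.

Lemma prim_cst0 : prim (cst 0 : R -> R) = cst 0.
Proof.
by apply/funext => x; rewrite /prim /Rintegral integral0.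
Qed.

Lemma Vh0 r : (1 <= r)%N -> Vh L r s (cst 0) /\ H10 L (cst 0).
Proof.
move=> r1; rewrite -prim_cst0; apply: Vh_prim => //.
- exact: sqint_cst.
- exact: piecewise_poly_cst.
- by rewrite Rintegral_cst_itv ?ltW// mul0r.
Qed.

End finite_elements.

(** * The steady problem *)

Section real_inequalities.
Context {R : rcfType}.
Implicit Types (a P Q X Y B c l k m K alpha beta : R).

(** If the bound failed then [X >= B], so [B ^+ 2 <= B * X], and after division by [X] the
    inequality is linear and contradicts the failure. *)
Lemma quad_le a P Q X B : 0 < a -> 0 <= P -> 0 <= Q -> 0 <= X -> 0 <= B ->
  a * X ^+ 2 <= P * B * X + Q * B ^+ 2 -> X <= ((P + Q) / a + 1) * B.
Proof.
move=> a0 P0 Q0 X0 B0 h; rewrite leNgt; apply/negP => hX.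
have PQ : 0 <= (P + Q) / a by rewrite divr_ge0 ?addr_ge0// ltW.
have BX : B <= X by apply: le_trans (ltW hX); rewrite mulrDl mul1r lerDr mulr_ge0.
have Xgt : 0 < X by apply: le_lt_trans hX; rewrite mulr_ge0// addr_ge0.
have : a * X ^+ 2 <= (P + Q) * B * X.
  by apply: (le_trans h); rewrite !mulrDl lerD2l expr2 -!mulrA ler_wpM2l// ler_wpM2l.
rewrite expr2 mulrA ler_pM2r// => h2.
have : X <= (P + Q) / a * B by rewrite mulrAC ler_pdivlMr// mulrC.
by move=> /(lt_le_trans hX); rewrite mulrDl mul1r; lra.
Qed.

(** Real-number core of the stability case: [X] stands for the norm of theta_h', [Y] for [|c|], [l]
    for lambda, and [m] for the factor by which discrete functions are smaller than their
    derivatives. [C] must serve all [l] and [m], although either may be arbitrarily small. *)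
Lemma stable_bound a k K alpha beta lmax mmax :
  0 < a -> 0 < k -> 0 <= K -> 0 <= alpha -> 0 <= beta ->
  exists2 C, 0 < C & forall l m X Y B,
    0 < l <= lmax -> 0 <= m -> m ^+ 2 <= mmax -> 0 <= X -> 0 <= Y -> 0 <= B ->
    a * X ^+ 2 + l * k * Y ^+ 2 <= K * B * (l * Y + m * X) ->
    (0 < m -> Y <= alpha * (X / m) + beta * B) ->
    X <= C * B /\ Y <= C * B.
Proof.
move=> a0 k0 K0 al0 be0; have a0' := ltW a0; have k0' := ltW k0.
(* Whichever of [l] and [m ^+ 2] is larger, [l / k + m ^+ 2 / a] is at most [S] times it. *)
pose S := k^-1 + a^-1.
have S0 : 0 < S by rewrite addr_gt0 ?invr_gt0.
pose C1 := K * Num.sqrt ((`|lmax| / k + `|mmax| / a) / a).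
pose C2 := K * Num.sqrt (S / k).
pose C3 := alpha * (K * Num.sqrt (S / a)) + beta.
have C10 : 0 <= C1 by rewrite mulr_ge0 ?sqrtr_ge0.
have C20 : 0 <= C2 by rewrite mulr_ge0 ?sqrtr_ge0.
have C30 : 0 <= C3 by rewrite addr_ge0 ?mulr_ge0 ?sqrtr_ge0.
exists (C1 + C2 + C3 + 1) => [|l m X Y B /andP[l0 ll] m0 mm X0 Y0 B0 h hY]; first by lra.
have l0' := ltW l0.
(* Young's inequality on each term of the right side; half of the energy is absorbed. *)
have key : a * X ^+ 2 + l * k * Y ^+ 2 <= (K * B) ^+ 2 * (l / k + m ^+ 2 / a).
  have h1 : K * B * (l * Y) <= l * k * Y ^+ 2 / 2 + (K * B) ^+ 2 * (l / k) / 2.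
    have : 0 <= l / k * (k * Y - K * B) ^+ 2 by rewrite mulr_ge0 ?sqr_ge0 ?divr_ge0.
    rewrite (_ : l / k * _ = l * k * Y ^+ 2 + (K * B) ^+ 2 * (l / k) - 2 * (K * B * (l * Y))).
      by lra.
    by field; rewrite gt_eqF.
  have h2 : K * B * (m * X) <= a * X ^+ 2 / 2 + (K * B) ^+ 2 * (m ^+ 2 / a) / 2.
    have : 0 <= a^-1 * (a * X - K * B * m) ^+ 2 by rewrite mulr_ge0 ?sqr_ge0 ?invr_ge0.
    rewrite (_ : a^-1 * _ = a * X ^+ 2 + (K * B) ^+ 2 * (m ^+ 2 / a) - 2 * (K * B * (m * X))).
      by lra.
    by field; rewrite gt_eqF.
  by move: h; rewrite mulrDr (mulrDr (_ ^+ 2)); lra.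
have KB0 : 0 <= K * B by rewrite mulr_ge0.
have lk0 : 0 <= l * k * Y ^+ 2 by rewrite mulr_ge0 ?sqr_ge0 ?mulr_ge0.
have aX0 : 0 <= a * X ^+ 2 by rewrite mulr_ge0 ?sqr_ge0.
have sqle (Z W D : R) : 0 <= Z -> 0 <= D -> 0 <= W -> Z ^+ 2 <= W ^+ 2 * D -> Z <= W * Num.sqrt D.
  move=> Z0 D0 W0 hZ; rewrite -ler_sqr ?nnegrE ?mulr_ge0 ?sqrtr_ge0//.
  by rewrite exprMn sqr_sqrtr.
have XC : X <= C1 * B.
  rewrite /C1 mulrAC; apply: sqle => //.
    by rewrite divr_ge0// addr_ge0 ?divr_ge0.
  rewrite mulrA ler_pdivlMr// mulrC.
  have : a * X ^+ 2 <= (K * B) ^+ 2 * (l / k + m ^+ 2 / a) by lra.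
  move=> /le_trans; apply; rewrite ler_wpM2l ?sqr_ge0//.
  by apply: lerD; rewrite ler_wpM2r ?invr_ge0//; apply: le_trans (ler_norm _).
have BB (D : R) : D <= C1 + C2 + C3 + 1 -> D * B <= (C1 + C2 + C3 + 1) * B.
  by move=> hD; rewrite ler_wpM2r.
split; first by apply: (le_trans XC); apply: BB; lra.
(* If [m ^+ 2 <= l] the energy bounds [Y] directly; otherwise it bounds [X / m],
   and [Y] is bounded by the last hypothesis. *)
have [ml|lm] := leP (m ^+ 2) l.
  apply: (@le_trans _ _ (C2 * B)); last by apply: BB; lra.
  rewrite /C2 mulrAC; apply: sqle => //; first by rewrite divr_ge0 ?ltW.
  rewrite mulrA ler_pdivlMr// mulrC -(ler_pM2l l0) mulrA.
  have : l * k * Y ^+ 2 <= (K * B) ^+ 2 * (l / k + m ^+ 2 / a) by lra.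
  move=> /le_trans; apply; rewrite mulrCA ler_wpM2l ?sqr_ge0// /S mulrDr lerD2l.
  by rewrite ler_wpM2r ?invr_ge0.
have mgt : 0 < m by rewrite lt_def m0 andbT; apply: contraTneq lm => ->; rewrite expr0n/= -leNgt ltW.
apply: (le_trans (hY mgt)).
apply: (@le_trans _ _ (C3 * B)); last by apply: BB; lra.
rewrite /C3 mulrDl lerD2r -mulrA ler_wpM2l// ler_pdivrMr//.
rewrite [leRHS](_ : _ = (K * B * m) * Num.sqrt (S / a)); last by ring.
apply: sqle => //; [by rewrite divr_ge0 ?ltW|by rewrite mulr_ge0|].
rewrite mulrA ler_pdivlMr// mulrC.
have : a * X ^+ 2 <= (K * B) ^+ 2 * (l / k + m ^+ 2 / a) by lra.
move=> /le_trans; apply; rewrite [leRHS](_ : _ = (K * B) ^+ 2 * (m ^+ 2 * S)); last by ring.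
rewrite ler_wpM2l ?sqr_ge0// /S mulrDr lerD2r.
by rewrite ler_wpM2r ?invr_ge0// ltW.
Qed.

End real_inequalities.

(** * Rotations of positive integral *)

Section test_functions.
Context {R : realType}.
Notation mu := (@lebesgue_measure R).
Variables (L : R) (L0 : 0 < L).
Notation I := (`[0, L]%classic : set R).
Let mI : measurable I. Proof. exact: measurable_itv. Qed.
Let fI : (mu I < +oo)%E. Proof. exact: itv_measure_lty. Qed.
Implicit Types (u v psi : R -> R).

(** [psi] is the derivative of the parabola [x (L - x)], of integral [L ^+ 3 / 6]. It has degree 1,
    so it is available on every mesh once [r >= 2]. *)
Lemma bubble : exists2 psi, sqint I psi /\
    (forall s r, (2 <= r)%N -> piecewise_poly r.-1 s psi) &
  \int[mu]_(x in I) psi x = 0 /\ 0 < \int[mu]_(x in I) prim psi x.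
Proof.
pose p : {poly R} := L *: 'X - 'X^2.
pose P : {poly R} := (L / 2)%:P * 'X^2 - (3^-1)%:P * 'X^3.
have dp x : p^`().[x] = L - 2 * x.
  by rewrite /p !poly.derivE !hornerE; ring.
have dP x : P^`().[x] = p.[x].
  by rewrite /P /p !poly.derivE !hornerE; field.
have E (x : R) : 0 <= x -> prim (horner p^`()) x = p.[x].
  by move=> x0; rewrite /prim poly_FTC// /p !hornerE; ring.
exists (horner p^`()).
  split; first exact: poly_sqint.
  move=> s r r2 i js; exists p^`(); last exact: aeW.
  rewrite (leq_trans (size_poly _ _))// prednK ?(ltn_trans _ r2)//.
  apply: leq_trans r2; rewrite -ltnS prednK.
    by apply: (leq_trans (size_polyD _ _)); rewrite size_polyN geq_max size_polyXn andbT
      (leq_trans (size_scale_leq _ _))// size_polyX.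
  rewrite lt0n size_poly_eq0; apply/eqP => p0.
  by have := dp 0; rewrite p0 deriv0 horner0 mulr0 subr0 => /eqP; rewrite eq_sym gt_eqF.
split; first by rewrite poly_FTC ?ltW// /p !hornerE; ring.
have -> : \int[mu]_(x in I) prim (horner p^`()) x = \int[mu]_(x in I) P^`().[x].
  by apply: eq_Rintegral => x; rewrite inE/= in_itv/= => /andP[x0 _]; rewrite E// dP.
rewrite poly_FTC ?ltW// /P !(hornerD, hornerN, hornerM, hornerC, hornerX).
rewrite [ltRHS](_ : _ = L ^+ 3 / 6); first by rewrite divr_gt0// exprn_gt0.
by field.
Qed.

(** Derivative of the hat of height 1 with peak at [y]. It is piecewise constant, hence usable for
    [r = 1], if [y] is a node; the integral of the hat is [L / 2] wherever the peak is. *)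
Definition hat' y (x : R) := if x < y then y^-1 else - (L - y)^-1.

Section hat.
Variables (y : R) (y0 : 0 < y) (yL : y < L).

Lemma hat'_sqint : sqint I (hat' y).
Proof.
apply: (@sqint_bounded _ _ mI fI _ (y^-1 + (L - y)^-1)).
  apply: measurable_funTS; apply: measurable_fun_ifT => //.
  by apply: measurable_fun_ltr.
have a0 : 0 < y^-1 by rewrite invr_gt0.
have b0 : 0 < (L - y)^-1 by rewrite invr_gt0 subr_gt0.
move=> x _; rewrite /hat'; case: ifP => _; rewrite ?normrN ger0_norm; lra.
Qed.

Lemma int_hat' a b : 0 <= a -> a <= b -> b <= y ->
  \int[mu]_(t in `[a, b]) hat' y t = y^-1 * (b - a).
Proof.
move=> a0 ab bY; rewrite -Rintegral_cst_itv//; apply: Rintegral_ae => //.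
- apply: measurable_funS (proj1 hat'_sqint) => //.
  by apply: sub_itvI => //; rewrite (le_trans bY) ?ltW.
- move: (ae_neq b); apply: filterS => x xb.
  rewrite /= in_itv/= => /andP[ax xb']; rewrite /hat' (lt_le_trans _ bY)//.
  by rewrite lt_neqAle xb' andbT; apply/eqP.
Qed.

Lemma int_hat'_r a b : y <= a -> a <= b -> b <= L ->
  \int[mu]_(t in `[a, b]) hat' y t = - (L - y)^-1 * (b - a).
Proof.
move=> ya ab bL; rewrite -Rintegral_cst_itv//; apply: eq_Rintegral => x.
by rewrite inE/= in_itv/= => /andP[ax xb]; rewrite /hat' ltNge (le_trans ya ax).
Qed.

Lemma prim_hat' x : 0 <= x -> x <= y -> prim (hat' y) x = y^-1 * x.
Proof. by move=> x0 xy; rewrite /prim int_hat'// subr0. Qed.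

Lemma prim_hat'_r x : y <= x -> x <= L -> prim (hat' y) x = (L - y)^-1 * (L - x).
Proof.
move=> yx xL; have ih := sqint_int mI fI hat'_sqint.
have := prim_sub ih (ltW y0) yx xL.
rewrite int_hat'_r// (prim_hat' (ltW y0) (lexx y)) => /(canRL (subrK _)) ->.
by field; rewrite gt_eqF ?subr_gt0// gt_eqF.
Qed.

Lemma hat'_int0 : \int[mu]_(x in I) hat' y x = 0.
Proof. by rewrite -[LHS]/(prim _ L) (prim_hat'_r (ltW yL) (lexx L)) subrr mulr0. Qed.

Lemma int_prim_hat' : \int[mu]_(x in I) prim (hat' y) x = L / 2.
Proof.
have ih := sqint_int mI fI (prim_sqint (ltW L0) hat'_sqint).
have := prim_sub ih (ltW y0) (ltW yL) (lexx L).
rewrite {1}/prim => /(canRL (subrK _)) ->.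
have -> : prim (prim (hat' y)) y = y / 2.
  transitivity (\int[mu]_(x in `[0, y]) ((y^-1 / 2)%:P * 'X^2 : {poly R})^`().[x]).
    apply: eq_Rintegral => x; rewrite inE/= in_itv/= => /andP[x0 xy].
    by rewrite prim_hat'// !poly.derivE !hornerE; field; rewrite gt_eqF.
  by rewrite poly_FTC ?ltW// !(hornerD, hornerN, hornerM, hornerC, hornerX); field; rewrite gt_eqF.
rewrite (_ : \int[mu]_(t in `[y, L]) prim (hat' y) t = (L - y) / 2); first by field.
transitivity (\int[mu]_(x in `[y, L])
   ((L - y)^-1%:P * (L%:P * 'X - (2^-1)%:P * 'X^2) : {poly R})^`().[x]).
  apply: eq_Rintegral => x; rewrite inE/= in_itv/= => /andP[x0 xy].
  by rewrite prim_hat'_r// !poly.derivE !hornerE; field; rewrite gt_eqF// subr_gt0.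
by rewrite poly_FTC ?ltW// !(hornerD, hornerN, hornerM, hornerC, hornerX); field; rewrite gt_eqF// subr_gt0.
Qed.

(** This energy blows up as [y] approaches an end point, which is why hats alone do not settle the
    case [r = 1]. *)
Lemma ip_hat' : ip I (hat' y) (hat' y) = y^-1 + (L - y)^-1.
Proof.
rewrite (ip_split (lexx 0) (ltW y0) (ltW yL) (lexx L) hat'_sqint); congr (_ + _).
  transitivity (\int[mu]_(t in `[0, y]) (y^-1 * hat' y t)).
    apply: Rintegral_ae => //.
    - have m : measurable_fun `[0, y] (hat' y).
        by apply: measurable_funS (proj1 hat'_sqint) => //; apply: sub_itvI => //; exact: ltW.
      exact: measurable_funM.
    - have m : measurable_fun `[0, y] (hat' y).
        by apply: measurable_funS (proj1 hat'_sqint) => //; apply: sub_itvI => //; exact: ltW.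
      exact: measurable_funM.
    - move: (ae_neq y); apply: filterS => x xy; rewrite /= in_itv/= => /andP[_ xy'].
      by rewrite {1}/hat' lt_neqAle xy' andbT (introN eqP xy).
  rewrite RintegralZl//; last first.
    apply: integrableS (sqint_int mI fI hat'_sqint) => //.
    by apply: sub_itvI => //; exact: ltW.
  by rewrite int_hat'// ?ltW// subr0; field; rewrite gt_eqF.
transitivity (\int[mu]_(t in `[y, L]) ((L - y)^-1 ^+ 2)).
  apply: eq_Rintegral => x; rewrite inE/= in_itv/= => /andP[yx _].
  by rewrite /hat' ltNge yx/= mulrNN expr2.
by rewrite Rintegral_cst_itv ?ltW//; field; rewrite gt_eqF// subr_gt0.
Qed.

Lemma hat'_piecewise s j : itv_partition 0 L s -> (j <= size s)%N -> y = (0 :: s)`_j ->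
  piecewise_poly 0 s (hat' y).
Proof.
move=> ps js yj i is_; case: (ltnP i j) => ij.
- exists (y^-1)%:P; first exact: size_polyC_leq1.
  apply: aeW => x; rewrite in_itv/= => /andP[_ xi]; rewrite hornerC /hat'.
  by rewrite (lt_le_trans xi)// yj; exact: (node_le ps ij js).
- exists (- (L - y)^-1)%:P; first exact: size_polyC_leq1.
  apply: aeW => x; rewrite in_itv/= => /andP[xi _]; rewrite hornerC /hat'.
  by rewrite ltNge (le_trans _ (ltW xi))// yj; exact: (node_le ps ij (ltnW is_)).
Qed.

End hat.
End test_functions.

(** * The alternative between a good test rotation and a coarse mesh *)

Section test_or_stable.
Context {R : realType}.
Notation mu := (@lebesgue_measure R).
Variables (L : R) (L0 : 0 < L).
Notation I := (`[0, L]%classic : set R).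
Let mI : measurable I. Proof. exact: measurable_itv. Qed.
Let fI : (mu I < +oo)%E. Proof. exact: itv_measure_lty. Qed.
Implicit Types (u v psi : R -> R).

Lemma mid_element s : itv_partition 0 L s -> exists2 i, (i < size s)%N &
  (0 :: s)`_i <= L / 2 <= (0 :: s)`_i.+1.
Proof.
have L2 : L / 2 <= L by move: L0 => L0'; lra.
move=> ps; have ex : exists j, L / 2 <= (0 :: s)`_j.
  by exists (size s); rewrite (node_last ps).
case: (ex_minnP ex) => -[|i] hi hmin; first by exfalso; move: hi; rewrite /= leNgt divr_gt0.
exists i; first by apply: hmin; rewrite (node_last ps).
by rewrite hi andbT leNgt; apply/negP => /ltW/hmin; rewrite ltnn.
Qed.

Lemma hat_bound (y m : R) : 0 < m -> 0 < y -> y < L ->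
  (m <= y /\ L / 2 <= L - y) \/ (L / 2 <= y /\ m <= L - y) -> m <= L / 2 -> nrm I (hat' L y) <= Num.sqrt (2 / m).
Proof.
have L0' := L0; move=> m0 y0 yL h mL; rewrite ler_wsqrtr// ip_hat'//.
have im : 0 < m^-1 by rewrite invr_gt0.
have iL (z : R) : L / 2 <= z -> z^-1 <= m^-1.
  by move=> hz; rewrite lef_pV2 ?posrE//; lra.
have im' (z : R) : m <= z -> z^-1 <= m^-1.
  by move=> hz; rewrite lef_pV2 ?posrE//; lra.
have -> : 2 / m = m^-1 + m^-1 by rewrite mulr_natl mulr2n.
by case: h => -[h1 h2]; apply: lerD; [exact: im'|exact: iL|exact: iL|exact: im'].
Qed.

(** Outside the element [[a, b]] the point lies within [m] of an end where [prim g] vanishes, and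
    Cauchy-Schwarz on that short piece gives [sqrt m]. On the element [g] is constant, so [prim g]
    is affine and bounded by its values at [a] and [b]. *)
Lemma prim_le_end s i m g : itv_partition 0 L s -> (i < size s)%N ->
  (0 :: s)`_i <= m -> L - (0 :: s)`_i.+1 <= m ->
  sqint I g -> piecewise_poly 0 s g -> \int[mu]_(x in I) g x = 0 ->
  forall x, x \in `[0, L] -> `|prim g x| <= Num.sqrt m * nrm I g.
Proof.
move=> ps js am bm sg pg int0.
set a := (0 :: s)`_i in am *; set b := (0 :: s)`_i.+1 in bm *.
have a0 : 0 <= a by exact: (node_ge0 ps (ltnW js)).
have ab : a < b by exact: (node_lt ps js).
have bL : b <= L by exact: (node_leL ps js).
have ig := sqint_int mI fI sg.
have m0 : 0 <= m by exact: le_trans am.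
have ends x : 0 <= x -> x <= L -> x <= a \/ b <= x -> `|prim g x| <= Num.sqrt m * nrm I g.
  move=> x0 xL h; rewrite -ler_sqr ?nnegrE ?mulr_ge0 ?nrm_ge0 ?sqrtr_ge0//.
  rewrite real_normK ?num_real// exprMn nrm_sqr sqr_sqrtr//.
  case: h => hx.
  - have := prim_CS sg (lexx 0) x0 xL; rewrite prim0 !subr0 => /le_trans; apply.
    by apply: ler_pM; rewrite ?ip_ge0 ?(le_trans hx)// ipS//; apply: sub_itvI.
  - have := prim_CS sg x0 xL (lexx L); rewrite {1}/prim int0 sub0r sqrrN => /le_trans; apply.
    apply: ler_pM; rewrite ?ip_ge0 ?subr_ge0//; first by lra.
    by rewrite ipS//; apply: sub_itvI.
move=> x; rewrite in_itv/= => /andP[x0 xL].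
have [xa|ax] := leP x a; first by apply: ends => //; left.
have [bx|xb] := leP b x; first by apply: ends => //; right.
have [p sp hp] := pg i js.
have {}hp : aeq `[a, b] g (cst p`_0).
  by apply: aeq_oo_cc; apply: filterS hp => t + ht => ->//; rewrite {1}(size1_polyC sp) hornerC.
have lin t : a <= t -> t <= b -> prim g t = prim g a + p`_0 * (t - a).
  move=> at_ tb; rewrite -Rintegral_cst_itv//.
  rewrite -(@Rintegral_ae _ `[a, t]%classic _ g) //.
  - by rewrite -(prim_sub ig a0 at_) ?(le_trans tb)//; ring.
  - by apply: measurable_funS (proj1 sg) => //; apply: sub_itvI => //; exact: le_trans bL.
  - by apply: aeqS hp; apply: subset_itv; rewrite bnd_simp.
have ha := ends a a0 (le_trans (ltW ab) bL) (or_introl (lexx a)).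
have hb := ends b (le_trans a0 (ltW ab)) bL (or_intror (lexx b)).
set K := Num.sqrt m * _ in ha hb *.
rewrite (lin x (ltW ax) (ltW xb)); rewrite (lin b (ltW ab) (lexx b)) in hb.
set A := prim g a in ha hb *; set k := p`_0 in hb *.
have /andP[h1 h2] : - K <= A <= K by rewrite -ler_norml.
have /andP[h3 h4] : - K <= A + k * (b - a) <= K by rewrite -ler_norml.
rewrite ler_norml.
have ba0 : 0 < b - a by rewrite subr_gt0.
have xa0 : 0 < x - a by rewrite subr_gt0.
have bx0 : 0 < b - x by rewrite subr_gt0.
apply/andP; split; rewrite -(ler_pM2r ba0).
- have h5 : 0 <= (b - x) * (A + K) by apply: mulr_ge0; [exact: ltW|lra].
  have h6 : 0 <= (x - a) * (A + k * (b - a) + K) by apply: mulr_ge0; [exact: ltW|lra].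
  by nra.
- have h5 : 0 <= (b - x) * (K - A) by apply: mulr_ge0; [exact: ltW|lra].
  have h6 : 0 <= (x - a) * (K - (A + k * (b - a))) by apply: mulr_ge0; [exact: ltW|lra].
  by nra.
Qed.

(* In the second case [m ^+ 2] is max (x_i, L - x_(i+1)), where [x_i, x_(i+1)] is
   the element that contains L / 2. *)
Lemma test_or_stable : exists c0 C0, [/\ 0 < c0, 0 < C0 & forall s r,
  itv_partition 0 L s -> (1 <= r)%N ->
  (exists2 psi, [/\ sqint I psi, piecewise_poly r.-1 s psi &
        \int[mu]_(x in I) psi x = 0] &
     c0 <= \int[mu]_(x in I) prim psi x /\ nrm I psi <= C0) \/
  (r = 1%N /\ exists m, [/\ 0 <= m, m ^+ 2 <= L, L / 2 <= mesh_size s,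
     forall g, sqint I g -> piecewise_poly 0 s g -> \int[mu]_(x in I) g x = 0 ->
       forall x, x \in `[0, L] -> `|prim g x| <= m * nrm I g &
     0 < m -> exists2 psi, [/\ sqint I psi, piecewise_poly 0 s psi &
        \int[mu]_(x in I) psi x = 0] &
     \int[mu]_(x in I) prim psi x = L / 2 /\ nrm I psi <= Num.sqrt 2 / m])].
Proof.
have L0' := L0; have [b [sb pb] [b0 cb]] := bubble L0.
(* Bound of [hat_bound] for a peak at distance at least [L / 4] from both ends. *)
pose C8 := Num.sqrt (2 / (L / 4)).
exists (Num.min (\int[mu]_(x in I) prim b x) (L / 2)), (nrm I b + C8 + 1).
have nb := nrm_ge0 I b; have C80 : 0 <= C8 by exact: sqrtr_ge0.
split; [by rewrite lt_min cb divr_gt0|lra|] => s r ps r1.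
have [r2|] := leqP 2 r.
  left; exists b; first by split => //; exact: pb.
  by split; [rewrite ge_min lexx|lra].
rewrite ltnS => r1'; have {r1 r1'} -> : r = 1%N by apply/eqP; rewrite eqn_leq r1 r1'.
have [i js /andP[ai bi]] := mid_element ps.
have a0 := node_ge0 ps (ltnW js); have ab := node_lt ps js; have bL := node_leL ps js.
set x0 := (0 :: s)`_i in ai a0 ab; set x1 := (0 :: s)`_i.+1 in bi ab bL.
pose m := Num.max x0 (L - x1).
have mL : m <= L / 2 by rewrite ge_max ai/=; lra.
have m0 : 0 <= m by rewrite le_max a0.
have hat : 0 < m -> exists2 psi, [/\ sqint I psi, piecewise_poly 0 s psi &
     \int[mu]_(x in I) psi x = 0] &
     \int[mu]_(x in I) prim psi x = L / 2 /\ nrm I psi <= Num.sqrt (2 / m).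
  (* The peak is put at the end of the middle element that realises the maximum [m]; it is at
     distance [m] from one end of the beam and at least [L / 2] from the other. *)
  move=> mgt; have [y [j [yj yE y0 yL hy]]] : exists y j, [/\ (j <= size s)%N,
      y = (0 :: s)`_j, 0 < y, y < L &
      (m <= y /\ L / 2 <= L - y) \/ (L / 2 <= y /\ m <= L - y)].
    have [h|h] := leP (L - x1) x0.
    - have mE : m = x0 by rewrite /m max_l.
      exists x0, i; split; [exact: ltnW|by []|by rewrite -mE|lra|].
      by left; rewrite mE lexx; split => //; lra.
    - have mE : m = L - x1 by rewrite /m max_r// ltW.
      exists x1, i.+1; split; [by []|by []|lra|by rewrite -subr_gt0 -mE|].
      by right; rewrite mE.
  exists (hat' L y).
    split; [exact: hat'_sqint|exact: hat'_piecewise ps yj yE|exact: hat'_int0].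
  by split; [exact: int_prim_hat'|exact: hat_bound].
(* If [m < L / 4], both nodes around the midpoint are within [L / 4] of the ends, so the middle
   element alone is longer than [L / 2]. *)
have [m4|m4] := leP (L / 4) m.
  left; have [|psi h1 [h2 h3]] := hat; first by apply: lt_le_trans m4; rewrite divr_gt0.
  exists psi => //; split; first by rewrite h2 ge_min lexx orbT.
  have : Num.sqrt (2 / m) <= C8.
    rewrite ler_wsqrtr// ler_wpM2l// lef_pV2 ?posrE// ?divr_gt0//.
    by apply: lt_le_trans m4; rewrite divr_gt0.
  by lra.
right; split => //; exists (Num.sqrt m); split.
- exact: sqrtr_ge0.
- by rewrite sqr_sqrtr//; lra.
- apply: le_trans (mesh_ge js); rewrite -/x0 -/x1.
  by move: m4; rewrite gt_max => /andP[]; lra.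
- move=> g sg pg g0; apply: (prim_le_end ps js) => //.
  + by rewrite le_max lexx.
  + by rewrite le_max lexx orbT.
- rewrite sqrtr_gt0 => mgt; have [psi h1 [h2 h3]] := hat mgt; exists psi => //.
  by split => //; apply: (le_trans h3); rewrite sqrtrM// sqrtrV// ltW.
Qed.

End test_or_stable.

(** * Estimates for the derivatives and the shear force at a fixed time *)

Section steady.
Context {R : realType}.
Notation mu := (@lebesgue_measure R).
Variables (L : R) (L0 : 0 < L) (r : nat) (r1 : (1 <= r)%N).
Notation I := (`[0, L]%classic : set R).
Let mI : measurable I. Proof. exact: measurable_itv. Qed.
Let fI : (mu I < +oo)%E. Proof. exact: itv_measure_lty. Qed.

Definition Q s psi := sqint I psi /\ piecewise_poly r.-1 s psi.
(** Piecewise polynomials of degree [r - 1] serve both as shear forces ([Q]) and, with zero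
    integral, as derivatives of discrete functions vanishing at both ends. *)
Definition Q0 s psi := Q s psi /\ \int[mu]_(x in I) psi x = 0.

Lemma QB s u v : Q s u -> Q s v -> Q s (fun x => u x - v x).
Proof. by move=> [su pu] [sv pv]; split; [exact: sqintB|exact: piecewise_polyB]. Qed.

Lemma Q_cst s c : Q s (cst c).
Proof. by split; [exact: sqint_cst|exact: piecewise_poly_cst]. Qed.

Definition mean u := L^-1 * \int[mu]_(x in I) u x.

Lemma Q0_mean s u : Q s u -> Q0 s (fun x => u x - mean u).
Proof.
move=> qu; split; first exact: (QB qu (Q_cst s (mean u))).
have iu := sqint_int mI fI (proj1 qu).
rewrite RintegralB//; last exact (sqint_int mI fI (sqint_cst mI fI (mean u))).
by rewrite Rintegral_cst_itv ?(ltW L0)// subr0 /mean mulrC mulVKf ?subrr// gt_eqF.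
Qed.

Lemma nrm_mean u : sqint I u -> nrm I (cst (mean u)) <= nrm I u.
Proof.
move=> su; rewrite nrm_cst ?(ltW L0)// /mean normrM (ger0_norm (ltW _)) ?invr_gt0//.
rewrite mulrCA ler_pdivrMl//; apply: (le_trans (ler_wpM2l (sqrtr_ge0 _) (int_nrm (ltW L0) su))).
by rewrite mulrA -expr2 sqr_sqrtr// ltW.
Qed.

Variables (s : seq R) (ps : itv_partition 0 L s).
Variables (a1 a2 k1 k2 lmax lam : R) (Ih kap : R -> R).
Hypotheses (a1_gt0 : 0 < a1) (k1_gt0 : 0 < k1).
Hypotheses (mIh : measurable_fun I Ih) (mkap : measurable_fun I kap).
Hypotheses (Ih_itv : forall x, x \in `[0, L] -> a1 <= Ih x <= a2).
Hypotheses (kap_itv : forall x, x \in `[0, L] -> k1 <= kap x <= k2).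
Hypotheses (lam0 : 0 < lam <= lmax).
Variables (f fh g gh z zh : R -> R).
Hypotheses (sf : sqint I f) (qfh : Q0 s fh) (sg : sqint I g) (qgh : Q0 s gh).
Hypotheses (sz : sqint I z) (qzh : Q s zh).
Hypotheses (f0 : \int[mu]_(x in I) f x = 0) (g0 : \int[mu]_(x in I) g x = 0).
(* [f], [g], [z] stand for theta', w', gamma, and [fh], [gh], [zh] for their
   discrete counterparts; [kap] is the inverse of [Ah]. The pairs (prim psi, 0) and
   (0, prim psi) give O1, O2 and, for the discrete equation alone, O4; the
   constraint equation gives O3 by difference and O5 with the test function 1. *)
Hypothesis O1 : forall psi, Q0 s psi ->
  ip I (fun x => Ih x * (f x - fh x)) psi + ip I (fun x => z x - zh x) (prim psi) = 0.
Hypothesis O2 : forall psi, Q0 s psi -> ip I (fun x => z x - zh x) psi = 0.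
Hypothesis O3 : forall psi, Q s psi ->
  ip I (fun x => (prim f x - prim fh x) - (g x - gh x)) psi =
  lam * ip I (fun x => kap x * (z x - zh x)) psi.
Hypothesis O4 : forall psi, Q0 s psi ->
  ip I (fun x => Ih x * fh x) psi + ip I zh (prim psi) = 0.
Hypothesis O5 : \int[mu]_(x in I) prim fh x = lam * \int[mu]_(x in I) (kap x * zh x).

Let a2_ge0 : 0 <= a2.
Proof.
have /andP[h1 h2] : a1 <= Ih 0 <= a2 by apply: Ih_itv; rewrite in_itv/= lexx ltW.
by apply: le_trans (le_trans h1 h2); exact: ltW.
Qed.
Let k2_ge0 : 0 <= k2.
Proof.
have /andP[h1 h2] : k1 <= kap 0 <= k2 by apply: kap_itv; rewrite in_itv/= lexx ltW.
by apply: le_trans (le_trans h1 h2); exact: ltW.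
Qed.
Let lam_ge0 : 0 <= lam. Proof. by case/andP: lam0 => /ltW. Qed.
Let lam_le : lam <= lmax. Proof. by case/andP: lam0. Qed.

Lemma bounded_mul (b1 b2 : R) (b u : R -> R) : 0 < b1 -> measurable_fun I b ->
  (forall x, x \in `[0, L] -> b1 <= b x <= b2) -> sqint I u ->
  sqint I (fun x => b x * u x) /\ nrm I (fun x => b x * u x) <= b2 * nrm I u.
Proof.
move=> b10 mb hb su.
have hb' x : I x -> `|b x| <= b2.
  by move=> /hb/andP[h1 h2]; rewrite ger0_norm// (le_trans (ltW b10)).
have b20 : 0 <= b2.
  by apply: (le_trans (normr_ge0 (b 0))); apply: hb'; rewrite /= in_itv/= lexx ltW.
have sbu : sqint I (fun x => b x * u x) by exact: sqint_bound mb hb' su.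
split => //; rewrite -ler_sqr ?nnegrE ?mulr_ge0 ?nrm_ge0//.
rewrite exprMn !nrm_sqr -RintegralZl//; last exact: sqintM.
apply: le_Rintegral => //; [exact: sqintM|by apply: integrableZ_fin => //; exact: sqintM|].
move=> x /hb' h; rewrite -!expr2 exprMn ler_wpM2r ?sqr_ge0//.
by rewrite -(real_normK (num_real (b x))) ler_sqr ?nnegrE.
Qed.

Let sIh u : sqint I u -> sqint I (fun x => Ih x * u x).
Proof. by move=> su; have [] := bounded_mul a1_gt0 mIh Ih_itv su. Qed.
Let nIh u : sqint I u -> nrm I (fun x => Ih x * u x) <= a2 * nrm I u.
Proof. by move=> su; have [] := bounded_mul a1_gt0 mIh Ih_itv su. Qed.
Let sk u : sqint I u -> sqint I (fun x => kap x * u x).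
Proof. by move=> su; have [] := bounded_mul k1_gt0 mkap kap_itv su. Qed.
Let nk u : sqint I u -> nrm I (fun x => kap x * u x) <= k2 * nrm I u.
Proof. by move=> su; have [] := bounded_mul k1_gt0 mkap kap_itv su. Qed.

Let coercive u : sqint I u -> a1 * nrm I u ^+ 2 <= ip I (fun x => Ih x * u x) u.
Proof.
move=> su; rewrite nrm_sqr -RintegralZl//; last exact: sqintM.
apply: le_Rintegral => //.
- by apply: integrableZ_fin => //; exact: sqintM.
- by apply: sqintM => //; exact: sIh.
- by move=> x /Ih_itv/andP[h _]; rewrite -mulrA ler_wpM2r// -expr2 sqr_ge0.
Qed.

(** Coefficient of [lam * c] in the constraint tested by 1; its positive lower bound gives the
    energy its [lam * c ^+ 2] term. *)
Let Kint := \int[mu]_(x in I) kap x.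
Let Kint_ge : k1 * L <= Kint.
Proof.
rewrite -[L in leLHS]subr0 -Rintegral_cst_itv ?(ltW L0)//; apply: le_Rintegral => //.
- exact (sqint_int mI fI (sqint_cst mI fI k1)).
- have := sqint_int mI fI (sk (sqint_cst mI fI 1)).
  by rewrite (_ : (fun x => kap x * cst 1 x) = kap)//; apply/funext => x; rewrite mulr1.
- by move=> x /kap_itv/andP[].
Qed.

Let int_ip1 u : \int[mu]_(x in I) u x = ip I u (cst 1).
Proof. by apply: eq_Rintegral => x _; rewrite mulr1. Qed.

(** [O2] makes [z - zh] orthogonal to [psi], the part of zero integral of [zh - psiz]. Hence [psi]
    is no larger than [z - psiz], and only the mean of [zh - psiz] escapes control. *)
Lemma shear_decomp B psiz : Q s psiz -> nrm I (fun x => z x - psiz x) <= B ->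
  exists c b, [/\ sqint I b, nrm I b <= 2 * B & forall x, z x - zh x = b x + c].
Proof.
move=> qz hB; pose q x := zh x - psiz x.
have qq : Q s q by exact: QB.
have q0 := Q0_mean qq; pose psi x := q x - mean q.
have spsi : sqint I psi by case: q0 => -[].
have sd := sqintB mI sz (proj1 qz).
have B0 : 0 <= B by apply: le_trans hB; exact: nrm_ge0.
have npsi : nrm I psi <= B.
  have := O2 q0; rewrite -/psi.
  rewrite (_ : (fun x => z x - zh x) = (fun x => ((z x - psiz x) - cst (mean q) x) - psi x)); last first.
    by apply/funext => x; rewrite /psi /q /=; ring.
  have sm := sqint_cst mI fI (mean q).
  rewrite (ipBl mI (sqintB mI sd sm) spsi spsi) (ipBl mI sd sm spsi).
  (* The mean drops out, since [psi] has zero integral. *)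
  rewrite [ip I (cst _) _](_ : _ = 0); last first.
    rewrite /ip RintegralZl ?(proj2 q0) ?mulr0//; exact (sqint_int mI fI spsi).
  rewrite subr0 => /eqP; rewrite subr_eq0 => /eqP h.
  have := ip_le_nrm mI sd spsi; rewrite h ger0_norm ?ip_ge0// -nrm_sqr expr2.
  have [->//|n0] := eqVneq (nrm I psi) 0.
  rewrite ler_pM2r; first by move=> /le_trans; apply.
  by rewrite lt_def n0 nrm_ge0.
exists (- mean q), (fun x => (z x - psiz x) - psi x); split.
- exact: sqintB.
- by apply: (le_trans (nrmB mI sd spsi)); lra.
- by move=> x; rewrite /psi /q; ring.
Qed.

(** The error is split into an approximation part [a] and a discrete part [d] of zero integral,
    which is admissible in [O1]. The resulting bound is linear in [|c|] and involves lambda only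
    through [lmax]. *)
Lemma energy_bound B psif c b : Q s psif -> nrm I (fun x => f x - psif x) <= B ->
  sqint I b -> nrm I b <= 2 * B -> (forall x, z x - zh x = b x + c) ->
  exists d a, [/\ Q0 s d, sqint I a, nrm I a <= 2 * B,
    forall x, f x - fh x = a x + d x &
    a1 * nrm I d ^+ 2 <= (2 * a2 + 2 * L) * B * nrm I d +
                         (2 * Num.sqrt L * (lmax * k2 + L)) * B * `|c|].
Proof.
move=> qf hB sb nb zb; have L0' := L0; have Lge := ltW L0.
have B0 : 0 <= B by apply: le_trans hB; exact: nrm_ge0.
pose p x := psif x - mean psif.
have qp : Q0 s p by exact: Q0_mean.
have sp : sqint I p by case: qp => -[].
have sfh : sqint I fh by case: qfh => -[].
have spf : sqint I psif by case: qf.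
pose d x := p x - fh x; pose a x := f x - p x.
have sd : sqint I d by exact: sqintB.
have sa : sqint I a by exact: sqintB.
have qd : Q0 s d.
  split; first by apply: QB; [case: qp|case: qfh].
  rewrite RintegralB ?(proj2 qp) ?(proj2 qfh) ?subrr//; exact: sqint_int.
have sfp := sqintB mI sf spf.
(* As [f] has zero integral, the mean of [psif] is minus that of the error [f - psif]; removing it
   at most doubles the error. *)
have na : nrm I a <= 2 * B.
  have mE : mean psif = - mean (fun x => f x - psif x).
    by rewrite /mean RintegralB ?f0 ?sub0r ?mulrN ?opprK//; exact: sqint_int.
  rewrite (_ : a = fun x => (f x - psif x) - cst (mean (fun x => f x - psif x)) x); last first.
    by apply/funext => x; rewrite /a /p /= mE; ring.
  have sm := sqint_cst mI fI (mean (fun x => f x - psif x)).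
  apply: (le_trans (nrmB mI sfp sm)); have := nrm_mean sfp; lra.
have fE x : f x - fh x = a x + d x by rewrite /a /d; ring.
exists d, a; split => //.
have spd := prim_sqint Lge sd; have spa := prim_sqint Lge sa.
have sc := sqint_cst mI fI c; have s1 := sqint_cst mI fI 1.
have ipd := sqint_int mI fI spd.
(* The constraint tested by 1: both slopes have zero integral, so w disappears from it. *)
have intd : ip I (prim d) (cst 1) =
    lam * ip I (fun x => kap x * b x) (cst 1) + lam * c * Kint - ip I (prim a) (cst 1).
  have := O3 (Q_cst s 1).
  have -> : ip I (fun x => prim f x - prim fh x - (g x - gh x)) (cst 1) =
      ip I (prim a) (cst 1) + ip I (prim d) (cst 1).
    have sgh : sqint I gh by case: qgh => -[].
    have spf' := prim_sqint Lge sf; have spfh := prim_sqint Lge sfh.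
    have spp := prim_sqint Lge sp.
    rewrite (ipBl mI (sqintB mI spf' spfh) (sqintB mI sg sgh) s1).
    rewrite (ipBl mI sg sgh s1) -!int_ip1 g0 (proj2 qgh) subrr subr0.
    rewrite -RintegralD//; [|exact: sqint_int..].
    apply: eq_Rintegral => x; rewrite inE/= in_itv/= => /andP[_ xL].
    rewrite (@primB _ L p fh x) ?(@primB _ L f p x)//; [ring|exact: sqint_int..].
  have -> : ip I (fun x => kap x * (z x - zh x)) (cst 1) =
      ip I (fun x => kap x * b x) (cst 1) + c * Kint.
    rewrite (_ : (fun x => _) = (fun x => kap x * b x + c * (kap x * cst 1 x))); last first.
      by apply/funext => x; rewrite zb /=; ring.
    rewrite (ipDl mI (sk sb) (sqintZ mI c (sk s1)) s1) (ipZl mI c (sk s1) s1).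
    congr (_ + c * _); apply: eq_Rintegral => x _; rewrite /=; ring.
  by rewrite mulrDr mulrA => /(canRL (addKr _)) ->; ring.
have Ed : ip I (fun x => Ih x * d x) d =
    - ip I (fun x => Ih x * a x) d - ip I b (prim d) - c * ip I (prim d) (cst 1).
  have := O1 qd.
  rewrite (_ : (fun x => Ih x * _) = (fun x => Ih x * a x + Ih x * d x)); last first.
    by apply/funext => x; rewrite fE mulrDr.
  rewrite (_ : (fun x => z x - zh x) = (fun x => b x + c * cst 1 x)); last first.
    by apply/funext => x; rewrite zb mulr1.
  rewrite (ipDl mI (sIh sa) (sIh sd) sd) (ipDl mI sb (sqintZ mI c s1) spd).
  rewrite (ipZl mI c s1 spd) (ipC I (cst 1)); lra.
have hX := nrm_ge0 I d; have hc := normr_ge0 c.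
set X := nrm I d in hX *.
have K0 : 0 <= Kint by apply: le_trans Kint_ge; rewrite mulr_ge0// ltW.
apply: (le_trans (coercive sd)); rewrite Ed intd.
have e1 : `|ip I (fun x => Ih x * a x) d| <= a2 * (2 * B) * X.
  apply: (le_trans (ip_le_nrm mI (sIh sa) sd)); rewrite ler_wpM2r//.
  by apply: (le_trans (nIh sa)); rewrite ler_wpM2l.
have e2 : `|ip I b (prim d)| <= (2 * B) * (L * X).
  apply: (le_trans (ip_le_nrm mI sb spd)); apply: ler_pM; rewrite ?nrm_ge0//.
  exact: prim_nrm.
have sL := sqrtr_ge0 L.
have n1 : nrm I (cst 1) = Num.sqrt L by rewrite nrm_cst// normr1 mulr1.
have e3 : `|ip I (fun x => kap x * b x) (cst 1)| <= k2 * (2 * B) * Num.sqrt L.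
  rewrite -n1; apply: (le_trans (ip_le_nrm mI (sk sb) s1)); rewrite ler_wpM2r ?nrm_ge0//.
  by apply: (le_trans (nk sb)); rewrite ler_wpM2l.
have e4 : `|ip I (prim a) (cst 1)| <= L * (2 * B) * Num.sqrt L.
  rewrite -n1; apply: (le_trans (ip_le_nrm mI spa s1)); rewrite ler_wpM2r ?nrm_ge0//.
  by apply: (le_trans (prim_nrm Lge sa)); rewrite ler_wpM2l.
set T1 := ip I (fun x => Ih x * a x) d in e1 *; set T2 := ip I b (prim d) in e2 *.
set T3 := ip I (fun x => kap x * b x) (cst 1) in e3 *; set T4 := ip I (prim a) (cst 1) in e4 *.
have h1 : - T1 <= a2 * (2 * B) * X by apply: le_trans e1; rewrite -normrN ler_norm.
have h2 : - T2 <= (2 * B) * (L * X) by apply: le_trans e2; rewrite -normrN ler_norm.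
have h3 : - (c * (lam * T3)) <= `|c| * (lmax * (k2 * (2 * B) * Num.sqrt L)).
  apply: (le_trans (ler_norm _)); rewrite normrN !normrM (ger0_norm lam_ge0).
  by rewrite ler_wpM2l//; apply: ler_pM.
have h4 : c * T4 <= `|c| * (L * (2 * B) * Num.sqrt L).
  by apply: (le_trans (ler_norm _)); rewrite normrM ler_wpM2l.
(* This term enters the energy with a minus sign and is discarded; only the products of [c] with
   approximation errors remain. *)
have h5 : 0 <= lam * c ^+ 2 * Kint.
  by apply: mulr_ge0 => //; apply: mulr_ge0 => //; exact: sqr_ge0.
rewrite (_ : - T1 - T2 - _ = - T1 + - T2 + - (c * (lam * T3)) + c * T4 - lam * c ^+ 2 * Kint);
  last by ring.
rewrite (_ : (2 * a2 + _) * B * X + _ = a2 * (2 * B) * X + 2 * B * (L * X) +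
   `|c| * (lmax * (k2 * (2 * B) * Num.sqrt L)) + `|c| * (L * (2 * B) * Num.sqrt L)); last by ring.
lra.
Qed.

Let ip_cr u v c : sqint I u -> sqint I v ->
  ip I (fun x => u x + c) v = ip I u v + c * \int[mu]_(x in I) v x.
Proof.
move=> su sv; rewrite (ipDl mI su (sqint_cst mI fI c) sv); congr (_ + _).
by rewrite /ip RintegralZl//; exact: (sqint_int mI fI sv).
Qed.

(** In [O1] tested by [psi], the constant [c] appears multiplied by the integral of [prim psi],
    which is at least [c0]; all other terms are bounded by [B] and the norm of [d], without
    lambda. *)
Lemma shear_mean_bound B c b a d psi c0 C0 : sqint I b -> nrm I b <= 2 * B ->
  (forall x, z x - zh x = b x + c) -> sqint I a -> nrm I a <= 2 * B -> sqint I d ->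
  (forall x, f x - fh x = a x + d x) -> Q0 s psi -> 0 < c0 -> 0 <= C0 ->
  c0 <= \int[mu]_(x in I) prim psi x -> nrm I psi <= C0 ->
  `|c| <= (a2 * C0 / c0) * nrm I d + ((2 * a2 + 2 * L) * C0 / c0) * B.
Proof.
move=> sb nb zb sa na sd fE qpsi c00 C00 hc0 hC0; have Lge := ltW L0.
have B0 : 0 <= 2 * B by apply: le_trans nb; exact: nrm_ge0.
have spsi : sqint I psi by case: qpsi => -[].
have spp := prim_sqint Lge spsi.
have sad := sqintD mI sa sd.
have E : c * \int[mu]_(x in I) prim psi x =
    - (ip I (fun x => Ih x * (a x + d x)) psi + ip I b (prim psi)).
  have := O1 qpsi.
  rewrite (_ : (fun x => Ih x * _) = (fun x => Ih x * (a x + d x))); last first.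
    by apply/funext => x; rewrite fE.
  rewrite (_ : (fun x => z x - zh x) = (fun x => b x + c)); last exact/funext.
  by rewrite ip_cr//; lra.
have e1 : `|ip I (fun x => Ih x * (a x + d x)) psi| <= a2 * (2 * B + nrm I d) * C0.
  apply: (le_trans (ip_le_nrm mI (sIh sad) spsi)); apply: ler_pM; rewrite ?nrm_ge0//.
  apply: (le_trans (nIh sad)); rewrite ler_wpM2l//.
  by apply: (le_trans (nrmD mI sa sd)); rewrite lerD2r.
have e2 : `|ip I b (prim psi)| <= (2 * B) * (L * C0).
  apply: (le_trans (ip_le_nrm mI sb spp)); apply: ler_pM; rewrite ?nrm_ge0//.
  by apply: (le_trans (prim_nrm Lge spsi)); rewrite ler_wpM2l.
have h : `|c| * c0 <= a2 * (2 * B + nrm I d) * C0 + (2 * B) * (L * C0).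
  apply: (@le_trans _ _ `|c * \int[mu]_(x in I) prim psi x|).
    by rewrite normrM ler_wpM2l// (le_trans hc0)// ler_norm.
  rewrite E normrN; apply: (le_trans (ler_normD _ _)); exact: lerD.
move: h; rewrite -ler_pdivlMr// => /le_trans; apply.
rewrite le_eqVlt; apply/orP; left; apply/eqP; field; exact: lt0r_neq0.
Qed.

(** Stability in place of approximation: the discrete equation [O4] is tested by [fh] itself, with
    [zh = (z - b) - c]. By [O5] the integral of [prim fh] contributes [- lam * c * Kint], which is
    kept here on the left; the smallness of [prim fh] puts a factor [m] on the right. *)
Lemma stable_energy B c b m : sqint I b -> (forall x, z x - zh x = b x + c) ->
  nrm I (fun x => z x - b x) <= B -> 0 <= m ->
  (forall x, x \in `[0, L] -> `|prim fh x| <= m * nrm I fh) ->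
  a1 * nrm I fh ^+ 2 + lam * (k1 * L) * `|c| ^+ 2 <=
  (Num.sqrt L * (1 + k2)) * B * (lam * `|c| + m * nrm I fh).
Proof.
move=> sb zb nB m0 hm; have Lge := ltW L0.
have sfh : sqint I fh by case: qfh => -[].
have B0 : 0 <= B by apply: le_trans nB; exact: nrm_ge0.
have s1 := sqint_cst mI fI 1.
pose y x := z x - b x; have sy : sqint I y by exact: sqintB.
have zhE x : zh x = y x + - c by have := zb x; rewrite /y; lra.
have spf := prim_sqint Lge sfh.
have E5 : \int[mu]_(x in I) prim fh x = lam * ip I (fun x => kap x * y x) (cst 1) - lam * c * Kint.
  rewrite O5 int_ip1.
  rewrite (_ : (fun x => kap x * zh x) = (fun x => kap x * y x - c * (kap x * cst 1 x))); last first.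
    by apply/funext => x; rewrite zhE /=; ring.
  rewrite (ipBl mI (sk sy) (sqintZ mI c (sk s1)) s1) (ipZl mI c (sk s1) s1) mulrBr mulrA.
  congr (_ - _ * _); apply: eq_Rintegral => x _; rewrite /=; ring.
have E4 : ip I (fun x => Ih x * fh x) fh = - ip I y (prim fh) + c * \int[mu]_(x in I) prim fh x.
  have := O4 qfh; rewrite (_ : zh = (fun x => y x + - c)); last exact/funext.
  by rewrite ip_cr//; lra.
have nprim : nrm I (prim fh) <= Num.sqrt L * (m * nrm I fh).
  apply: nrm_bounded => //; first by rewrite mulr_ge0 ?nrm_ge0.
  by case: spf.
have e1 : - ip I y (prim fh) <= B * (Num.sqrt L * (m * nrm I fh)).
  apply: (le_trans (ler_norm _)); rewrite normrN.
  by apply: (le_trans (ip_le_nrm mI sy spf)); apply: ler_pM; rewrite ?nrm_ge0.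
have e2 : c * (lam * ip I (fun x => kap x * y x) (cst 1)) <= `|c| * (lam * (k2 * B * Num.sqrt L)).
  apply: (le_trans (ler_norm _)); rewrite !normrM (ger0_norm lam_ge0) ler_wpM2l// ler_wpM2l//.
  apply: (le_trans (ip_le_nrm mI (sk sy) s1)); rewrite nrm_cst// normr1 mulr1.
  rewrite ler_wpM2r ?sqrtr_ge0//.
  by apply: (le_trans (nk sy)); rewrite ler_wpM2l.
have e3 : lam * (k1 * L) * `|c| ^+ 2 <= lam * c ^+ 2 * Kint.
  rewrite (real_normK (num_real c)) -mulrA [k1 * L * _]mulrC [leRHS]mulrAC -mulrA.
  by rewrite [Kint * _]mulrC ler_wpM2l// ler_wpM2l ?sqr_ge0.
have e4 := coercive sfh; rewrite E4 E5 in e4.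
have X0 := nrm_ge0 I fh; have hc := normr_ge0 c; have sL := sqrtr_ge0 L.
(* These two nonnegative terms only complete the right side to the product form expected by
   [stable_bound]. *)
have g1 : 0 <= Num.sqrt L * B * (lam * `|c|) by rewrite !mulr_ge0.
have g2 : 0 <= Num.sqrt L * k2 * B * (m * nrm I fh) by rewrite !mulr_ge0.
rewrite (_ : Num.sqrt L * (1 + k2) * B * _ = B * (Num.sqrt L * (m * nrm I fh)) +
  `|c| * (lam * (k2 * B * Num.sqrt L)) + Num.sqrt L * B * (lam * `|c|) +
  Num.sqrt L * k2 * B * (m * nrm I fh)); last by ring.
have e5 : c * (lam * ip I (fun x => kap x * y x) (cst 1) - lam * c * Kint) =
  c * (lam * ip I (fun x => kap x * y x) (cst 1)) - lam * c ^+ 2 * Kint by ring.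
rewrite e5 in e4; lra.
Qed.

(** The norm of [psi] may grow like [1 / m], but [prim psi] gains a factor [m] and stays bounded. So
    [1 / m] multiplies the norm of [fh] only, not [B]. *)
Lemma stable_test B c b m psi : sqint I b -> (forall x, z x - zh x = b x + c) ->
  nrm I (fun x => z x - b x) <= B -> 0 < m -> Q0 s psi ->
  (forall x, x \in `[0, L] -> `|prim psi x| <= m * nrm I psi) ->
  \int[mu]_(x in I) prim psi x = L / 2 -> nrm I psi <= Num.sqrt 2 / m ->
  `|c| <= (a2 * Num.sqrt 2 * 2 / L) * (nrm I fh / m) + (Num.sqrt L * Num.sqrt 2 * 2 / L) * B.
Proof.
move=> sb zb nB m0 qpsi hm hint npsi; have Lge := ltW L0.
have sfh : sqint I fh by case: qfh => -[].
have spsi : sqint I psi by case: qpsi => -[].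
have B0 : 0 <= B by apply: le_trans nB; exact: nrm_ge0.
pose y x := z x - b x; have sy : sqint I y by exact: sqintB.
have zhE x : zh x = y x + - c by have := zb x; rewrite /y; lra.
have spp := prim_sqint Lge spsi.
have E : c * (L / 2) = ip I (fun x => Ih x * fh x) psi + ip I y (prim psi).
  have := O4 qpsi; rewrite (_ : zh = (fun x => y x + - c)); last exact/funext.
  by rewrite ip_cr// hint; lra.
have nprim : nrm I (prim psi) <= Num.sqrt L * Num.sqrt 2.
  apply: (nrm_bounded Lge (sqrtr_ge0 _)); first by case: spp.
  move=> x /hm /le_trans; apply.
  by move: npsi; rewrite ler_pdivlMr// mulrC.
have e1 : `|ip I (fun x => Ih x * fh x) psi| <= a2 * nrm I fh * (Num.sqrt 2 / m).
  apply: (le_trans (ip_le_nrm mI (sIh sfh) spsi)); apply: ler_pM; rewrite ?nrm_ge0//.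
  exact: nIh.
have e2 : `|ip I y (prim psi)| <= B * (Num.sqrt L * Num.sqrt 2).
  by apply: (le_trans (ip_le_nrm mI sy spp)); apply: ler_pM; rewrite ?nrm_ge0.
have h : `|c| * (L / 2) <= a2 * nrm I fh * (Num.sqrt 2 / m) + B * (Num.sqrt L * Num.sqrt 2).
  rewrite -[L / 2]ger0_norm ?divr_ge0// -normrM E.
  by apply: (le_trans (ler_normD _ _)); exact: lerD.
move: h; rewrite -ler_pdivlMr ?divr_gt0// => /le_trans; apply.
rewrite le_eqVlt; apply/orP; left; apply/eqP; field.
by rewrite !gt_eqF.
Qed.

(** The constraint tested by the discrete part of [g - gh] expresses the slope error through the
    rotation and shear errors. *)
Lemma slope_bound B psig : Q s psig -> nrm I (fun x => g x - psig x) <= B ->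
  nrm I (fun x => g x - gh x) <=
  2 * B + L * nrm I (fun x => f x - fh x) + lmax * k2 * nrm I (fun x => z x - zh x).
Proof.
move=> qg hB; have Lge := ltW L0.
have B0 : 0 <= B by apply: le_trans hB; exact: nrm_ge0.
have sfh : sqint I fh by case: qfh => -[].
have sgh : sqint I gh by case: qgh => -[].
have szh : sqint I zh by case: qzh.
have spg : sqint I psig by case: qg.
pose p x := psig x - gh x; have qp : Q s p by apply: QB => //; case: qgh.
have sp : sqint I p by case: qp.
pose e x := g x - psig x; have se : sqint I e by exact: sqintB.
have sff := sqintB mI sf sfh; have szz := sqintB mI sz szh.
have spff := prim_sqint Lge sff.
have E : ip I p p = ip I (prim (fun x => f x - fh x)) p - ip I e p
    - lam * ip I (fun x => kap x * (z x - zh x)) p.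
  rewrite -(O3 qp).
  rewrite (_ : ip I (fun x => _ - _ - _) p =
      ip I (fun x => prim (fun x => f x - fh x) x - (e x + p x)) p); last first.
    apply: eq_Rintegral => x; rewrite inE/= in_itv/= => /andP[_ xL].
    rewrite (@primB _ L f fh x)//; [|exact: sqint_int..].
    by congr (_ * _); rewrite /e /p; ring.
  rewrite (ipBl mI spff (sqintD mI se sp) sp) (ipDl mI se sp sp); ring.
have np : nrm I p <= B + L * nrm I (fun x => f x - fh x) + lmax * k2 * nrm I (fun x => z x - zh x).
  have [->|n0] := eqVneq (nrm I p) 0.
    rewrite !addr_ge0 ?mulr_ge0 ?nrm_ge0//; exact: le_trans lam_le.
  have pp : 0 < nrm I p by rewrite lt_def n0 nrm_ge0.
  rewrite -(ler_pM2r pp) -expr2 nrm_sqr E !mulrDl.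
  have e1 := ler_norm (ip I (prim (fun x => f x - fh x)) p).
  have e1' : `|ip I (prim (fun x => f x - fh x)) p| <= L * nrm I (fun x => f x - fh x) * nrm I p.
    by apply: (le_trans (ip_le_nrm mI spff sp)); rewrite ler_wpM2r ?nrm_ge0// prim_nrm.
  have e2 := ler_norm (- ip I e p); rewrite normrN in e2.
  have e2' : `|ip I e p| <= B * nrm I p.
    by apply: (le_trans (ip_le_nrm mI se sp)); rewrite ler_wpM2r ?nrm_ge0.
  have e3 := ler_norm (- (lam * ip I (fun x => kap x * (z x - zh x)) p)).
  have e3' : `|- (lam * ip I (fun x => kap x * (z x - zh x)) p)| <=
      lmax * k2 * nrm I (fun x => z x - zh x) * nrm I p.
    rewrite normrN normrM (ger0_norm lam_ge0) -!mulrA; apply: ler_pM => //.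
    apply: (le_trans (ip_le_nrm mI (sk szz) sp)); rewrite mulrA ler_wpM2r ?nrm_ge0//.
    exact: nk.
  lra.
rewrite (_ : (fun x => g x - gh x) = (fun x => e x + p x)); last first.
  by apply/funext => x; rewrite /e /p; ring.
by apply: (le_trans (nrmD mI se sp)); lra.
Qed.

End steady.

Section steady_error.
Context {R : realType}.
Notation mu := (@lebesgue_measure R).
Variables (L : R) (L0 : 0 < L).
Notation I := (`[0, L]%classic : set R).
Let mI : measurable I. Proof. exact: measurable_itv. Qed.
Let fI : (mu I < +oo)%E. Proof. exact: itv_measure_lty. Qed.

(** The constant is chosen before the mesh, lambda and the coefficients. [M] bounds the norms of [f]
    and [z] as well, since the coarse-mesh case compares with the solution itself. *)
Lemma steady_error (r : nat) (a1 a2 k1 k2 lmax : R) :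
  0 < a1 -> 0 <= a2 -> 0 < k1 -> 0 <= k2 -> 0 <= lmax -> (1 <= r)%N ->
  exists2 C, 0 < C & forall (s : seq R) (lam : R) (Ih kap : R -> R)
    (f fh g gh z zh psif psig psiz : R -> R) (M : R),
  itv_partition 0 L s -> measurable_fun I Ih -> measurable_fun I kap ->
  (forall x, x \in `[0, L] -> a1 <= Ih x <= a2) ->
  (forall x, x \in `[0, L] -> k1 <= kap x <= k2) -> 0 < lam <= lmax ->
  sqint I f -> Q0 L r s fh -> sqint I g -> Q0 L r s gh -> sqint I z -> Q L r s zh ->
  \int[mu]_(x in I) f x = 0 -> \int[mu]_(x in I) g x = 0 ->
  (forall psi, Q0 L r s psi ->
    ip I (fun x => Ih x * (f x - fh x)) psi + ip I (fun x => z x - zh x) (prim psi) = 0) ->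
  (forall psi, Q0 L r s psi -> ip I (fun x => z x - zh x) psi = 0) ->
  (forall psi, Q L r s psi ->
    ip I (fun x => (prim f x - prim fh x) - (g x - gh x)) psi =
    lam * ip I (fun x => kap x * (z x - zh x)) psi) ->
  (forall psi, Q0 L r s psi ->
    ip I (fun x => Ih x * fh x) psi + ip I zh (prim psi) = 0) ->
  \int[mu]_(x in I) prim fh x = lam * \int[mu]_(x in I) (kap x * zh x) ->
  Q L r s psif -> nrm I (fun x => f x - psif x) <= mesh_size s ^+ r * M ->
  Q L r s psig -> nrm I (fun x => g x - psig x) <= mesh_size s ^+ r * M ->
  Q L r s psiz -> nrm I (fun x => z x - psiz x) <= mesh_size s ^+ r * M ->
  nrm I f <= M -> nrm I z <= M ->
  [/\ nrm I (fun x => f x - fh x) <= C * (mesh_size s ^+ r * M),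
      nrm I (fun x => g x - gh x) <= C * (mesh_size s ^+ r * M) &
      nrm I (fun x => z x - zh x) <= C * (mesh_size s ^+ r * M)].
Proof.
move=> a10 a20 k10 k20 lmax0 r1; have L0' := L0; have Lge := ltW L0.
have [c0 [C0 [c00 C00 tests]]] := test_or_stable L0.
have C0ge := ltW C00; have c0ge := ltW c00; have a1ge := ltW a10.
have [al alE] : exists x, x = a2 * C0 / c0 by exists (a2 * C0 / c0).
have [be beE] : exists x, x = (2 * a2 + 2 * L) * C0 / c0 by exists ((2 * a2 + 2 * L) * C0 / c0).
have al0 : 0 <= al by rewrite alE divr_ge0// mulr_ge0.
have be0 : 0 <= be by rewrite beE divr_ge0// mulr_ge0// addr_ge0// mulr_ge0.
have sL := sqrtr_ge0 L; have s2 := sqrtr_ge0 (2 : R).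
have [P PE] : exists x, x = 2 * a2 + 2 * L by exists (2 * a2 + 2 * L).
have [Qc QcE] : exists x, x = 2 * Num.sqrt L * (lmax * k2 + L) by exists (2 * Num.sqrt L * (lmax * k2 + L)).
have P0 : 0 <= P by rewrite PE addr_ge0// mulr_ge0.
have Qc0 : 0 <= Qc by rewrite QcE mulr_ge0 ?mulr_ge0// addr_ge0// mulr_ge0.
(* Constant of [quad_le] after [|c| <= al * X + be * B] is inserted into the energy bound
   [P * B * X + Qc * B * |c|]. *)
have [C1 C1E] : exists x, x = ((P + Qc * al) + Qc * be) / a1 + 1 by exists (((P + Qc * al) + Qc * be) / a1 + 1).
have C10 : 0 <= C1.
  by rewrite C1E addr_ge0// divr_ge0// !addr_ge0// mulr_ge0.
have [|||||C2 C20 stab] := @stable_bound _ a1 (k1 * L) (Num.sqrt L * (1 + k2))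
  (a2 * Num.sqrt 2 * 2 / L) (Num.sqrt L * Num.sqrt 2 * 2 / L) lmax L.
- by [].
- exact: mulr_gt0.
- by rewrite mulr_ge0// addr_ge0.
- by rewrite divr_ge0// !mulr_ge0.
- by rewrite divr_ge0// !mulr_ge0.
(* In the coarse-mesh case the norm of [z - b] is at most [M + 2 * B], and [M <= 2 / L * B]. *)
have [W WE] : exists x, x = 2 / L + 2 by exists (2 / L + 2).
have W0 : 0 <= W by rewrite WE addr_ge0// divr_ge0.
have tL : 0 <= 2 / L by rewrite divr_ge0.
have [Cf CfE] : exists x, x = (2 + C1) + (2 / L + C2 * W) by exists ((2 + C1) + (2 / L + C2 * W)).
have [Cc CcE] : exists x, x = (al * C1 + be) + C2 * W by exists ((al * C1 + be) + C2 * W).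
have CW : 0 <= C2 * W by rewrite mulr_ge0// ltW.
have Cc0 : 0 <= Cc by rewrite CcE !addr_ge0// mulr_ge0.
have Cf0 : 0 <= Cf by rewrite CfE; apply: addr_ge0; apply: addr_ge0.
have [Cz CzE] : exists x, x = 2 + Num.sqrt L * Cc by exists (2 + Num.sqrt L * Cc).
have Cz0 : 0 <= Cz by rewrite CzE addr_ge0// mulr_ge0.
have [Cg CgE] : exists x, x = 2 + L * Cf + lmax * k2 * Cz by exists (2 + L * Cf + lmax * k2 * Cz).
have Cg0 : 0 <= Cg.
  by rewrite CgE; apply: addr_ge0; [apply: addr_ge0 => //|]; apply: mulr_ge0 => //; apply: mulr_ge0.
exists (Cf + Cz + Cg + 1); first by rewrite ltr_wpDl// !addr_ge0.
move=> s lam Ih kap f fh g gh z zh psif psig psiz M ps mIh mkap hIh hkap hlam.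
move=> sf qfh sg qgh sz qzh f0 g0 O1 O2 O3 O4 O5 qf nf qg ng qz nz fM zM.
set B := _ ^+ r * M in nf ng nz *.
have B0 : 0 <= B by apply: le_trans nf; exact: nrm_ge0.
have M0 : 0 <= M by apply: le_trans fM; exact: nrm_ge0.
have [c [b [sb nb zb]]] := shear_decomp L0 sz qzh O2 qz nz.
have [d [a [qd sa na fE en]]] := energy_bound L0 a10 k10 mIh mkap hIh hkap hlam
  sf qfh sg qgh f0 g0 O1 O3 qf nf sb nb zb.
have sfh : sqint I fh by case: qfh => -[].
have szh : sqint I zh by case: qzh.
have sd : sqint I d by case: qd => -[].
have [hf hc] : nrm I (fun x => f x - fh x) <= Cf * B /\ `|c| <= Cc * B.
  have nfa : nrm I (fun x => f x - fh x) <= 2 * B + nrm I d.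
    rewrite (_ : (fun x => _) = (fun x => a x + d x)); last exact/funext.
    by apply: (le_trans (nrmD mI sa sd)); rewrite lerD2r.
  have X0 := nrm_ge0 I d.
  case: (tests s r ps r1) => [[psi [spsi ppsi psi0] [hc0 hC0]]|[rE [m [m0 mL hL sup hat]]]].
    have hc := shear_mean_bound L0 a10 mIh hIh O1 sb nb zb sa na sd fE
      (conj (conj spsi ppsi) psi0) c00 C0ge hc0 hC0; rewrite -alE -beE in hc.
    have XC : nrm I d <= C1 * B.
      rewrite C1E; apply: quad_le => //; [by rewrite addr_ge0// mulr_ge0|exact: mulr_ge0|].
      apply: (le_trans en); rewrite -PE -QcE.
      apply: (@le_trans _ _ (P * B * nrm I d + Qc * B * (al * nrm I d + be * B))).
        by rewrite lerD2l ler_wpM2l// mulr_ge0.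
      by rewrite le_eqVlt; apply/orP; left; apply/eqP; ring.
    split.
      apply: (le_trans nfa); rewrite CfE !mulrDl.
      have h1 : 0 <= 2 / L * B by rewrite mulr_ge0.
      have h2 : 0 <= C2 * W * B by rewrite mulr_ge0.
      clear - h1 h2 XC; lra.
    apply: (le_trans hc); rewrite CcE !mulrDl.
    have h1 : al * nrm I d <= al * (C1 * B) by rewrite ler_wpM2l.
    have h2 : 0 <= C2 * W * B by rewrite mulr_ge0.
    rewrite mulrA in h1; clear - h1 h2; lra.
  (* Here [r = 1] and [h >= L / 2], so [B = h * M] is at least [L / 2 * M]: the solution itself is
     of the size of the error bound. *)
  have MB : M <= 2 / L * B.
    have : L / 2 * M <= B.
      by rewrite /B rE expr1 ler_wpM2r.
    by move=> h; rewrite mulrAC ler_pdivlMr//; clear - h; lra.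
  have nB : nrm I (fun x => z x - b x) <= W * B.
    by apply: (le_trans (nrmB mI sz sb)); rewrite WE mulrDl; clear - nb zM MB; lra.
  have qfh1 : forall x, x \in `[0, L] -> `|prim fh x| <= m * nrm I fh.
    by apply: sup => //; [case: qfh => -[_]; rewrite rE|case: qfh].
  have e1 := stable_energy L0 a10 k10 mIh mkap hIh hkap hlam qfh sz O4 O5 sb zb nB m0 qfh1.
  have e2 : 0 < m -> `|c| <= (a2 * Num.sqrt 2 * 2 / L) * (nrm I fh / m) +
      (Num.sqrt L * Num.sqrt 2 * 2 / L) * (W * B).
    move=> mgt; have [psi [spsi ppsi psi0] [hint npsi]] := hat mgt.
    have qpsi : Q0 L r s psi by split => //; split => //; rewrite rE.
    apply: (stable_test L0 a10 mIh hIh qfh sz O4 sb zb nB mgt qpsi) => //.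
    exact: sup.
  have [h1 h2] := stab lam m (nrm I fh) `|c| (W * B) hlam m0 mL (nrm_ge0 _ _)
    (normr_ge0 c) (mulr_ge0 W0 B0) e1 e2.
  split.
    apply: (le_trans (nrmB mI sf sfh)); rewrite CfE !mulrDl.
    have h3 : 0 <= C1 * B by rewrite mulr_ge0.
    rewrite mulrA in h1; clear - h1 h3 MB fM B0; lra.
  rewrite CcE !mulrDl.
  have h3 : 0 <= al * C1 * B by rewrite mulr_ge0// mulr_ge0.
  have h4 : 0 <= be * B by rewrite mulr_ge0.
  rewrite mulrA in h2; clear - h2 h3 h4; lra.
have hz : nrm I (fun x => z x - zh x) <= Cz * B.
  have sc := sqint_cst mI fI c.
  rewrite (_ : (fun x => _) = (fun x => b x + cst c x)); last exact/funext.
  apply: (le_trans (nrmD mI sb sc)); rewrite nrm_cst// CzE mulrDl -mulrA lerD//.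
  by rewrite ler_wpM2l.
have hg : nrm I (fun x => g x - gh x) <= Cg * B.
  apply: (le_trans (slope_bound L0 k10 mkap hkap hlam sf qfh sg qgh sz qzh O3 qg ng)).
  rewrite CgE !mulrDl; apply: lerD; last first.
    by rewrite -(mulrA (lmax * k2)); apply: ler_wpM2l => //; exact: mulr_ge0.
  by apply: lerD => //; rewrite -mulrA; apply: ler_wpM2l.
have CfB : 0 <= Cf * B by rewrite mulr_ge0.
have CzB : 0 <= Cz * B by rewrite mulr_ge0.
have CgB : 0 <= Cg * B by rewrite mulr_ge0.
by split; rewrite !mulrDl mul1r; [clear - hf CzB CgB B0|clear - hg CfB CzB B0|clear - hz CfB CgB B0]; lra.
Qed.

End steady_error.

(** * From elastic forms to the system on derivatives *)

Section galerkin_error.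
Context {R : realType}.
Notation mu := (@lebesgue_measure R).
Variables (L : R) (L0 : 0 < L).
Notation I := (`[0, L]%classic : set R).
Let mI : measurable I. Proof. exact: measurable_itv. Qed.
Let fI : (mu I < +oo)%E. Proof. exact: itv_measure_lty. Qed.

Lemma measurable_fun_inv (D : set R) (u : R -> R) : measurable_fun D u ->
  (forall x, D x -> 0 < u x) -> measurable_fun D (fun x => (u x)^-1).
Proof.
move=> mu_ u0; have o : open (`]0, +oo[%classic : set R) by exact: interval_open.
have mV : measurable_fun (`]0, +oo[%classic : set R) (@GRing.inv R).
  apply: open_continuous_measurable_fun => // x; rewrite inE/= in_itv/= andbT => x0.
  by apply: inv_continuous; rewrite gt_eqF.
apply: (measurable_comp _ _ mV mu_) => //.
by move=> y [x /u0 ux <-]; rewrite /= in_itv/= ux.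
Qed.

Lemma sobolevS k u : sobolev L k.+1 u -> sobolev L k u.
Proof.
elim: k u => [u [u2 _]//|k IH u [u2 [g hg sg]]].
by split => //; exists g => //; exact: IH.
Qed.

(** Since [wderiv] is a choice of representative, even the derivative of 0 is known only almost
    everywhere. *)
Lemma wderiv0 : aeq I (wderiv L (cst 0)) (cst 0).
Proof. by rewrite -{1}prim_cst0; apply: wderiv_prim => //; exact: sqint_cst. Qed.

Lemma wderiv0_sqint : sqint I (wderiv L (cst 0)).
Proof.
rewrite -prim_cst0; apply: (wderiv_sqint L0 (k := 0)).
by apply: sobolev_prim => //; exact: sqint_cst.
Qed.

Lemma wderiv_prim_sqint g : sqint I g -> sqint I (wderiv L (prim g)).
Proof. by move=> sg; apply: (wderiv_sqint L0 (k := 0)); exact: sobolev_prim. Qed.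

Lemma elastic_form_eta Ih th ga psi : sqint I (fun x => Ih x * wderiv L th x) ->
  sqint I ga -> sqint I psi ->
  elastic_form L Ih th ga (prim psi) (cst 0) =
  ip I (fun x => Ih x * wderiv L th x) psi + ip I ga (prim psi).
Proof.
move=> sI sga spsi; have spp := prim_sqint (ltW L0) spsi.
have sw0 := wderiv0_sqint; have swp := wderiv_prim_sqint spsi.
have h : aeq I (fun x => prim psi x - wderiv L (cst 0) x) (prim psi).
  by apply: filterS wderiv0 => x h /h /= ->; rewrite subr0.
have e1 := ip_ae mI sI sI swp spsi (aeq_refl _ _) (wderiv_prim L0 spsi).
have e2 := ip_ae mI sga sga (sqintB mI spp sw0) spp (aeq_refl _ _) h.
transitivity (ip I (fun x => Ih x * wderiv L th x) (wderiv L (prim psi)) +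
  ip I ga (fun x => prim psi x - wderiv L (cst 0) x)); first by [].
by rewrite e1 e2.
Qed.

Lemma elastic_form_v Ih th ga psi : sqint I (fun x => Ih x * wderiv L th x) ->
  sqint I ga -> sqint I psi ->
  elastic_form L Ih th ga (cst 0) (prim psi) = - ip I ga psi.
Proof.
move=> sI sga spsi; have sw0 := wderiv0_sqint; have s0 := sqint_cst mI fI 0.
have swp := wderiv_prim_sqint spsi.
have e0 (u : R -> R) : ip I u (cst 0) = 0.
  by rewrite /ip (_ : (fun x => _) = cst 0) ?Rintegral_cst_itv ?ltW ?mul0r//; apply/funext => x; rewrite mulr0.
have e1 := ip_ae mI sI sI sw0 s0 (aeq_refl _ _) wderiv0.
have h : aeq I (fun x => cst 0 x - wderiv L (prim psi) x) (fun x => cst 0 x - psi x).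
  by apply: filterS (wderiv_prim L0 spsi) => x h /h /= ->.
have e2 := ip_ae mI sga sga (sqintB mI s0 swp) (sqintB mI s0 spsi) (aeq_refl _ _) h.
have e3 := ipBr mI s0 spsi sga.
rewrite e0 in e1; rewrite e0 sub0r in e3.
transitivity (ip I (fun x => Ih x * wderiv L th x) (wderiv L (cst 0)) +
  ip I ga (fun x => cst 0 x - wderiv L (prim psi) x)); first by [].
by rewrite e1 e2 e3 add0r.
Qed.

Lemma sqrt_sum_le (x y : R) : 0 <= x -> 0 <= y -> Num.sqrt (x ^+ 2 + y ^+ 2) <= x + y.
Proof.
move=> x0 y0; rewrite -[leRHS]ger0_norm ?addr_ge0// -sqrtr_sqr ler_wsqrtr//; nra.
Qed.

Lemma wderivB_nrm u v : H10 L u -> H10 L v ->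
  nrm I (wderiv L (u \- v)) = nrm I (fun x => wderiv L u x - wderiv L v x).
Proof.
move=> hu hv.
have hw := is_wderivB (H10_sqint hu) (H10_sqint hv) (H10_wderiv L0 hu) (H10_wderiv L0 hv).
apply: nrm_ae => //; last exact (wderiv_ae L0 hw).
- by case: (wderivP hw) => /L2_sqint.
- by case: hw => /L2_sqint.
Qed.

Lemma sub_add_eq0 (a b c d : R) : a + c = b + d -> (a - b) + (c - d) = 0.
Proof. lra. Qed.

Lemma sub_system (a b c d a' c' z zh l : R) : a = a' -> c = c' ->
  (a - b) - l * z = 0 -> (c - d) - l * zh = 0 -> (a' - c') - (b - d) = l * (z - zh).
Proof. by move=> -> ->; lra. Qed.

(** The third equation on elastic forms, with [v = 0], is independent of the orthogonality: the load
    acts on [v] only, so pure rotations see a homogeneous discrete equation, which the stability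
    case relies on. *)
Lemma galerkin_error (r : nat) (a1 a2 k1 k2 lmax : R) :
  0 < a1 -> 0 <= a2 -> 0 < k1 -> 0 <= k2 -> 0 <= lmax -> (1 <= r)%N ->
  exists2 C, 0 < C & forall (s : seq R) (lam : R) (Ih Ah th w ga thh wh gah : R -> R),
  itv_partition 0 L s -> measurable_fun I Ih -> measurable_fun I Ah ->
  (forall x, x \in `[0, L] -> a1 <= Ih x <= a2) ->
  (forall x, x \in `[0, L] -> k1 <= (Ah x)^-1 <= k2) -> 0 < lam <= lmax ->
  HH L (th, w) -> L2 L ga -> HHh L r s (thh, wh) -> Qh L r s gah ->
  sobolev L r.+2 th -> sobolev L r.+2 w -> sobolev L r.+1 ga ->
  (forall eta v, HHh L r s (eta, v) ->
     elastic_form L Ih th ga eta v = elastic_form L Ih thh gah eta v) ->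
  (forall eta, HHh L r s (eta, cst 0) -> elastic_form L Ih thh gah eta (cst 0) = 0) ->
  (forall psi, Qh L r s psi -> L2dot L (th \- wderiv L w) psi
      - lam * L2dot L (fun x => ga x / Ah x) psi = 0) ->
  (forall psi, Qh L r s psi -> L2dot L (thh \- wderiv L wh) psi
      - lam * L2dot L (fun x => gah x / Ah x) psi = 0) ->
  HH_norm L (th \- thh, w \- wh) + L2norm L (ga \- gah) <=
  C * mesh_size s ^+ r *
    (sobolev_norm L r.+2 th + sobolev_norm L r.+2 w + sobolev_norm L r.+1 ga).
Proof.
move=> a10 a20 k10 k20 lmax0 r1.
have [C C0 hC] := steady_error L0 a10 a20 k10 k20 lmax0 r1.
exists (3 * C); first by rewrite mulr_gt0.
move=> s lam Ih Ah th w ga thh wh gah ps mIh mAh hIh hAh hlam.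
move=> [/= hth hw] /L2_sqint sga [[/= vthh vwh] [/= hthh hwh]] [/L2_sqint sgah pgah].
move=> rth rw rga G1 G3 G2 G2h.
have Lge := ltW L0.
have [sth0 pth0] := H10_prim L0 hth; have [_ w0] := H10_prim L0 hw.
have [sthh0 pthh0] := H10_prim L0 hthh; have [_ wh0] := H10_prim L0 hwh.
have sth := H10_sqint hth; have sthh := H10_sqint hthh.
have sf := H10_wderiv_sqint L0 hth; have sfh := H10_wderiv_sqint L0 hthh.
have sg := H10_wderiv_sqint L0 hw; have sgh := H10_wderiv_sqint L0 hwh.
(* The derivative is in H^(r+1), of which only H^r is needed for the order [r]. *)
have [_ /sobolevS rf] := sobolev_wderiv (k := r.+1) L0 rth.
have [_ /sobolevS rg] := sobolev_wderiv (k := r.+1) L0 rw.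
have rz := @sobolevS r ga rga.
have [psif qf nf] := piecewise_approx L0 ps rf.
have [psig qg ng] := piecewise_approx L0 ps rg.
have [psiz qz nz] := piecewise_approx L0 ps rz.
set M := sobolev_norm L r.+2 th + sobolev_norm L r.+2 w + sobolev_norm L r.+1 ga.
have N0 k u : 0 <= sobolev_norm L k u by exact: sqrtr_ge0.
have hr := mesh_ge0 s.
have b1 : nrm I (iter r (wderiv L) (wderiv L th)) <= M.
  rewrite -iterSr; apply: (le_trans (@nrm_le_sobolev _ L r.+2 r.+1 th (leqnSn _))).
  by rewrite /M -addrA lerDl addr_ge0.
have b2 : nrm I (iter r (wderiv L) (wderiv L w)) <= M.
  rewrite -iterSr; apply: (le_trans (@nrm_le_sobolev _ L r.+2 r.+1 w (leqnSn _))).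
  by rewrite /M -addrA addrCA lerDl addr_ge0.
have b3 : nrm I (iter r (wderiv L) ga) <= M.
  apply: (le_trans (@nrm_le_sobolev _ L r.+1 r ga (leqnSn _))).
  by rewrite /M lerDr addr_ge0.
have b4 : nrm I (wderiv L th) <= M.
  apply: (le_trans (@nrm_le_sobolev _ L r.+2 1 th isT)).
  by rewrite /M -addrA lerDl addr_ge0.
have b5 : nrm I ga <= M.
  apply: (le_trans (@nrm_le_sobolev _ L r.+1 0 ga isT)).
  by rewrite /M lerDr addr_ge0.
have QE psi : Qh L r s psi <-> Q L r s psi.
  by split=> -[/L2_sqint ? ?]; split => //; apply/L2_sqint.
have mkap : measurable_fun I (fun x => (Ah x)^-1).
  apply: measurable_fun_inv => // x /hAh/andP[h _].
  by rewrite -invr_gt0 (lt_le_trans k10).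
have SI u : sqint I u -> sqint I (fun x => Ih x * u x) by case/(bounded_mul L0 a10 mIh hIh).
have SK u : sqint I u -> sqint I (fun x => (Ah x)^-1 * u x).
  by case/(bounded_mul L0 k10 mkap hAh).
have qfh : Q0 L r s (wderiv L thh).
  exact (conj (conj sfh (wderiv_piecewise L0 ps (proj1 vthh) (proj2 vthh))) pthh0).
have qgh : Q0 L r s (wderiv L wh).
  exact (conj (conj sgh (wderiv_piecewise L0 ps (proj1 vwh) (proj2 vwh))) wh0).
have [v0 h0] := Vh0 L0 ps r1.
have tests psi : Q0 L r s psi ->
    HHh L r s (prim psi, cst 0) /\ HHh L r s (cst 0, prim psi).
  by move=> [[spsi ppsi] psi0]; have [? ?] := Vh_prim L0 ps r1 spsi ppsi psi0.
have sff := sqintB mI sf sfh; have szz := sqintB mI sga sgah.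
have kE u psi : ip I (fun x => (Ah x)^-1 * u x) psi = L2dot L (fun x => u x / Ah x) psi.
  by apply: eq_Rintegral => x _; rewrite [_^-1 * _]mulrC.
have spf := prim_sqint Lge sf; have spfh := prim_sqint Lge sfh.
have s1 := sqint_cst mI fI 1.
have [] := hC s lam Ih (fun x => (Ah x)^-1) (wderiv L th) (wderiv L thh) (wderiv L w)
  (wderiv L wh) ga gah psif psig psiz M ps mIh mkap hIh hAh hlam sf qfh sg qgh sga
  (conj sgah pgah) pth0 w0.
- move=> psi qpsi; have [t1 _] := tests _ qpsi; have spsi := proj1 (proj1 qpsi).
  have := G1 _ _ t1; rewrite !elastic_form_eta//; [|exact: SI|exact: SI].
  have spp := prim_sqint Lge spsi.
  rewrite (_ : (fun x => Ih x * (_ - _)) = (fun x => Ih x * wderiv L th x - Ih x * wderiv L thh x)).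
    rewrite (ipBl mI (SI _ sf) (SI _ sfh) spsi) (ipBl mI sga sgah spp).
    exact: sub_add_eq0.
  by apply/funext => x; rewrite mulrBr.
- move=> psi qpsi; have [_ t2] := tests _ qpsi; have spsi := proj1 (proj1 qpsi).
  have := G1 _ _ t2; rewrite !elastic_form_v//; [|exact: SI|exact: SI].
  by rewrite (ipBl mI sga sgah spsi) => /oppr_inj ->; rewrite subrr.
- move=> psi qpsi; have spsi := proj1 qpsi.
  have g2 := G2 _ (iffRL (QE psi) qpsi); have g2h := G2h _ (iffRL (QE psi) qpsi).
  rewrite -kE in g2; rewrite -kE in g2h.
  rewrite (_ : (fun x => (Ah x)^-1 * (_ - _)) =
    (fun x => (Ah x)^-1 * ga x - (Ah x)^-1 * gah x)); last first.
    by apply/funext => x; rewrite mulrBr.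
  rewrite (ipBl mI (SK _ sga) (SK _ sgah) spsi) (ipBl mI (sqintB mI spf spfh) (sqintB mI sg sgh) spsi).
  rewrite (ipBl mI spf spfh spsi) (ipBl mI sg sgh spsi).
  have e3 := ip_ae mI sth spf spsi spsi sth0 (aeq_refl _ _).
  have e4 := ip_ae mI sthh spfh spsi spsi sthh0 (aeq_refl _ _).
  have e1 : L2dot L (th \- wderiv L w) psi = ip I th psi - ip I (wderiv L w) psi.
    exact: (ipBl mI sth sg spsi).
  have e2 : L2dot L (thh \- wderiv L wh) psi = ip I thh psi - ip I (wderiv L wh) psi.
    exact: (ipBl mI sthh sgh spsi).
  rewrite e1 in g2; rewrite e2 in g2h; exact: (sub_system e3 e4 g2 g2h).
- move=> psi qpsi; have [t1 _] := tests _ qpsi; have spsi := proj1 (proj1 qpsi).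
  by have := G3 _ t1; rewrite elastic_form_eta//; exact: SI.
- have q1 : Q L r s (cst 1) by exact: Q_cst.
  have := G2h _ (iffRL (QE _) q1); rewrite -kE.
  have -> : L2dot L (thh \- wderiv L wh) (cst 1) = ip I thh (cst 1) - ip I (wderiv L wh) (cst 1).
    exact: (ipBl mI sthh sgh s1).
  rewrite (ip_ae mI sthh spfh s1 s1 sthh0 (aeq_refl _ _)).
  have one u : ip I u (cst 1) = \int[mu]_(x in I) u x.
    by apply: eq_Rintegral => x _; rewrite mulr1.
  by rewrite !one wh0 subr0 => /eqP; rewrite subr_eq0 => /eqP.
- exact/QE.
- exact (le_trans nf (ler_wpM2l (exprn_ge0 r hr) b1)).
- exact/QE.
- exact (le_trans ng (ler_wpM2l (exprn_ge0 r hr) b2)).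
- exact/QE.
- exact (le_trans nz (ler_wpM2l (exprn_ge0 r hr) b3)).
- exact b4.
- exact b5.
set B := C * _ => e1 e2 e3.
have -> : 3 * C * mesh_size s ^+ r * M = B + B + B by rewrite /B; ring.
apply: lerD; last by rewrite L2norm_nrm.
rewrite /HH_norm /= !L2norm_nrm (wderivB_nrm hth hthh) (wderivB_nrm hw hwh).
exact (le_trans (sqrt_sum_le (nrm_ge0 _ _) (nrm_ge0 _ _)) (lerD e1 e2)).
Qed.

End galerkin_error.

(** * Integration in time *)

Section nonmeasurable_integral.
Context d (X : measurableType d) (R : realType) (mu : {measure set X -> \bar R}).
Implicit Types (A : set X) (f g : X -> \bar R).
#[local] Existing Instance ae_filter_ringOfSetsType.
Import HBNNSimple.
Local Open Scope ereal_scope.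

(* The integral of a nonnegative function is a supremum over the simple functions
   below it, so that null sets are negligible without any measurability. *)
Lemma ae_ge0_le_integral_gen A f g : (forall x, A x -> 0 <= f x) ->
  (forall x, A x -> 0 <= g x) -> {ae mu, forall x, A x -> f x <= g x} ->
  \int[mu]_(x in A) f x <= \int[mu]_(x in A) g x.
Proof.
move=> f0 g0 [N [mN N0 sub]].
rewrite ge0_integralE// [leRHS]ge0_integralE//.
apply: ge_ereal_sup => _ [h hf <-].
(* Setting [h] to 0 on the null set keeps its integral and puts it below [g] everywhere. *)
pose h' := proj_nnsfun h (measurableC mN).
have -> : sintegral mu (h : X -> R) = sintegral mu (h' : X -> R).
  rewrite -!integralT_nnsfun; apply: ae_eq_integral => //.
  - exact/measurable_EFinP.
  - exact/measurable_EFinP.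
  - exists N; split => // x /= h1; apply: contrapT => nx; apply: h1 => _ /=.
    by rewrite mindicE mem_set// mulr1.
apply: ereal_sup_ubound; exists h' => // x /=.
rewrite mindicE; case: (boolP (x \in ~` N)) => [|_]; last first.
  by rewrite mulr0 patchE; case: ifPn => // /set_mem; exact: g0.
rewrite inE => xN; rewrite mulr1; apply: (le_trans (hf x)).
rewrite !patchE; case: ifPn => // /set_mem Ax.
by apply: contrapT => h1; apply: xN; apply: sub => /= h2; exact/h1/h2.
Qed.

Lemma ae_eq_integral_gen A f g : {ae mu, forall x, A x -> f x = g x} ->
  \int[mu]_(x in A) f x = \int[mu]_(x in A) g x.
Proof.
move=> fg; rewrite integralE [RHS]integralE.
have eqge0 (u v : X -> \bar R) : (forall x, 0 <= u x) -> (forall x, 0 <= v x) ->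
    {ae mu, forall x, A x -> u x = v x} ->
    \int[mu]_(x in A) u x = \int[mu]_(x in A) v x.
  move=> u0 v0 uv; apply/eqP; rewrite eq_le; apply/andP; split;
    apply: ae_ge0_le_integral_gen => //; apply: filterS uv => x h /h ->//.
congr (_ - _); apply: eqge0 => //; apply: filterS fg => x h Ax.
- by rewrite !funeposE h.
- by rewrite !funenegE h.
Qed.

(** Without measurability of [f]: a simple function below [c * f], divided by [c], is below [f]. *)
Lemma ge0_integralZ_le A (c : R) (f : X -> R) : (0 < c)%R ->
  (forall x, A x -> (0 <= f x)%R) ->
  \int[mu]_(x in A) (c * f x)%:E <= c%:E * \int[mu]_(x in A) (f x)%:E.
Proof.
move=> c0 f0; have c0' := ltW c0.
rewrite ge0_integralE; last by move=> x Ax; rewrite lee_fin mulr_ge0// f0.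
apply: ge_ereal_sup => _ [h hf <-].
have ci0 : (0 <= c^-1)%R by rewrite invr_ge0.
pose k : {nonneg R} := NngNum ci0.
pose h' := scale_nnsfun h ci0.
rewrite muleC -lee_pdivrMr//.
rewrite [leRHS]ge0_integralE//.
rewrite muleC -sintegralrM.
apply: ereal_sup_ubound; exists h' => // x /=.
have := hf x; rewrite !patchE; case: ifPn => [/set_mem Ax|_].
  by rewrite !lee_fin => h1; rewrite mulrC -ler_pdivlMr ?invr_gt0// invrK mulrC.
move=> h1; have -> : h x = 0%R by apply/eqP; rewrite eq_le -lee_fin h1/= fun_ge0.
by rewrite mulr0.
Qed.

End nonmeasurable_integral.

Section bochner.
Context {R : realType}.
Notation mu := (@lebesgue_measure R).

(** [psi] of the approximating simple maps is simple and, by the Lipschitz bound, converges almost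
    everywhere to [psi] of [f]. *)
Lemma L1_comp_measurable (V : zmodType) (D : set V) (N : V -> R) (T C : R)
    (f : R -> V) (psi : V -> R) : L1 T D N f ->
  (forall u v, D u -> D v -> `|psi u - psi v| <= C * N (u - v)) ->
  exists2 G : R -> R, measurable_fun `[0, T] G &
    {ae mu, forall t, t \in `[0, T] -> psi (f t) = G t}.
Proof.
move=> [[s simp [Z [mZ Z0 sub]]] _] lip.
(* Cutting out the measurable null set [Z] makes the convergence hold at every point, so that the
   limit is measurable. *)
pose g n t := psi (s n t) * \1_(~` Z) t.
exists (fun t => psi (f t) * \1_(~` Z) t); last first.
  exists Z; split => // t /= h; apply: contrapT => tZ; apply: h => _.
  by rewrite indicE mem_set// mulr1.
have mg n : measurable_fun `[0, T] (g n).
  apply: measurable_funM.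
    move=> _ Y mY; have [fin ms _] := simp n.
    have -> : `[0, T] `&` (fun t => psi (s n t)) @^-1` Y =
        \bigcup_(b in (s n @` `[0, T]) `&` psi @^-1` Y)
          (`[0, T] `&` s n @^-1` [set b]).
      apply/seteqP; split => [t [tT tY]|t [b [_ bY] [tT /= tb]]].
        by exists (s n t) => //; split => //; exists t.
      by split => //=; rewrite tb.
    apply: fin_bigcup_measurable => [|b _]; last exact: ms.
    exact: sub_finite_set fin.
  apply: (@measurable_funS _ _ _ _ setT) => //.
  apply: measurable_indic.
  exact: measurableC.
apply: (measurable_fun_cvg mg) => t tT.
have [tZ|tZ] := pselect (Z t).
  rewrite /g indicE memNset; last by move=> /(_ tZ).
  rewrite mulr0; under eq_fun do rewrite mulr0; exact: cvg_cst.
rewrite /g indicE mem_set// mulr1.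
under eq_fun do rewrite mulr1.
have h : t \in `[0, T] ->
    D (f t) /\ (N (f t - s n t) @[n --> \oo] --> (0 : R)).
  by apply: contrapT => h; apply: tZ; exact: sub.
have [Df cv] := h tT.
apply/subr_cvg0; apply/norm_cvg0P.
apply: (@squeeze_cvgr _ _ _ _ (cst 0) (fun n => C * N (f t - s n t))).
- apply: nearW => n; rewrite normr_ge0/= distrC; apply: lip => //.
  by have [_ _ sD] := simp n; exact: sD.
- exact: cvg_cst.
- by rewrite -(mulr0 C); apply: cvgM => //; exact: cvg_cst.
Qed.
End bochner.

(** * Uniqueness for Volterra equations with a bounded continuous kernel *)

Section volterra.
Context {R : realType}.
Notation mu := (@lebesgue_measure R).
Variables (T M : R) (kk : R -> R -> R).
Hypothesis T0 : 0 <= T.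
Hypothesis kk_cont : {within [set p : R * R | [/\ 0 <= p.2, p.2 <= p.1 & p.1 <= T]],
  continuous (fun p : R * R => kk p.1 p.2)}.
Hypothesis kk_bnd : forall t s, 0 <= s -> s <= t -> t <= T -> `|kk t s| <= M.

Lemma kernel_measurable t : t \in `[0, T] -> measurable_fun `[0, t] (kk t).
Proof.
rewrite in_itv/= => /andP[t0 tT].
apply: subspace_continuous_measurable_fun => //.
apply/subspace_continuousP => s; rewrite /= in_itv/= => /andP[s0 st].
move/subspace_continuousP: kk_cont => /(_ (t, s)) h.
have {}h : (kk p.1 p.2 @[p --> within
    [set p : R * R | [/\ 0 <= p.2, p.2 <= p.1 & p.1 <= T]] (nbhs (t, s))] -->
    kk t s) by exact: (h (And3 s0 st tT)).
move=> U /h; rewrite /= /within/= !near_simpl/= => hU.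
have c : (fun s' => (t, s')) @ s --> (t, s) by exact: (cvg_pair (cvg_cst t) cvg_id).
have h1 : \forall s' \near s, [/\ 0 <= s', s' <= t & t <= T] -> U (kk t s').
  exact: c _ hU.
suff : \forall s' \near s, (s' \in `[0, t]) -> U (kk t s') by [].
by apply: filterS h1 => s' h1; rewrite in_itv/= => /andP[? ?]; exact: h1.
Qed.

Lemma kernel_integrable t f : t \in `[0, T] ->
  mu.-integrable `[0, T] (EFin \o f) ->
  mu.-integrable `[0, t] (EFin \o (fun s => kk t s * f s)).
Proof.
move=> tT fi; have := tT; rewrite in_itv/= => /andP[t0 tT'].
have fi' : mu.-integrable `[0, t] (EFin \o f).
  by apply: integrableS fi => //; apply: subset_itvl; rewrite bnd_simp.
have mf : measurable_fun `[0, t] f by apply/measurable_EFinP; exact: measurable_int fi'.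
apply: (@integrable_bound _ _ _ _ (fun s => M * `|f s|)) => //.
- by apply: measurable_funM => //; exact: kernel_measurable.
- by apply: integrableZ_fin => //; exact: (integrable_norm fi').
- move=> s; rewrite /= in_itv/= => /andP[s0 st].
  by rewrite normrM ler_wpM2r//; exact: kk_bnd.
Qed.

Lemma kernel_int_le t f : t \in `[0, T] -> 0 <= M ->
  mu.-integrable `[0, T] (EFin \o f) ->
  `|\int[mu]_(s in `[0, t]) (kk t s * f s)| <= M * prim (fun s => `|f s|) t.
Proof.
move=> tT M0 fi; have := tT; rewrite in_itv/= => /andP[t0 tT'].
have fi' : mu.-integrable `[0, t] (EFin \o f).
  by apply: integrableS fi => //; apply: subset_itvl; rewrite bnd_simp.
have ni := integrable_norm fi'.
have ki := kernel_integrable tT fi.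
apply: (le_trans (le_normr_Rintegral _ ki)) => //.
rewrite /prim -RintegralZl//; apply: le_Rintegral => //.
- exact: (integrable_norm ki).
- by apply: integrableZ_fin.
- move=> s; rewrite /= in_itv/= => /andP[s0 st].
  by rewrite normrM ler_wpM2r//; exact: kk_bnd.
Qed.

(** Gronwall by steps: on an interval of length at most [1 / (2 M)] on whose left [f] vanishes, the
    integral of [|f|] is at most half of itself. The conclusion concerns the memory integral, and so
    holds at every time. *)
Lemma volterra_eq0 f : mu.-integrable `[0, T] (EFin \o f) ->
  {ae mu, forall t, t \in `[0, T] ->
    f t = \int[mu]_(s in `[0, t]) (kk t s * f s)} ->
  forall t, t \in `[0, T] -> \int[mu]_(s in `[0, t]) (kk t s * f s) = 0.
Proof.
move=> fi fE.
have M0 : 0 <= M by apply: le_trans (kk_bnd (lexx 0) (lexx 0) T0).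
pose g s := `|f s|.
have gi : mu.-integrable `[0, T] (EFin \o g) by exact: (integrable_norm fi).
have g_incr a b : 0 <= a -> a <= b -> b <= T -> prim g a <= prim g b.
  move=> a0 ab bT; rewrite -subr_ge0 (@prim_sub _ T)//.
  by apply: Rintegral_ge0 => s _; rewrite normr_ge0.
have step a b : 0 <= a -> a <= b -> b <= T -> (b - a) * M <= 2^-1 ->
    prim g a = 0 -> prim g b = 0.
  move=> a0 ab bT small ga.
  have gb0 : 0 <= prim g b by rewrite -ga g_incr.
  (* As [(b - a) * M <= 1 / 2] and [prim g b >= 0], this forces [prim g b = 0]. *)
  suff : prim g b <= (b - a) * M * prim g b by move=> ?; nra.
  rewrite -[leLHS]subr0 -ga (@prim_sub _ T)// mulrC mulrA.
  have sub : `[a, b] `<=` `[0, T] by apply: subset_itv; rewrite bnd_simp.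
  have gi' : mu.-integrable `[a, b] (EFin \o g) by exact: integrableS gi.
  rewrite mulrAC -[leRHS](Rintegral_cst_itv (prim g b * M))//.
  rewrite -lee_fin -!EFin_Rintegral//; last first.
    have mab := measurable_itv `[a, b].
  exact (sqint_int mab (itv_measure_lty a b) (sqint_cst mab (itv_measure_lty a b) _)).
  apply: ae_ge0_le_integral_gen.
  - by move=> s _; rewrite lee_fin normr_ge0.
  - by move=> s _; rewrite lee_fin mulr_ge0.
  - apply: filterS fE => s h sab; rewrite lee_fin.
    have sT : s \in `[0, T] by exact: sub.
    move: sab; rewrite /= in_itv/= => /andP[as_ sb].
    rewrite /g h// mulrC; apply: (le_trans (kernel_int_le sT M0 fi)).
    by rewrite ler_wpM2l// g_incr// (le_trans a0).
have gT : prim g T = 0.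
  (* Number of steps for which [(T / n) * M <= 1 / 2]; the successor makes it positive. *)
  pose n := (Num.bound (2 * (T * M))).+1.
  have n0 : (0 < n%:R :> R) by rewrite ltr0n.
  have nb : 2 * (T * M) <= n%:R.
    have := archi_boundP (mulr_ge0 (ler0n R 2) (mulr_ge0 T0 M0)).
    by move=> /ltW/le_trans; apply; rewrite ler_nat /n.
  have all i : (i <= n)%N -> prim g (i%:R * (T / n%:R)) = 0.
    elim: i => [_|i IH lin]; first by rewrite mul0r prim0.
    have d0 : 0 <= T / n%:R by rewrite divr_ge0// ltW.
    apply: (step (i%:R * (T / n%:R))); last exact/IH/ltnW.
    - by rewrite mulr_ge0.
    - by rewrite ler_wpM2r// ler_nat.
    - by rewrite mulrCA ler_piMr// ler_pdivrMr// mul1r ler_nat.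
    - rewrite -mulrBl -natrB// subSnn mul1r mulrAC ler_pdivrMr// ler_pdivlMl//.
  by have := all n (leqnn _); rewrite mulrCA divff ?mulr1// gt_eqF.
move=> t tT; apply/eqP; rewrite -normr_le0.
apply: (le_trans (kernel_int_le tT M0 fi)).
move: tT; rewrite in_itv/= => /andP[t0 tT].
by rewrite -(mulr0 M) ler_wpM2l// -gT g_incr.
Qed.

(** [P] collects the times at which the equations hold and can be fixed before the test pair, so the
    exceptional set is common to all pairs. [F'] and [G'] are integrable versions of [F] and [G]. *)
Lemma volterra_unique (P : R -> Prop) (l F F' G G' : R -> R) :
  {ae mu, forall t, t \in `[0, T] -> P t} ->
  mu.-integrable `[0, T] (EFin \o F') -> mu.-integrable `[0, T] (EFin \o G') ->
  {ae mu, forall t, t \in `[0, T] -> F t = F' t} ->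
  {ae mu, forall t, t \in `[0, T] -> G t = G' t} ->
  (forall t, t \in `[0, T] -> P t ->
     F t = l t + \int[mu]_(s in `[0, t]) (kk t s * F s)) ->
  (forall t, t \in `[0, T] -> P t ->
     G t = l t + \int[mu]_(s in `[0, t]) (kk t s * G s)) ->
  forall t, t \in `[0, T] -> P t -> F t = G t.
Proof.
move=> aP Fi Gi FF GG eF eG.
have swap f f' t : {ae mu, forall t, t \in `[0, T] -> f t = f' t} -> t \in `[0, T] ->
    \int[mu]_(s in `[0, t]) (kk t s * f s) = \int[mu]_(s in `[0, t]) (kk t s * f' s).
  move=> ff tT; congr fine; apply: ae_eq_integral_gen.
  apply: filterS ff => s h; rewrite /= in_itv/= => /andP[s0 st].
  rewrite h// in_itv/= s0 (le_trans st)//.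
  by move: tT; rewrite in_itv/= => /andP[].
have FGi : mu.-integrable `[0, T] (EFin \o (fun t => F' t - G' t)).
  rewrite (_ : EFin \o _ = EFin \o (fun t => F' t + -1 * G' t)); last first.
    by apply/funext => t /=; rewrite mulN1r.
  by apply: integrableD_fin => //; apply: integrableZ_fin.
have eB t : t \in `[0, T] -> P t ->
    F t - G t = \int[mu]_(s in `[0, t]) (kk t s * (F' s - G' s)).
  move=> tT Pt; rewrite eF// eG// (swap _ _ _ FF tT) (swap _ _ _ GG tT).
  rewrite opprD addrACA subrr add0r -RintegralB//; last 2 first.
  - exact: kernel_integrable.
  - exact: kernel_integrable.
  by apply: eq_Rintegral => s _; rewrite mulrBr.
have ev : {ae mu, forall t, t \in `[0, T] ->
    F' t - G' t = \int[mu]_(s in `[0, t]) (kk t s * (F' s - G' s))}.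
  apply: filterS3 aP FF GG => t aP FF GG tT.
  by rewrite -eB//; [rewrite FF// GG|exact: aP].
move=> t tT Pt; apply/eqP; rewrite -subr_eq0 eB//.
by rewrite (volterra_eq0 FGi ev).
Qed.

End volterra.

(** * The elastic form as an integrable function of time *)

Section elastic_in_time.
Context {R : realType}.
Notation mu := (@lebesgue_measure R).
Variables (L : R) (L0 : 0 < L) (a1 a2 : R) (Ih : R -> R).
Hypotheses (a10 : 0 < a1) (a20 : 0 <= a2).
Notation I := (`[0, L]%classic : set R).
Hypotheses (mIh : measurable_fun I Ih)
  (hIh : forall x, x \in `[0, L] -> a1 <= Ih x <= a2).
Let mI : measurable I. Proof. exact: measurable_itv. Qed.
Local Notation V := ((R -> R) * (R -> R) * (R -> R))%type.

Lemma le_sqrt_sum (x y : R) : 0 <= x -> x <= Num.sqrt (x ^+ 2 + y ^+ 2).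
Proof.
by move=> x0; rewrite -[leLHS]ger0_norm// -sqrtr_sqr ler_wsqrtr// lerDl sqr_ge0.
Qed.

Lemma HHL2_norm_ge (f g w : R -> R) :
  nrm I (wderiv L f) <= HHL2_norm L (f, w, g) /\ nrm I g <= HHL2_norm L (f, w, g).
Proof.
rewrite -!L2norm_nrm /HHL2_norm /HH_norm /=; split.
- apply: (le_trans _ (le_sqrt_sum _ (sqrtr_ge0 _))).
  by apply: le_sqrt_sum; rewrite L2norm_nrm nrm_ge0.
- by rewrite addrC; apply: le_sqrt_sum; rewrite L2norm_nrm nrm_ge0.
Qed.

Lemma form_le (f g p q : R -> R) (m : R) : sqint I f -> sqint I g -> sqint I p ->
  sqint I q -> nrm I f <= m -> nrm I g <= m ->
  `|ip I (fun x => Ih x * f x) p + ip I g q| <= (a2 * nrm I p + nrm I q) * m.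
Proof.
move=> sf sg sp sq fm gm; have [sb nb] := bounded_mul L0 a10 mIh hIh sf.
apply: (le_trans (ler_normD _ _)); rewrite mulrDl; apply: lerD.
- apply: (le_trans (ip_le_nrm mI sb sp)); rewrite mulrAC.
  apply: (ler_wpM2r (nrm_ge0 _ _)); apply: (le_trans nb).
  exact: (ler_wpM2l a20).
- apply: (le_trans (ip_le_nrm mI sg sq)); rewrite mulrC.
  exact: (ler_wpM2l (nrm_ge0 _ _)).
Qed.

(** For a fixed test pair, the bound yields integrability in time and the Lipschitz estimate
    measurability. The summand 1 in [K] makes it positive even for a null pair. *)
Lemma elastic_le (eta v : R -> R) : HH L (eta, v) -> exists2 K, 0 < K &
  (forall f w g, (HH L `*` L2 L) (f, w, g) ->
     `|elastic_form L Ih f g eta v| <= K * HHL2_norm L (f, w, g)) /\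
  (forall u u' : V, (HH L `*` L2 L) u -> (HH L `*` L2 L) u' ->
     `|elastic_form L Ih u.1.1 u.2 eta v - elastic_form L Ih u'.1.1 u'.2 eta v| <=
     K * HHL2_norm L (u - u')).
Proof.
move=> [/= he hv]; have sp := H10_wderiv_sqint L0 he.
have sq : sqint I (fun x => eta x - wderiv L v x).
  exact (sqintB mI (H10_sqint he) (H10_wderiv_sqint L0 hv)).
set p := wderiv L eta in sp *; set q := (fun x => eta x - wderiv L v x) in sq *.
have K0 : 0 <= a2 * nrm I p + nrm I q.
  exact: (addr_ge0 (mulr_ge0 a20 (nrm_ge0 _ _)) (nrm_ge0 _ _)).
exists (a2 * nrm I p + nrm I q + 1); first exact: ltr_wpDl.
have K1 (c x m : R) : x <= c * m -> 0 <= m -> x <= (c + 1) * m.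
  by move=> h m0; apply: (le_trans h); rewrite mulrDl mul1r lerDl.
split=> [f w g [[/= hf hw] /L2_sqint sg]|].
- have [b1 b2] := HHL2_norm_ge f g w.
  apply: K1; last exact: sqrtr_ge0.
  exact (form_le (H10_wderiv_sqint L0 hf) sg sp sq b1 b2).
- move=> [[f w] g] [[f' w'] g'] [[/= hf hw] /L2_sqint sg] [[/= hf' hw'] /L2_sqint sg'].
  have [b1 b2] := HHL2_norm_ge (f \- f') (g \- g') (w \- w').
  apply: K1; last exact: sqrtr_ge0.
  rewrite (wderivB_nrm L0 hf hf') in b1.
  have sf := H10_wderiv_sqint L0 hf; have sf' := H10_wderiv_sqint L0 hf'.
  have := form_le (sqintB mI sf sf') (sqintB mI sg sg') sp sq b1 b2.
  have [sIf _] := bounded_mul L0 a10 mIh hIh sf.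
  have [sIf' _] := bounded_mul L0 a10 mIh hIh sf'.
  have -> : ip I (fun x => Ih x * (wderiv L f x - wderiv L f' x)) p =
      ip I (fun x => Ih x * wderiv L f x) p - ip I (fun x => Ih x * wderiv L f' x) p.
    rewrite -(ipBl mI sIf sIf' sp); congr (ip I _ p).
    by apply/funext => x; rewrite mulrBr.
  rewrite (ipBl mI sg sg' sq) => h; apply: (le_trans _ h).
  rewrite addrACA -opprD; exact: lexx.
Qed.

Lemma elastic_integrable (T : R) (f : R -> V) (eta v : R -> R) :
  L1 T (HH L `*` L2 L) (HHL2_norm L) f -> HH L (eta, v) ->
  exists2 F : R -> R, mu.-integrable `[0, T] (EFin \o F) &
    {ae mu, forall t, t \in `[0, T] ->
       elastic_form L Ih (f t).1.1 (f t).2 eta v = F t}.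
Proof.
move=> fL hev; have [K K0 [bnd lip]] := elastic_le hev.
pose psi (u : V) := elastic_form L Ih u.1.1 u.2 eta v.
have [F mF fF] := L1_comp_measurable (psi := psi) fL lip.
exists F => //; apply/integrableP; split; first exact/measurable_EFinP.
case: fL => -[s _ fD] fin.
apply: (@le_lt_trans _ _ (K%:E * L1norm T (HHL2_norm L) f)%E); last first.
  by apply: lte_mul_pinfty; rewrite ?lee_fin ?ltW.
have h := @ge0_integralZ_le _ _ _ mu `[0, T]%classic K
  (fun t => HHL2_norm L (f t)) K0 (fun t _ => sqrtr_ge0 _).
apply: (le_trans _ h) => {h}.
apply: ae_ge0_le_integral_gen.
- by move=> t _; exact: abse_ge0.
- by move=> t _; rewrite lee_fin (mulr_ge0 (ltW K0))// sqrtr_ge0.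
- apply: filterS2 fF fD => t fF fD tT.
  have [Df _] := fD tT.
  rewrite /= lee_fin -fF//.
  by move: Df; rewrite /psi; case: (f t) => [[f1 f2] f3] /bnd.
Qed.

End elastic_in_time.

Lemma L1_sub (R : realType) (V : zmodType) (T : R) (D D' : set V) (N : V -> R) f :
  D `<=` D' -> L1 T D N f -> L1 T D' N f.
Proof.
move=> DD [[s ss h] fin]; split=> //; exists s => [n|].
  by have [s1 s2 s3] := ss n; split => // t /s3/DD.
by apply: filterS h => t h /h [/DD].
Qed.

Lemma Rintegral_cst0 (R : realType) (D : set R) :
  \int[@lebesgue_measure R]_(x in D) (cst 0 x) = 0 :> R.
Proof. by rewrite /Rintegral integral0. Qed.

Lemma L2dot_cst0 (R : realType) (L : R) (u : R -> R) : L2dot L u (cst 0) = 0.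
Proof.
rewrite /L2dot (_ : (fun x => _) = cst 0); last by apply/funext => x; rewrite mulr0.
exact: Rintegral_cst0.
Qed.

Section galerkin_in_time.
Context {R : realType}.
Notation mu := (@lebesgue_measure R).
Variables (L : R) (L0 : 0 < L) (a1 a2 : R) (Ih : R -> R).
Hypotheses (a10 : 0 < a1) (a20 : 0 <= a2).
Hypotheses (mIh : measurable_fun `[0, L] Ih)
  (hIh : forall x, x \in `[0, L] -> a1 <= Ih x <= a2).
Variables (T M : R) (kk : R -> R -> R).
Hypothesis T0 : 0 <= T.
Hypothesis kk_cont : {within [set p : R * R | [/\ 0 <= p.2, p.2 <= p.1 & p.1 <= T]],
  continuous (fun p : R * R => kk p.1 p.2)}.
Hypothesis kk_bnd : forall t s, 0 <= s -> s <= t -> t <= T -> `|kk t s| <= M.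
Variables (Ah : R -> R) (lam : R) (X : set ((R -> R) * (R -> R))) (Q : set (R -> R)).
Variables (qE th w ga thh wh gah : R -> R -> R).
Hypotheses (XH : X `<=` HH L) (QL : Q `<=` L2 L) (X0 : Q (cst 0)).
Hypothesis sol : mixed_solution L T kk Ih Ah lam (HH L) (L2 L) qE th w ga.
Hypothesis solh : mixed_solution L T kk Ih Ah lam X Q qE thh wh gah.

(** [P t] contains the equations for all test pairs at once, so uniqueness can be applied pair by
    pair at a fixed good time. *)
Lemma galerkin_in_time : {ae mu, forall t, t \in `[0, T] ->
  (forall eta v, X (eta, v) -> elastic_form L Ih (th t) (ga t) eta v =
     elastic_form L Ih (thh t) (gah t) eta v) /\
  (forall eta, X (eta, cst 0) -> elastic_form L Ih (thh t) (gah t) eta (cst 0) = 0)}.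
Proof.
have [fL fE] := sol; have [gL gE] := solh.
have sub : X `*` Q `<=` HH L `*` L2 L by move=> [u p] [/XH ? /QL].
have gL' := L1_sub sub gL.
pose P t := (forall eta v, X (eta, v) ->
    elastic_form L Ih (th t) (ga t) eta v = L2dot L (qE t) v +
      \int[mu]_(s in `[0, t]) (kk t s * elastic_form L Ih (th s) (ga s) eta v)) /\
  (forall eta v, X (eta, v) ->
    elastic_form L Ih (thh t) (gah t) eta v = L2dot L (qE t) v +
      \int[mu]_(s in `[0, t]) (kk t s * elastic_form L Ih (thh s) (gah s) eta v)).
have aP : {ae mu, forall t, t \in `[0, T] -> P t}.
  apply: filterS2 fE gE => t fE gE tT; split=> eta v hX.
    by have [] := fE tT eta v (cst 0) (XH hX) (QL X0).
  by have [] := gE tT eta v (cst 0) hX X0.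
apply: filterS (aP) => t Pt tT; split=> [eta v hX|eta hX].
- have [F Fi FF] := elastic_integrable L0 a10 a20 mIh hIh fL (XH hX).
  have [G Gi GG] := elastic_integrable L0 a10 a20 mIh hIh gL' (XH hX).
  apply: (volterra_unique T0 kk_cont kk_bnd aP Fi Gi FF GG _ _ tT (Pt tT)).
  + by move=> s _ [h _]; exact: h.
  + by move=> s _ [_ h]; exact: h.
- have [G Gi GG] := elastic_integrable L0 a10 a20 mIh hIh gL' (XH hX).
  have oi : mu.-integrable `[0, T] (EFin \o (cst 0 : R -> R)).
    have mab := measurable_itv `[0, T].
    exact (sqint_int mab (itv_measure_lty 0 T) (sqint_cst mab (itv_measure_lty 0 T) 0)).
  (* With [v = 0] the load term vanishes, and the zero function solves the same Volterra
     equation. *)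
  apply: (volterra_unique (l := fun s => L2dot L (qE s) (cst 0)) (G := cst 0) T0 kk_cont kk_bnd aP Gi oi GG _ _ _ tT (Pt tT)).
  + exact: nearW.
  + by move=> s _ [_ h]; exact: h.
  + move=> s _ _ /=; rewrite L2dot_cst0 add0r.
    rewrite (_ : (fun x => _) = cst 0) ?Rintegral_cst0//.
    by apply/funext => x; rewrite mulr0.
Qed.

End galerkin_in_time.

(** * Measurability in time of Sobolev norms *)

Section sobolev_in_time.
Context {R : realType}.
Notation mu := (@lebesgue_measure R).
Variables (L : R) (L0 : 0 < L).
Notation I := (`[0, L]%classic : set R).
Let mI : measurable I. Proof. exact: measurable_itv. Qed.

Lemma nrm_dist (u v : R -> R) : sqint I u -> sqint I v ->
  `|nrm I u - nrm I v| <= nrm I (fun x => u x - v x).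
Proof.
move=> su sv; have h (f g : R -> R) : sqint I f -> sqint I g ->
    nrm I f <= nrm I g + nrm I (fun x => f x - g x).
  move=> sf sg; have := nrmD mI sg (sqintB mI sf sg).
  rewrite (_ : (fun x => g x + (f x - g x)) = f)//.
  by apply/funext => x; rewrite addrC subrK.
have h1 := h _ _ su sv; have h2 := h _ _ sv su.
have e : nrm I (fun x => v x - u x) = nrm I (fun x => u x - v x).
  have := nrmZ mI (-1) (sqintB mI su sv); rewrite normrN1 mul1r => <-.
  by congr (nrm I _); apply/funext => x; rewrite mulN1r opprB.
rewrite e in h2; have aux (a b c : R) : a <= b + c -> b <= a + c -> `|a - b| <= c.
  by move=> ? ?; rewrite ler_norml; apply/andP; split; lra.
exact: aux.
Qed.

Lemma sobolev_dist k j (u v : R -> R) : (j <= k)%N -> sobolev L k u -> sobolev L k v ->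
  `|nrm I (iter j (wderiv L) u) - nrm I (iter j (wderiv L) v)| <=
  1 * sobolev_norm L k (u - v).
Proof.
move=> jk su sv; have suv := sobolevB su sv.
have si w : sobolev L k w -> sqint I (iter j (wderiv L) w).
  by move=> sw; apply: (sobolev_sqint (sobolev_iter L0 sw jk)).
rewrite mul1r; apply: (le_trans _ (nrm_le_sobolev _ (u - v) jk)).
apply: (le_trans (nrm_dist (si _ su) (si _ sv))).
have h := iter_wderivB L0 su sv suv (aeq_refl _ _) jk.
rewrite -(nrm_ae mI (si _ suv) (sqintB mI (si _ su) (si _ sv)) h).
exact: lexx.
Qed.

(** The L2 norm of each derivative of order at most [k] is 1-Lipschitz for the Sobolev norm.
    Measurable versions are needed to add the three regularity norms under the integral. *)
Lemma sobolev_norm_measurable (T : R) k (f : R -> R -> R) :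
  L1 T (sobolev L k) (sobolev_norm L k) f ->
  exists2 G : R -> R, measurable_fun `[0, T] G &
    {ae mu, forall t, t \in `[0, T] -> sobolev_norm L k (f t) = G t}.
Proof.
move=> fL.
have /choice[G hG] j : exists G : R -> R, measurable_fun `[0, T] G /\
    {ae mu, forall t, t \in `[0, T] -> (j < k.+1)%N ->
       nrm I (iter j (wderiv L) (f t)) = G t}.
  have [jk|jk] := leqP j k; last first.
    exists (cst 0); split; first exact: measurable_cst.
    by apply: nearW => t _; rewrite ltnS leqNgt jk.
  have [G mG fG] := L1_comp_measurable fL (fun u v => @sobolev_dist k j u v jk).
  by exists G; split => //; apply: filterS fG => t h /h.
exists (fun t => Num.sqrt (\sum_(j < k.+1) G j t ^+ 2)).
  have ms : measurable_fun setT (Num.sqrt : R -> R).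
    by apply: continuous_measurable_fun; exact: sqrt_continuous.
  apply: (measurableT_comp ms).
  by apply: measurable_sum => j; apply: measurable_funX; have [] := hG j.
have /ae_foralln : forall j, {ae mu, forall t, t \in `[0, T] -> (j < k.+1)%N ->
    nrm I (iter j (wderiv L) (f t)) = G j t} by move=> j; have [] := hG j.
apply: filterS => t h tT; rewrite /sobolev_norm; congr Num.sqrt.
by apply: eq_bigr => j _; rewrite L2norm_nrm h.
Qed.

End sobolev_in_time.

Section integrate_error.
Context {R : realType}.
Notation mu := (@lebesgue_measure R).

Lemma ae_measurable_ge0 (D : set R) (X X' : R -> R) : (forall t, 0 <= X t) ->
  measurable_fun D X' -> {ae mu, forall t, D t -> X t = X' t} ->
  exists2 Y : R -> R, measurable_fun D Y & (forall t, 0 <= Y t) /\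
    {ae mu, forall t, D t -> X t = Y t}.
Proof.
move=> X0 mX XX; exists (fun t => `|X' t|).
  exact: measurableT_comp.
split=> [t|]; first exact: normr_ge0.
by apply: filterS XX => t h Dt; rewrite -h// ger0_norm.
Qed.

(** No measurability is assumed for [A] and [B], so their integrals are not merged: each is bounded
    by the integral of the whole right side, whence the factor 2. The right side is additive because
    [X], [Y], [Z] have measurable versions. *)
Lemma integrate_error (D : set R) (K : R) (A B X Y Z X' Y' Z' : R -> R) :
  measurable D -> 0 <= K -> (forall t, 0 <= A t) -> (forall t, 0 <= B t) ->
  (forall t, 0 <= X t) -> (forall t, 0 <= Y t) -> (forall t, 0 <= Z t) ->
  measurable_fun D X' -> measurable_fun D Y' -> measurable_fun D Z' ->
  {ae mu, forall t, D t -> X t = X' t} ->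
  {ae mu, forall t, D t -> Y t = Y' t} ->
  {ae mu, forall t, D t -> Z t = Z' t} ->
  {ae mu, forall t, D t -> A t + B t <= K * (X t + Y t + Z t)} ->
  (\int[mu]_(t in D) (A t)%:E + \int[mu]_(t in D) (B t)%:E <=
   (2 * K)%:E * (\int[mu]_(t in D) (X t)%:E + \int[mu]_(t in D) (Y t)%:E
                 + \int[mu]_(t in D) (Z t)%:E))%E.
Proof.
move=> mD K0 A0 B0 X0 Y0 Z0 mX mY mZ XX YY ZZ AB.
have [x mx [x0 Xx]] := ae_measurable_ge0 X0 mX XX.
have [y my [y0 Yy]] := ae_measurable_ge0 Y0 mY YY.
have [z mz [z0 Zz]] := ae_measurable_ge0 Z0 mZ ZZ.
have sw (f g : R -> R) : {ae mu, forall t, D t -> f t = g t} ->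
    (\int[mu]_(t in D) (f t)%:E = \int[mu]_(t in D) (g t)%:E)%E.
  by move=> fg; apply: ae_eq_integral_gen; apply: filterS fg => t h /h ->.
rewrite (sw _ _ Xx) (sw _ _ Yy) (sw _ _ Zz).
have sE : (\int[mu]_(t in D) (K * (x t + y t + z t))%:E = K%:E *
    (\int[mu]_(t in D) (x t)%:E + \int[mu]_(t in D) (y t)%:E
      + \int[mu]_(t in D) (z t)%:E))%E.
  have mx' := (measurable_EFinP _ _).2 mx; have my' := (measurable_EFinP _ _).2 my.
  have mz' := (measurable_EFinP _ _).2 mz.
  rewrite -ge0_integralD//; last 2 first.
  - by move=> t _; rewrite lee_fin.
  - by move=> t _; rewrite lee_fin.
  rewrite -ge0_integralD//; last 3 first.
  - by move=> t _; rewrite -EFinD lee_fin addr_ge0.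
  - exact: emeasurable_funD.
  - by move=> t _; rewrite lee_fin.
  rewrite -ge0_integralZl_EFin//; last 2 first.
  - by move=> t _; rewrite -!EFinD lee_fin !addr_ge0.
  - by apply: emeasurable_funD => //; exact: emeasurable_funD.
have AB' : {ae mu, forall t, D t -> A t + B t <= K * (x t + y t + z t)}.
  have xyz : {ae mu, forall t, D t -> X t + Y t + Z t = x t + y t + z t}.
    by apply: filterS3 Xx Yy Zz => t h1 h2 h3 Dt; rewrite h1// h2// h3.
  by apply: filterS2 AB xyz => t h1 h2 Dt; rewrite -h2//; exact: h1.
have bnd (f : R -> R) : (forall t, 0 <= f t) ->
    {ae mu, forall t, D t -> f t <= A t + B t} ->
    (\int[mu]_(t in D) (f t)%:E <= \int[mu]_(t in D) (K * (x t + y t + z t))%:E)%E.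
  move=> f0 fAB; apply: ae_ge0_le_integral_gen.
  - by move=> t _; rewrite lee_fin.
  - by move=> t _; rewrite lee_fin mulr_ge0// !addr_ge0.
  - apply: filterS2 fAB AB' => t h1 h2 Dt; rewrite lee_fin.
    exact: le_trans (h1 Dt) (h2 Dt).
have h : (2 * K)%:E = (K%:E + K%:E)%E by rewrite -EFinD mulrDl mul1r.
rewrite h ge0_muleDl ?lee_fin//.
rewrite -sE; apply: leeD; apply: bnd => //; apply: nearW => t _.
  by rewrite lerDl.
by rewrite lerDr.
Qed.

End integrate_error.

Theorem proposition3p1 (R : realType) (L T : R) (L_gt0 : 0 < L) (T_gt0 : 0 < T)
  (E dE : R -> R) (nu ks epsmax : R) (inertia area : R -> R -> R)
  (CE1 CE2 CG1 CG2 : R)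
  (E_deriv : is_deriv_within `[0, T] E dE)
  (k_cont : {within [set p : R * R | [/\ 0 <= p.2, p.2 <= p.1 & p.1 <= T]],
     continuous (fun p : R * R => memory_kernel E dE p.1 p.2)})
  (k_bnd : exists M : R, forall t s : R, 0 <= s -> s <= t -> t <= T ->
     `|memory_kernel E dE t s| <= M)
  (ks_gt0 : 0 < ks) (epsmax_gt0 : 0 < epsmax)
  (inertia_meas : forall eps : R, 0 < eps <= epsmax ->
     measurable_fun `[0, L] (inertia eps))
  (area_meas : forall eps : R, 0 < eps <= epsmax ->
     measurable_fun `[0, L] (area eps))
  (inertia_gt0 : forall eps x : R, 0 < eps <= epsmax -> x \in `[0, L] ->
     0 < inertia eps x)
  (area_gt0 : forall eps x : R, 0 < eps <= epsmax -> x \in `[0, L] ->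
     0 < area eps x)
  (thickness : forall eps : R, 0 < eps <= epsmax ->
     eps ^+ 2 = L^-1 * \int[@lebesgue_measure R]_(x in `[0, L])
                         (inertia eps x / (area eps x * L ^+ 2)))
  (CE1_gt0 : 0 < CE1) (CE2_gt0 : 0 < CE2) (CG1_gt0 : 0 < CG1) (CG2_gt0 : 0 < CG2)
  (inertia_bnd : forall eps x : R, 0 < eps <= epsmax -> x \in `[0, L] ->
     CE1 <= E 0 * scaled_inertia (inertia eps) eps x <= CE2)
  (area_bnd : forall eps x : R, 0 < eps <= epsmax -> x \in `[0, L] ->
     CG1 <= E 0 / (2 * (1 + nu)) * scaled_area ks (area eps) eps x <= CG2)
  (regularity : forall k, (2 <= k)%N -> exists2 C : R, 0 < C &
     forall (eps : R) (q th w ga : R -> R -> R), 0 < eps <= epsmax ->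
     let qE t x := q t x / E 0 in
     L1 T (L2 L) (L2norm L) q ->
     L1 T (sobolev L (k - 2)) (sobolev_norm L (k - 2)) qE ->
     mixed_solution L T (memory_kernel E dE)
       (scaled_inertia (inertia eps) eps) (scaled_area ks (area eps) eps)
       (2 * (1 + nu) * eps ^+ 2) (HH L) (L2 L) qE th w ga ->
     [/\ L1 T (sobolev L k) (sobolev_norm L k) th,
         L1 T (sobolev L k) (sobolev_norm L k) w,
         L1 T (sobolev L (k - 1)) (sobolev_norm L (k - 1)) ga &
         (L1norm T (sobolev_norm L k) th + L1norm T (sobolev_norm L k) w
            + L1norm T (sobolev_norm L (k - 1)) ga
          <= C%:E * L1norm T (sobolev_norm L (k - 2)) qE)%E])
  (r : nat) (r_ge1 : (1 <= r)%N) :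
  exists2 C : R, 0 < C &
    forall (eps : R) (s : seq R) (q th w ga thh wh gah : R -> R -> R),
    0 < eps <= epsmax ->
    itv_partition 0 L s ->
    let lam := 2 * (1 + nu) * eps ^+ 2 in
    let Ih := scaled_inertia (inertia eps) eps in
    let Ah := scaled_area ks (area eps) eps in
    let k := memory_kernel E dE in
    let qE t x := q t x / E 0 in
    L1 T (L2 L) (L2norm L) q ->
    L1 T (sobolev L r) (sobolev_norm L r) qE ->
    mixed_solution L T k Ih Ah lam (HH L) (L2 L) qE th w ga ->
    mixed_solution L T k Ih Ah lam (HHh L r s) (Qh L r s) qE thh wh gah ->
    (L1norm T (HH_norm L) (fun t => (th t \- thh t, w t \- wh t)%R)
       + L1norm T (L2norm L) (fun t => ga t \- gah t)%R
     <= (C * mesh_size s ^+ r)%:E * L1norm T (sobolev_norm L r) qE)%E.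
Proof.
have T0 := ltW T_gt0; have Lge := ltW L_gt0.
have em : 0 < epsmax <= epsmax by rewrite epsmax_gt0 lexx.
have x0 : (0 : R) \in `[0, L] by rewrite in_itv/= lexx.
(* Signs are read off the lower bounds: [E 0] from the one on the inertia, then [1 + nu] from the
   one on the area. *)
have E0 : 0 < E 0.
  have /andP[h _] := inertia_bnd epsmax 0 em x0.
  have := lt_le_trans CE1_gt0 h; rewrite pmulr_lgt0//.
  by rewrite divr_gt0 ?exprn_gt0// inertia_gt0.
have Ah_gt0 eps x : 0 < eps <= epsmax -> x \in `[0, L] ->
    0 < scaled_area ks (area eps) eps x.
  move=> he xL; have /andP[e0 _] := he.
  by rewrite divr_gt0// mulr_gt0// area_gt0.
pose g := E 0 / (2 * (1 + nu)).
have g0 : 0 < g.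
  have /andP[h _] := area_bnd epsmax 0 em x0.
  by have := lt_le_trans CG1_gt0 h; rewrite pmulr_lgt0// Ah_gt0.
have nu0 : 0 < 2 * (1 + nu) by rewrite -invr_gt0 -(pmulr_rgt0 _ E0).
have [M k_bnd'] := k_bnd.
(* At order [r + 2] the regularity estimate asks for the load in H^r, which is the hypothesis at
   hand. *)
have [Cr Cr0 hreg] := regularity r.+2 isT.
rewrite subn2 subn1 !succnK in hreg.
(* Bounds for [Ih] follow on dividing by [E 0]; [g * Ah] lies between [CG1] and [CG2], hence
   [1 / Ah] between [g / CG2] and [g / CG1]; lambda is largest at [epsmax]. None of these depends on
   [eps]. *)
have [C C0 herr] := @galerkin_error _ L L_gt0 r (CE1 / E 0) (CE2 / E 0) (g / CG2) (g / CG1)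
  (2 * (1 + nu) * epsmax ^+ 2) (divr_gt0 CE1_gt0 E0) (ltW (divr_gt0 CE2_gt0 E0))
  (divr_gt0 g0 CG2_gt0) (ltW (divr_gt0 g0 CG1_gt0))
  (ltW (mulr_gt0 nu0 (exprn_gt0 2 epsmax_gt0))) r_ge1.
exists (2 * C * Cr); first by rewrite !mulr_gt0.
move=> eps s q th w ga thh wh gah heps ps lam Ih Ah k qE qL qS sol solh.
have /andP[eps0 epsle] := heps.
have [thL wL gaL hle] := hreg eps q th w ga heps qL qS sol.
have mIh : measurable_fun `[0, L] Ih.
  by apply: measurable_funM; [exact: inertia_meas|exact: measurable_cst].
have mAh : measurable_fun `[0, L] Ah.
  apply: measurable_funM; last exact: measurable_cst.
  by apply: measurable_funM; [exact: measurable_cst|exact: area_meas].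
have hIh x : x \in `[0, L] -> CE1 / E 0 <= Ih x <= CE2 / E 0.
  move=> xL; have := inertia_bnd eps x heps xL.
  by rewrite ler_pdivrMr// ler_pdivlMr// [E 0 * _]mulrC.
have hAh x : x \in `[0, L] -> g / CG2 <= (Ah x)^-1 <= g / CG1.
  move=> xL; have := area_bnd eps x heps xL; have a0 := Ah_gt0 eps x heps xL.
  rewrite -/g -/Ah => /andP[h1 h2].
  rewrite ler_pdivrMr// ler_pdivlMr// mulrC ler_pdivlMr// h2.
  by rewrite mulrC ler_pdivrMr// h1.
have hlam : 0 < lam <= 2 * (1 + nu) * epsmax ^+ 2.
  rewrite mulr_gt0 ?exprn_gt0//= ler_wpM2l ?(ltW nu0)//.
  by rewrite lerXn2r ?nnegrE ?(ltW eps0) ?(ltW epsmax_gt0).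
have [V0 H0] := Vh0 L_gt0 ps r_ge1.
have HHh0 : HHh L r s (cst 0, cst 0) by split; split.
have Qh0 : Qh L r s (cst 0).
  split.
    apply/L2_sqint; apply: sqint_cst; first exact: measurable_itv.
    exact: itv_measure_lty.
  move=> i _; exists 0; first by rewrite size_poly0.
  by apply: nearW => x _; rewrite horner0.
have HHhH : HHh L r s `<=` HH L by move=> u [].
have QhL : Qh L r s `<=` L2 L by move=> u [].
have orth := galerkin_in_time L_gt0 (divr_gt0 CE1_gt0 E0) (ltW (divr_gt0 CE2_gt0 E0))
  mIh hIh T0 k_cont k_bnd' HHhH QhL Qh0 sol solh.
have [X' mX XX] := sobolev_norm_measurable (k := r.+2) L_gt0 thL.
have [Y' mY YY] := sobolev_norm_measurable (k := r.+2) L_gt0 wL.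
have [Z' mZ ZZ] := sobolev_norm_measurable (k := r.+1) L_gt0 gaL.
have K0 : 0 <= C * mesh_size s ^+ r.
  by rewrite mulr_ge0 ?(ltW C0)// exprn_ge0// mesh_ge0.
have mT : measurable (`[0, T]%classic : set R) by [].
apply: (le_trans (@integrate_error _ `[0, T]%classic (C * mesh_size s ^+ r)
  (fun t => HH_norm L (th t \- thh t, w t \- wh t)) (fun t => L2norm L (ga t \- gah t))
  (fun t => sobolev_norm L r.+2 (th t)) (fun t => sobolev_norm L r.+2 (w t))
  (fun t => sobolev_norm L r.+1 (ga t)) X' Y' Z' _ K0 _ _ _ _ _ mX mY mZ XX YY ZZ _)).
- exact: measurable_itv.
- by move=> t; exact: sqrtr_ge0.
- by move=> t; rewrite L2norm_nrm; exact: nrm_ge0.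
- by move=> t; exact: sqrtr_ge0.
- by move=> t; exact: sqrtr_ge0.
- by move=> t; exact: sqrtr_ge0.
- have [[[? _ thD] _] solE] := sol; have [[[? _ thhD] _] solhE] := solh.
  have [[? _ thS] _] := thL; have [[? _ wS] _] := wL; have [[? _ gaS] _] := gaL.
  have memb : {ae @lebesgue_measure R, forall t, t \in `[0, T] ->
      [/\ sobolev L r.+2 (th t), sobolev L r.+2 (w t) & sobolev L r.+1 (ga t)]}.
    by apply: filterS3 thS wS gaS => t h1 h2 h3 tT; split;
      [case: (h1 tT)|case: (h2 tT)|case: (h3 tT)].
  have dom : {ae @lebesgue_measure R, forall t, t \in `[0, T] ->
      (HH L `*` L2 L) (th t, w t, ga t) /\
      (HHh L r s `*` Qh L r s) (thh t, wh t, gah t)}.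
    by apply: filterS2 thD thhD => t h1 h2 tT; split; [case: (h1 tT)|case: (h2 tT)].
  have eqs : {ae @lebesgue_measure R, forall t, t \in `[0, T] -> forall psi, Qh L r s psi ->
      L2dot L (th t \- wderiv L (w t)) psi - lam * L2dot L (fun x => ga t x / Ah x) psi = 0 /\
      L2dot L (thh t \- wderiv L (wh t)) psi - lam * L2dot L (fun x => gah t x / Ah x) psi = 0}.
    apply: filterS2 solE solhE => t h1 h2 tT psi hpsi; split.
      by case: (h1 tT _ _ _ (HHhH _ HHh0) (QhL _ hpsi)).
    by case: (h2 tT _ _ _ HHh0 hpsi).
  have md : {ae @lebesgue_measure R, forall t, t \in `[0, T] ->
      [/\ sobolev L r.+2 (th t), sobolev L r.+2 (w t) & sobolev L r.+1 (ga t)] /\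
      (HH L `*` L2 L) (th t, w t, ga t) /\
      (HHh L r s `*` Qh L r s) (thh t, wh t, gah t)}.
    by apply: filterS2 memb dom => t h1 h2 tT; split; [exact: h1|exact: h2].
  (* At almost every time all membership, orthogonality and constraint properties hold together, and
     the steady estimate applies. *)
  apply: filterS3 md orth eqs => t h12 h3 h4 tT; have [h1 h2] := h12 tT.
  have [m1 m2 m3] := h1; have [d12 d34] := h2; case: (d12) => d1 d2; case: (d34) => d3 d4.
  have [q1 q2] := h3 tT; have e := h4 tT.
  apply: (herr s lam Ih Ah) => //.
  + by move=> psi /e[].
  + by move=> psi /e[].
- have -> : (2 * C * Cr * mesh_size s ^+ r)%:E =
      ((2 * (C * mesh_size s ^+ r))%:E * Cr%:E)%E.
    by rewrite -EFinM; congr EFin; ring.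
  by rewrite -muleA; apply: lee_wpmul2l => //; rewrite lee_fin mulr_ge0.
Qed.
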